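(* Let $d\ge 1$ and $s_0>d/2$. There exist $\varepsilon_0\in(0,1)$ and constants $\mathtt{C}\ge \mathtt{M}>0$ (absolute constants in the sense explained in the context) such that for every integer $p\ge 1$, every real $s_1\ge s_0+2$, every $0<\varepsilon\le\varepsilon_0$, every real $s\ge s_1+1$ and every $u_0\in H^{s}(\mathbb{T}^d;\mathbb{C})$ satisfying \[ \|u_0\|_{H^{s_1}}\le \varepsilon,\qquad (2\mathtt{M})^{s_1}\|u_0\|_{L^2}\le \varepsilon,\qquad \|u_0\|_{H^s}<+\infty, \] the following holds. There exist a time $T=T(u_0,\mathtt{M},s_1)>0$ and a unique solution $u(t)$ of \[ \mathrm{i}u_t-\Delta u\pm|u|^{2p}u=0,\qquad x\in\mathbb{T}^d, \] (for either choice of the sign) with $u(0)=u_0$, such that \[ u\in C^0([0,T];H^s(\mathbb{T}^d;\mathbb{C}))\cap C^1([0,T];H^{s-2}(\mathbb{T}^d;\mathbb{C})), \qquad T\ge T_{good}:=\frac{1}{\varepsilon^{2p}}\,\frac{1}{2^{4(2p+2)}}\,\frac{2^{2p(s_1-s_0)}}{\mathtt{M}^{2ps_0}} . \] Moreover, for every $t\in[0,T]$, \[ \|u(t)\|_{H^s}\le 3\,\mathtt{C}^{ps(s-s_1)}\Big(\|u_0\|_{H^s}+(2\mathtt{M})^{s}\|u_0\|_{L^2}\Big)\Big[1+\Big(\mathtt{M}^{2p(s-s_1)}\frac{2^{4p}\mathtt{M}^{2ps_0}}{2^{2p(s_1-s_0)}}\,\varepsilon^{2p}\,t\Big)^{s-s_1}\Big],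 \] and, as a consequence, for every $\widehat{T}\le T_{good}$, \[ \sup_{t\in[0,\widehat{T}]}\|u(t)\|_{H^s}\le 3\,\mathtt{C}^{ps(s-s_1)}\Big(\|u_0\|_{H^s}+(2\mathtt{M})^{s}\|u_0\|_{L^2}\Big)\Big(1+\mathtt{M}^{2p(s-s_1)^2}\Big). \]
   Context: $\mathbb{T}^d=(\mathbb{R}/2\pi\mathbb{Z})^d$. The Laplacian acts by $\Delta e^{\mathrm{i}j\cdot x}=-|j|^2e^{\mathrm{i}j\cdot x}$, $j\in\mathbb{Z}^d$, with $|j|$ the Euclidean norm. The Sobolev norm is $\|u\|_{H^s}:=\|u\|_{L^2}+\|(\sqrt{-\Delta})^su\|_{L^2}$, where $(\sqrt{-\Delta})^se^{\mathrm{i}j\cdot x}=|j|^se^{\mathrm{i}j\cdot x}$. ''Absolute constants'' means constants depending at most on the fixed parameters $d$ and $s_0$; in particular not on $\varepsilon,p,s_1,s,u_0$. *)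

(* Defs.v *)
From HB Require Import structures.
From mathcomp Require Import all_boot all_order all_algebra.
From mathcomp Require Import all_classical all_reals all_analysis.
From mathcomp Require Export complex.
Import Order.TTheory GRing.Theory Num.Theory numFieldNormedType.Exports.

Set Implicit Arguments.
Unset Strict Implicit.
Unset Printing Implicit Defensive.

Local Open Scope classical_set_scope.
Local Open Scope ring_scope.

(* Functions on T^d = (R/2piZ)^d are represented by functions on R^d, i.e. on
   d.-tuples of reals; only their values on the fundamental domain [0, 2pi[^d
   matter, because everything below is expressed through the measure
   [torus_measure], the d-dimensional Lebesgue measure concentrated on that
   domain.  Elements of L^2 and H^s are functions up to a.e. equality. *)
Section torus_measure.
Context {R : realType}.

Local Notation RR := (measurableTypeR R).

Definition period : set RR := `[0, 2 * pi[%classic.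

Lemma measurable_period : measurable period.
Proof. exact: measurable_itv. Qed.

Definition circle_measure : set RR -> \bar R :=
  mrestr (@lebesgue_measure R) measurable_period.

HB.instance Definition _ := Measure.on circle_measure.

Lemma circle_measure_fin : fin_num_fun circle_measure.
Proof.
apply: lty_fin_num_fun.
suff : (lebesgue_measure period < +oo)%E.
  by rewrite -[period in X in X -> _]setTI.
by rewrite /period lebesgue_measure_itv/=; case: ifP => _; rewrite ltry.
Qed.

HB.instance Definition _ :=
  Measure_isFinite.Build _ _ _ circle_measure circle_measure_fin.

Definition ptcons n (z : RR * n.-tuple RR) : n.+1.-tuple RR :=
  cons_tuple z.1 z.2.

Lemma measurable_ptcons n : measurable_fun [set: RR * n.-tuple RR] (@ptcons n).
Proof.
apply: (@measurable_cons _ _ _ _ fst n snd).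
- exact: measurable_fst.
- exact: measurable_snd.
Qed.

Definition torus_step n (mu : {finite_measure set (n.-tuple RR) -> \bar R}) :
  set (n.+1.-tuple RR) -> \bar R :=
  pushforward (circle_measure \x mu)%E (@ptcons n).

Section torus_step.
Variables (n : nat) (mu : {finite_measure set (n.-tuple RR) -> \bar R}).

Let torus_step0 : torus_step mu set0 = 0%E.
Proof. by rewrite /torus_step /pushforward preimage_set0 measure0. Qed.

Let torus_step_ge0 A : (0 <= torus_step mu A)%E.
Proof. by apply: measure_ge0; exact: measurable_ptcons. Qed.

Let torus_step_sigma_additive : semi_sigma_additive (torus_step mu).
Proof.
by apply: measure_semi_sigma_additive; exact: measurable_ptcons.
Qed.

HB.instance Definition _ := isMeasure.Build _ _ _ (torus_step mu)
  torus_step0 torus_step_ge0 torus_step_sigma_additive.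

Let torus_step_fin : fin_num_fun (torus_step mu).
Proof.
apply: lty_fin_num_fun; rewrite /= /torus_step /pushforward preimage_setT.
rewrite -setXTT product_measure1E//.
by rewrite ltey_eq fin_numM//; exact: fin_num_measure.
Qed.

HB.instance Definition _ :=
  Measure_isFinite.Build _ _ _ (torus_step mu) torus_step_fin.

End torus_step.

Fixpoint torus_measure d : {finite_measure set (d.-tuple RR) -> \bar R} :=
  match d with
  | 0 => \d_([tuple] : 0.-tuple RR)
  | n.+1 => torus_step (torus_measure n)
  end.

End torus_measure.
Arguments torus_measure {R} d.

Notation point R d := (d.-tuple (measurableTypeR R)).

Definition torus_fun (R : realType) (d : nat) : Type := point R d -> R[i].

Section sobolev.
Context {R : realType} {d : nat}.

Local Notation mu := (@torus_measure R d).

Implicit Types (f g : torus_fun R d) (j : d.-tuple int).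

Definition cmeasurable f : Prop :=
  measurable_fun setT (fun x => complex.Re (f x) : R) /\
  measurable_fun setT (fun x => complex.Im (f x) : R).

Definition L2norm f : \bar R :=
  Lnorm mu 2%:E (fun x => (Normc.normc (f x))%:E).

Definition inL2 f : Prop := cmeasurable f /\ (L2norm f < +oo)%E.

Definition plane_wave j (x : point R d) : R[i] :=
  let theta : R := \sum_(k < d) (tnth j k)%:~R * tnth x k in
  (cos theta +i* sin theta)%C.

Definition cintegral f : R[i] :=
  ((\int[mu]_x complex.Re (f x)) +i* (\int[mu]_x complex.Im (f x)))%C.

Definition fourier_coef f j : R[i] :=
  (((2 * pi) ^+ d)^-1)%:C%C * cintegral (fun x => f x * (plane_wave j x)^*%C).

Definition freq_norm j : R := Num.sqrt (\sum_(k < d) (tnth j k)%:~R ^+ 2).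

(* [fourier_multiplier m f g]: for f in L^2, the operator acting by
   e^{ij.x} |-> m(j) e^{ij.x} maps f to g, and g lies in L^2. *)
Definition fourier_multiplier (m : d.-tuple int -> R) f g : Prop :=
  inL2 g /\ forall j, fourier_coef g j = (m j)%:C%C * fourier_coef f j.

Definition is_laplacian f g : Prop :=
  fourier_multiplier (fun j => - freq_norm j ^+ 2) f g.

Definition is_sqrt_laplacian (s : R) f g : Prop :=
  fourier_multiplier (fun j => freq_norm j `^ s) f g.

(* (sqrt(-Delta))^s f is unique up to a.e. equality, so the infimum ranges over
   at most one value; it is +oo when (sqrt(-Delta))^s f is not in L^2. *)
Definition Hnorm (s : R) f : \bar R :=
  (L2norm f + ereal_inf [set L2norm g | g in is_sqrt_laplacian s f])%E.

Definition inH (s : R) f : Prop := inL2 f /\ (Hnorm s f < +oo)%E.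

Definition C0H (T s : R) (u : R -> torus_fun R d) : Prop :=
  forall t, t \in `[0, T] ->
    inH s (u t) /\
    Hnorm s (fun x => u t' x - u t x) @[t' --> within `[0, T] (nbhs t)]
      --> 0%E.

(* One-sided derivatives at the endpoints of [0, T]. *)
Definition derivH (T s : R) (u ut : R -> torus_fun R d) : Prop :=
  forall t, t \in `[0, T] ->
    Hnorm s (fun x => ((t' - t)^-1)%:C%C * (u t' x - u t x) - ut t x)
      @[t' --> within `[0, T] (t^')] --> 0%E.

Definition C1H (T s : R) (u ut : R -> torus_fun R d) : Prop :=
  [/\ C0H T s u, C0H T s ut & derivH T s u ut].

(* i u_t - Delta u + (-1)^sgn |u|^{2p} u = 0 on [0, T], u(0) = u0, with
   u in C^0([0,T]; H^s) and in C^1([0,T]; H^{s-2}). *)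
Definition NLS_solution (sgn : bool) (p : nat) (T s : R)
    (u0 : torus_fun R d) (u : R -> torus_fun R d) : Prop :=
  [/\ C0H T s u,
      u 0 = u0 %[ae mu] &
      exists2 ut : R -> torus_fun R d, C1H T (s - 2) u ut &
        forall t, t \in `[0, T] ->
          exists2 Lu, is_laplacian (u t) Lu &
            \forall x \ae mu,
              'i%C * ut t x - Lu x
                + (-1) ^+ sgn * (`|u t x| ^+ (2 * p) * u t x) = 0].

End sobolev.

Definition T_good {R : realType} (s0 M : R) (p : nat) (s1 eps : R) : R :=
  (eps ^+ (2 * p))^-1 * (2 ^+ (4 * (2 * p + 2)))^-1 *
  (2 `^ (2 * p%:R * (s1 - s0)) / M `^ (2 * p%:R * s0)).

(* Main.v *)
(** Everything happens on the Fourier side.  In the interaction picture,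
    [u^(t, j) = exp (i |j|^2 t) b(t, j)] and [b] solves an ODE whose right-hand
    side is the nonlinear term up to unimodular factors.  A function whose
    coefficients are absolutely summable with sum [A] satisfies
    [||u|^(2p) u|_(H^q) <= (8 * 4^q)^p A^(2p) |u|_(H^q)].  Interpolating [H^s0]
    between [L^2] and [H^s1] with weight [2 M] turns the two smallness
    assumptions into [A <= K eps (2 M)^(s0 - s1)], hence
    [T_good * A^(2p) <= K^(2p) 2^(-8p-8) M^(-2 p s1)]; for [M] large with respect
    to [K], which depends only on [d] and [s0], this beats the factors
    [(8 * 4^s1)^p], so Picard's iteration converges in [L^2] on the whole of
    [0, T_good], with [H^s1] bounds.  The [H^s] norm is propagated with the tame
    estimate, in which high frequencies carry the constant [32^p], independent
    of [s], and the other term loses one derivative; interpolating the latter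
    with a parameter proportional to [t] gives the polynomial growth without
    Gronwall's inequality.  That the Fourier coefficients determine a function
    is proved by approximating indicator functions of arcs by trigonometric
    polynomials. *)
Require Import Defs.
From mathcomp Require Import all_boot all_order all_algebra.
From mathcomp Require Import all_classical all_reals all_analysis.
From mathcomp Require Import measurable_realfun ring lra zify.
Import Order.TTheory GRing.Theory Num.Theory numFieldNormedType.Exports.

Set Implicit Arguments.
Unset Strict Implicit.
Unset Printing Implicit Defensive.

Local Open Scope classical_set_scope.
Local Open Scope ring_scope.
Local Notation Re := complex.Re.
Local Notation Im := complex.Im.
Local Notation normc := Normc.normc.
Local Notation tpoint R d := (d.-tuple (measurableTypeR R)).

(** On coefficients the free flow is multiplication by unimodular numbers: it preserves every
    weighted bound, and the vector field left in the interaction picture loses no derivative. Norms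
    enter as squared sums tested on finite sets of frequencies; such bounds survive coefficientwise
    limits, and a mean value inequality for finite weighted sums replaces vector-valued integration.
    The contraction takes place in $L^2$ only, where the Lipschitz constant involves the $\ell^1$
    bound alone; higher norms are mere bounds, propagated along the iterates and inherited by the
    limit. The iteration and the time are thus fixed before $s$ is chosen. The crude product
    estimate cannot give the $H^s$ bound on this interval: its factor $4^{ps}$ grows with $s$ while
    $T_{good}$ depends on $s_1$ only. All losses are $p$-th powers or powers with exponent
    proportional to $ps_1$ or $ps$, so a single $M$ works for all $p$, $s_1$ and $s$. In the
    uniqueness part the competitor is an arbitrary solution, known only through Sobolev continuity
    and an a.e. equation; its coefficients are shown to solve the same ODE. *)

Section ComplexParts.
Context {R : realType}.
Implicit Types z w : R[i].

Lemma ReD z w : Re (z + w) = Re z + Re w. Proof. by case: z w => ? ? []. Qed.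
Lemma ImD z w : Im (z + w) = Im z + Im w. Proof. by case: z w => ? ? []. Qed.
Lemma ReN z : Re (- z) = - Re z. Proof. by case: z. Qed.
Lemma ImN z : Im (- z) = - Im z. Proof. by case: z. Qed.
Lemma ReB z w : Re (z - w) = Re z - Re w. Proof. by rewrite ReD ReN. Qed.
Lemma ImB z w : Im (z - w) = Im z - Im w. Proof. by rewrite ImD ImN. Qed.
Lemma Re_mul z w : Re (z * w) = Re z * Re w - Im z * Im w.
Proof. by case: z w => ? ? []. Qed.
Lemma Im_mul z w : Im (z * w) = Re z * Im w + Im z * Re w.
Proof. by case: z w => ? ? []. Qed.
Lemma Re_conj z : Re z^*%C = Re z. Proof. by case: z. Qed.
Lemma Im_conj z : Im z^*%C = - Im z. Proof. by case: z. Qed.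
Lemma Re_sum (I : Type) (r : seq I) (P : pred I) (F : I -> R[i]) :
  Re (\sum_(i <- r | P i) F i) = \sum_(i <- r | P i) Re (F i).
Proof. exact: (big_morph _ ReD). Qed.
Definition reimE := (ReB, ImB, ReD, ImD, ReN, ImN, Re_mul, Im_mul, Re_conj, Im_conj).

Lemma complexP z w : Re z = Re w -> Im z = Im w -> z = w.
Proof. by case: z w => ? ? [? ?] /= -> ->. Qed.

(** The squared modulus is preferred to [normc]: it is a polynomial in the real and imaginary parts,
    hence within reach of [ring] and [nra], and its measurability and integrals involve no square
    root. *)
Definition sqc z : R := Re z ^+ 2 + Im z ^+ 2.

Lemma sqc_ge0 z : 0 <= sqc z.
Proof. by rewrite addr_ge0// sqr_ge0. Qed.

Lemma sqc0 : sqc 0 = 0.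
Proof. by rewrite /sqc/= expr0n addr0. Qed.

Lemma sqc_eq0 z : sqc z = 0 -> z = 0.
Proof.
move=> /eqP; rewrite paddr_eq0 ?sqr_ge0// !sqrf_eq0 => /andP[/eqP a /eqP b].
exact: complexP.
Qed.

Lemma sqcM z w : sqc (z * w) = sqc z * sqc w.
Proof. by rewrite /sqc !reimE; ring. Qed.

Lemma sqcJ z : sqc z^*%C = sqc z.
Proof. by rewrite /sqc !reimE sqrrN. Qed.

Lemma sqcN z : sqc (- z) = sqc z.
Proof. by rewrite /sqc !reimE !sqrrN. Qed.

Lemma sqcB z w : sqc (z - w) = sqc (w - z).
Proof. by rewrite -sqcN opprB. Qed.

Lemma sqcR (r : R) : sqc r%:C%C = r ^+ 2.
Proof. by rewrite /sqc/= expr0n addr0. Qed.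

Lemma sqcD_le z w : sqc (z + w) <= 2 * (sqc z + sqc w).
Proof.
rewrite /sqc !reimE.
have := sqr_ge0 (Re z - Re w); have := sqr_ge0 (Im z - Im w); nra.
Qed.

Lemma sqcB_le z w : sqc (z - w) <= 2 * (sqc z + sqc w).
Proof. by have := sqcD_le z (- w); rewrite sqcN. Qed.

Lemma normcE z : normc z = Num.sqrt (sqc z).
Proof. by case: z. Qed.

Lemma normc_ge0 z : 0 <= normc z.
Proof. by rewrite normcE sqrtr_ge0. Qed.

Lemma sqr_normcE z : normc z ^+ 2 = sqc z.
Proof. by rewrite normcE sqr_sqrtr// sqc_ge0. Qed.

Lemma normcJ z : normc z^*%C = normc z.
Proof. by rewrite !normcE sqcJ. Qed.

Lemma ler_normcD z w : normc (z + w) <= normc z + normc w.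
Proof. exact: (le_normcD z w). Qed.

Lemma normc_sum (I : Type) (r : seq I) (F : I -> R[i]) :
  normc (\sum_(i <- r) F i) <= \sum_(i <- r) normc (F i).
Proof.
elim: r => [|i r ih]; first by rewrite !big_nil Normc.normc0.
by rewrite !big_cons (le_trans (ler_normcD _ _))// lerD2l.
Qed.

Lemma sqc_normc_le z (A : R) : 0 <= A -> (sqc z <= A ^+ 2) = (normc z <= A).
Proof. by move=> A0; rewrite -sqr_normcE ler_sqr// nnegrE normc_ge0. Qed.

Lemma Re_le_normc z : `|Re z| <= normc z.
Proof.
by rewrite normcE -sqrtr_sqr ler_sqrt ?sqc_ge0// /sqc lerDl sqr_ge0.
Qed.

Lemma Im_le_normc z : `|Im z| <= normc z.
Proof.
by rewrite normcE -sqrtr_sqr ler_sqrt ?sqc_ge0// /sqc lerDr sqr_ge0.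
Qed.

Lemma normc_normrB z w : `|normc z - normc w| <= normc (z - w).
Proof.
have h (x y : R[i]) : normc x - normc y <= normc (x - y).
  by have := ler_normcD (x - y) y; rewrite subrK lerBlDr.
by rewrite ler_norml h andbT lerNl opprB (le_trans (h _ _))// !normcE sqcB.
Qed.

End ComplexParts.

(** * Bounds on finite partial sums *)

Section FiniteSumBounds.
Context {R : realType}.

(* Sums of nonnegative families over [Z^d] only ever occur through the bounds
   that their finite partial sums satisfy. *)
Definition sumB (I : eqType) (F : I -> R) (B : R) : Prop :=
  forall K : seq I, uniq K -> \sum_(i <- K) F i <= B.

Context {I : eqType}.
Implicit Types (F G : I -> R) (K : seq I).

Lemma sumB_ge0 F B : sumB F B -> 0 <= B.
Proof. by move=> /(_ [::] isT); rewrite big_nil. Qed.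

Lemma sumB_le F G A B : sumB G A -> (forall i, F i <= G i) -> A <= B -> sumB F B.
Proof.
by move=> GA FG AB K uK; rewrite (le_trans _ AB)// (le_trans _ (GA _ uK))// ler_sum.
Qed.

Lemma sumBD F G A B : sumB F A -> sumB G B -> sumB (fun i => F i + G i) (A + B).
Proof. by move=> FA GB K uK; rewrite big_split/= lerD ?FA ?GB. Qed.

Lemma sumBZ F A c : 0 <= c -> sumB F A -> sumB (fun i => c * F i) (c * A).
Proof. by move=> c0 FA K uK; rewrite -big_distrr/= ler_wpM2l// FA. Qed.

Lemma sumB_single F A i : sumB F A -> F i <= A.
Proof. by move=> /(_ [:: i] isT); rewrite big_seq1. Qed.

Lemma ler_sum_sub F K K' : uniq K -> uniq K' -> {subset K <= K'} ->
  (forall i, 0 <= F i) -> \sum_(i <- K) F i <= \sum_(i <- K') F i.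
Proof.
move=> uK uK' sub F0.
rewrite [leRHS](bigID [in K])/= -[leLHS]addr0 lerD ?sumr_ge0//.
rewrite -[leRHS]big_filter le_eqVlt; apply/orP; left; apply/eqP/perm_big.
apply: uniq_perm; rewrite ?filter_uniq//.
by move=> i; rewrite mem_filter; case: (boolP (i \in K)) => // /sub ->.
Qed.

Lemma sumB_inj (J : eqType) F A (h : J -> I) : injective h -> sumB F A ->
  sumB (F \o h) A.
Proof.
by move=> hi FA K uK; rewrite -(big_map h xpredT F) FA// map_inj_uniq.
Qed.

Lemma sumB_subadd (F : I -> R) (e A : R) (J K : seq I) :
  sumB F A -> uniq J -> A - e <= \sum_(i <- J) F i -> uniq K ->
  (forall i, i \in K -> i \notin J) -> \sum_(i <- K) F i <= e.
Proof.
move=> FA uJ Je uK JK.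
have /FA : uniq (J ++ K).
  by rewrite cat_uniq uJ uK andbT/=; apply/hasPn => i /JK.
by rewrite big_cat/=; lra.
Qed.

(* The sum splits over a finite set carrying all but [e] of the mass. *)
Lemma sumB_tail F A e : sumB F A -> 0 < e ->
  exists2 J, uniq J & forall K, uniq K -> (forall i, i \in K -> i \notin J) ->
    \sum_(i <- K) F i <= e.
Proof.
move=> FA e0.
(* The given bound [A] need not be sharp; the supremum of the partial sums is approached by some [J]
   up to [e]. *)
pose S := [set \sum_(i <- K) F i | K in [set K | uniq K]].
have hS : has_sup S.
  split; first by exists (\sum_(i <- [::]) F i), [::].
  by exists A => _ [K uK <-]; exact: FA.
have [_ [J uJ <-] SJ] := sup_adherent e0 hS.
exists J => // K uK; apply: (@sumB_subadd _ e (sup S)) => //; last exact: ltW.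
by move=> L uL; apply: ub_le_sup; [case: hS|exists L].
Qed.

End FiniteSumBounds.

(** * Young's inequalities for discrete convolutions, [sub k j] playing the role of $k-j$ *)

Section Young.
Context {R : realType} {I : eqType} (sub : I -> I -> I).
Hypothesis subI : forall k, injective (sub k).
Hypothesis subIl : forall j, injective (sub^~ j).
Implicit Types (a b : I -> R) (J K : seq I).

Lemma sum_mul_sq_le (T : Type) (s : seq T) (w x : T -> R) :
  (forall i, 0 <= w i) ->
  (\sum_(i <- s) w i * x i) ^+ 2 <=
  (\sum_(i <- s) w i) * (\sum_(i <- s) w i * x i ^+ 2).
Proof.
move=> w0; elim: s => [|i s ih]; first by rewrite !big_nil expr0n mul0r.
rewrite !big_cons; move: ih.
set S := \sum_(j <- s) w j * x j; set W := \sum_(j <- s) w j.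
set Q := \sum_(j <- s) _ => ih.
have W0 : 0 <= W by exact: sumr_ge0.
have Q0 : 0 <= Q by apply: sumr_ge0 => j _; rewrite mulr_ge0// sqr_ge0.
(* Adding one term of weight [w i] leaves exactly this cross term. It follows from $(Wx_i-S)^2\ge 0$
   and $S^2\le WQ$ after multiplication by $W$; if $W=0$ then $S=0$. *)
suff : 2 * S * x i <= W * x i ^+ 2 + Q by have := w0 i; nra.
have [W00|W00] := eqVneq W 0.
  have S0 : S = 0.
    by apply/eqP; rewrite -sqrf_eq0 eq_le sqr_ge0 andbT (le_trans ih)// W00 mul0r.
  by rewrite S0 mulr0 mul0r W00 mul0r add0r.
have Wp : 0 < W by rewrite lt_neqAle eq_sym W00.
rewrite -(ler_pM2l Wp).
have := sqr_ge0 (W * x i - S); nra.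
Qed.

(** Cauchy-Schwarz with the weights [a] bounds each square by $A\sum_j a_j b_{k-j}^2$; after
    exchanging the sums, $k\mapsto k-j$ is injective and the inner sum is at most [B]. *)
Lemma Young_left a b A B J K : (forall i, 0 <= a i) -> (forall i, 0 <= b i) ->
  sumB a A -> sumB (fun i => b i ^+ 2) B -> uniq J -> uniq K ->
  \sum_(k <- K) (\sum_(j <- J) a j * b (sub k j)) ^+ 2 <= A ^+ 2 * B.
Proof.
move=> a0 b0 aA bB uJ uK; have A0 := sumB_ge0 aA; have B0 := sumB_ge0 bB.
have SJ : \sum_(j <- J) a j <= A by exact: aA.
apply: (@le_trans _ _ (\sum_(k <- K) A * \sum_(j <- J) a j * b (sub k j) ^+ 2)).
  apply: ler_sum => k _; rewrite (le_trans (sum_mul_sq_le _ _ _))// ler_wpM2r//.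
  by apply: sumr_ge0 => j _; rewrite mulr_ge0// sqr_ge0.
rewrite -big_distrr/= expr2 -mulrA ler_wpM2l// exchange_big/=.
apply: (@le_trans _ _ (\sum_(j <- J) a j * B)).
  apply: ler_sum => j _; rewrite -big_distrr/= ler_wpM2l//.
  by apply: (@sumB_inj _ _ _ _ _ (sub^~ j) _ bB K uK).
by rewrite -big_distrl/= ler_wpM2r.
Qed.

Lemma Young_right a b A B J K : (forall i, 0 <= a i) -> (forall i, 0 <= b i) ->
  sumB (fun i => a i ^+ 2) A -> sumB b B -> uniq J -> uniq K ->
  \sum_(k <- K) (\sum_(j <- J) a j * b (sub k j)) ^+ 2 <= A * B ^+ 2.
Proof.
move=> a0 b0 aA bB uJ uK; have A0 := sumB_ge0 aA; have B0 := sumB_ge0 bB.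
have bJ k : \sum_(j <- J) b (sub k j) <= B.
  by apply: (@sumB_inj _ _ _ _ _ (sub k) _ bB J uJ).
apply: (@le_trans _ _ (\sum_(k <- K) B * \sum_(j <- J) b (sub k j) * a j ^+ 2)).
  apply: ler_sum => k _; under eq_bigr do rewrite mulrC.
  rewrite (le_trans (sum_mul_sq_le _ _ _))// ler_wpM2r//.
  by apply: sumr_ge0 => j _; rewrite mulr_ge0// sqr_ge0.
rewrite -big_distrr/= expr2 mulrA mulrC ler_wpM2r// exchange_big/=.
apply: (@le_trans _ _ (\sum_(j <- J) a j ^+ 2 * B)).
  apply: ler_sum => j _; rewrite -big_distrl/= mulrC ler_wpM2l ?sqr_ge0//.
  by apply: (@sumB_inj _ _ _ _ _ (sub^~ j) _ bB K uK).
by rewrite -big_distrl/= ler_wpM2r// aA.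
Qed.

Lemma Young_l1 a b A B J K : (forall i, 0 <= a i) -> (forall i, 0 <= b i) ->
  sumB a A -> sumB b B -> uniq J -> uniq K ->
  \sum_(k <- K) \sum_(j <- J) a j * b (sub k j) <= A * B.
Proof.
move=> a0 b0 aA bB uJ uK; have A0 := sumB_ge0 aA; have B0 := sumB_ge0 bB.
rewrite exchange_big/= (@le_trans _ _ (\sum_(j <- J) a j * B))//.
  apply: ler_sum => j _; rewrite -big_distrr/= ler_wpM2l//.
  by apply: (@sumB_inj _ _ _ _ _ (sub^~ j) _ bB K uK).
by rewrite -big_distrl/= ler_wpM2r// aA.
Qed.

End Young.

(** * Integration over the torus *)

Lemma bounded_integrable d (T : measurableType d) (R : realType)
    (mu : {finite_measure set T -> \bar R}) (f : T -> R) (A : R) :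
  measurable_fun setT f -> (forall x, `|f x| <= A) ->
  mu.-integrable setT (EFin \o f).
Proof.
move=> mf fA; apply: measurable_bounded_integrable => //.
  by rewrite ltey_eq fin_num_measure.
exists A; split; first exact: num_real.
by move=> r Ar x _; exact: (le_trans (fA x) (ltW Ar)).
Qed.

Section CircleIntegral.
Context {R : realType}.

Local Notation RR := (measurableTypeR R).

Lemma pi2_gt0 : 0 < 2 * pi :> R.
Proof. by rewrite mulr_gt0// pi_gt0. Qed.

Lemma cosDintpi (m : int) (x : R) : cos (m%:~R * (2 * pi) + x) = cos x.
Proof.
have h n (y : R) : cos (n%:R * (2 * pi) + y) = cos y.
  by rewrite mulr_natl [2 * _]mulr_natl addrC (periodicn (@cosD2pi R)).
case: m => n; first by rewrite -pmulrn h.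
by rewrite NegzE mulrNz mulNr -pmulrn -[LHS](h n.+1) addrA subrr add0r.
Qed.

Lemma sinDintpi (m : int) (x : R) : sin (m%:~R * (2 * pi) + x) = sin x.
Proof. by rewrite -!cosBpihalf -addrA cosDintpi. Qed.

Lemma continuous_cos_affine (b a : R) : continuous (fun x : R => cos (b * x + a)).
Proof.
move=> x.
apply: (@continuous_comp _ _ _ (fun x => b * x + a) cos); last exact: continuous_cos.
by apply: cvgD; [apply: cvgM; [exact: cvg_cst|exact: cvg_id]|exact: cvg_cst].
Qed.

Lemma measurable_cos_affine (b a : R) :
  measurable_fun [set: RR] (fun x : R => cos (b * x + a)).
Proof. by apply: continuous_measurable_fun; exact: continuous_cos_affine. Qed.

(** The fundamental theorem of calculus is applied on a closed segment, while [circle_measure] is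
    carried by the half-open period; the endpoint is Lebesgue negligible. *)
Lemma circle_integral (f : RR -> R) : measurable_fun [set: RR] f ->
  (\int[circle_measure]_(x in [set: RR]) (f x)%:E)%E =
  (\int[lebesgue_measure]_(x in `[0%R, (2 * pi)%R]) (f x)%:E)%E.
Proof.
move=> mf.
transitivity (\int[circle_measure]_(x in period) (f x)%:E)%E.
  rewrite [RHS]integral_mkcond; apply: ae_eq_integral => //.
  - exact/measurable_EFinP.
  - apply/measurable_restrict => //; first exact: measurable_period.
    by apply/measurable_EFinP; exact: measurable_funTS.
  exists (~` period); split.
  - by apply: measurableC; exact: measurable_period.
  - by rewrite /= /circle_measure /mrestr setICl measure0.
  - by move=> x /= h hp; apply: h => _; rewrite patchE mem_set.
rewrite -integral_itv_bndo_bndc; last first.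
  by apply/measurable_EFinP; exact: measurable_funTS.
apply: eq_measure_integral => A mA Ap.
by rewrite /= /circle_measure /mrestr setIidl.
Qed.

(** The shift [a] covers the sine as well as the cosine, and will absorb the phase of the other
    coordinates in higher dimension. *)
Lemma circle_integral_cos (m : int) (a : R) :
  (\int[circle_measure]_(x in [set: RR]) (cos (m%:~R * x + a))%:E)%E =
  (if m == 0 then 2 * pi * cos a else 0)%:E.
Proof.
rewrite circle_integral; last exact: measurable_cos_affine.
case: ifPn => [/eqP ->|m0].
  rewrite (eq_integral (fun=> (cos a)%:E)); last first.
    by move=> x _; rewrite mul0r add0r.
  by rewrite integral_cst//= lebesgue_measure_itv/= lte_fin pi2_gt0 oppr0 adde0
             -EFinM mulrC.
have m0' : m%:~R != 0 :> R by rewrite intr_eq0.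
pose F (x : R) : R := m%:~R^-1 * sin (m%:~R * x + a).
have dF (x : R) : is_derive x (1 : R) F (cos (m%:~R * x + a)).
  have h1 : is_derive x (1 : R) (fun y : R => m%:~R * y + a) (m%:~R : R).
    by apply: is_derive_eq; rewrite addr0 [LHS]mulr1.
  have h2 := @is_derive1_comp R sin (fun y : R => m%:~R * y + a) x _ _
    (is_derive_sin _) h1.
  have h3 := @is_deriveZ _ _ _ _ (m%:~R^-1 : R) _ _ _ h2.
  apply: is_derive_eq h3 _.
  by rewrite /= -[LHS]/(_ * _) mulrCA mulVf// mulr1.
have cF : continuous F.
  by move=> x; apply/differentiable_continuous/derivable1_diffP; case: (dF x).
rewrite (@continuous_FTC2 _ _ F).
- by rewrite /F sinDintpi mulr0 add0r subee.
- exact: pi2_gt0.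
- by apply: continuous_subspaceT; exact: continuous_cos_affine.
- split; first by move=> x _; case: (dF x).
  + by apply: cvg_at_right_filter; exact: cF.
  + by apply: cvg_at_left_filter; exact: cF.
- by move=> x _; rewrite derive1E; case: (dF x).
Qed.

End CircleIntegral.

Section TorusIntegral.
Context {R : realType}.

Local Notation RR := (measurableTypeR R).

Definition phase d (j : d.-tuple int) (x : tpoint R d) : R :=
  \sum_(k < d) (tnth j k)%:~R * tnth x k.

Lemma measurable_phase d (j : d.-tuple int) : measurable_fun setT (phase j).
Proof.
apply: measurable_sum => k; apply: measurable_funM => //.
exact: measurable_tnth.
Qed.

Lemma measurable_cos_phase d (j : d.-tuple int) (a : R) :
  measurable_fun setT (fun x => cos (phase j x + a)).
Proof.
rewrite (_ : (fun _ => _) = (fun y : R => cos (1 * y + a)) \o phase j); last first.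
  by apply/funext => x /=; rewrite mul1r.
exact: measurableT_comp (measurable_cos_affine 1 a) (measurable_phase j).
Qed.

Lemma phaseS d (j : d.+1.-tuple int) (z : RR * tpoint R d) :
  phase j (ptcons z) = (thead j)%:~R * z.1 + phase [tuple of behead j] z.2.
Proof.
rewrite /phase big_ord_recl /thead; congr (_ * _ + _).
apply: eq_bigr => k _; rewrite /ptcons tnthS; congr (_%:~R * _).
by rewrite [in LHS](tuple_eta j) tnthS.
Qed.

Lemma torus_integralS d (f : tpoint R d.+1 -> R) (A : R) :
  measurable_fun setT f -> (forall x, `|f x| <= A) ->
  (\int[torus_measure d.+1]_x (f x)%:E =
   \int[torus_measure d]_y \int[circle_measure]_x (f (ptcons (x, y)))%:E)%E.
Proof.
move=> mf fA.
have mcf : measurable_fun [set: RR * tpoint R d] (f \o @ptcons R d).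
  by apply: measurableT_comp => //; exact: measurable_ptcons.
have mnf : measurable_fun [set: RR * tpoint R d] (fun z => `|f (ptcons z)|).
  exact: measurableT_comp mcf.
have If : (circle_measure \x torus_measure d)%E.-integrable setT
    (EFin \o (f \o @ptcons R d)).
  apply/integrableP; split; first by apply/measurable_EFinP.
  rewrite fubini_tonelli1//=; last first.
    by apply/measurable_EFinP.
  apply: (@le_lt_trans _ _ (\int[circle_measure]_(x in [set: RR])
      ((A%:E * torus_measure d setT)))%E).
    apply: ge0_le_integral => //.
    - by move=> x _; exact: integral_ge0.
    - apply: measurable_fun_fubini_tonelli_F => //.
      by apply/measurable_EFinP.
    - move=> x _; rewrite /fubini_F -integral_cst//; apply: ge0_le_integral => //.
      + apply/measurable_EFinP.
        exact: measurableT_comp mnf (pair1_measurable x).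
      + by move=> y _; rewrite lee_fin.
  rewrite integral_cst// ltey_eq fin_numM//; last exact: circle_measure_fin.
  by rewrite fin_numM// fin_num_measure.
rewrite (integral21_prod_meas1 If).
have mEf : measurable_fun setT (EFin \o f) by apply/measurable_EFinP.
have <- := integral_pushforward (@measurable_ptcons R d) mEf If measurableT.
by apply: eq_measure_integral => //; exact: measurable_ptcons.
Qed.

(** Induction on the dimension with [a] general: when the first variable is integrated, the phase of
    the remaining ones belongs to the shift. The result vanishes unless the first frequency is zero,
    and is then a cosine of the remaining phase. *)
Lemma torus_integral_cos d (j : d.-tuple int) (a : R) :
  (\int[torus_measure d]_x (cos (phase j x + a))%:E)%E =
  (if [forall k, tnth j k == 0] then (2 * pi) ^+ d * cos a else 0)%:E.
Proof.
elim: d j a => [|d ih] j a.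
  rewrite integral_dirac//=; last first.
    by apply/measurable_EFinP; exact: measurable_cos_phase.
  rewrite diracT mul1e /phase big_ord0 add0r expr0 mul1r.
  by case: ifPn => // /forallPn[[]].
rewrite (@torus_integralS _ _ 1)//; last 2 first.
  exact: measurable_cos_phase.
  by move=> x; rewrite ler_norml cos_geN1 cos_le1.
transitivity (\int[torus_measure d]_y
   (if thead j == 0 then 2 * pi * cos (phase [tuple of behead j] y + a) else 0)%:E)%E.
  apply: eq_integral => y _; rewrite -circle_integral_cos.
  by apply: eq_integral => x _; rewrite phaseS/= addrA.
have -> : [forall k, tnth j k == 0] =
    (thead j == 0) && [forall k, tnth [tuple of behead j] k == 0].
  apply/forallP/andP => [h|[h /forallP h'] k]; first split.
  - exact: h.
  - apply/forallP => k; have := h (lift ord0 k).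
    by rewrite [in X in X -> _](tuple_eta j) tnthS.
  - rewrite (tuple_eta j); have [k'|] := unliftP ord0 k; last by move=> ->.
    by move=> ->; rewrite tnthS.
have [_|_] := eqVneq (thead j) 0; last by rewrite integral0.
under eq_integral do rewrite EFinM.
rewrite integralZl//; last first.
  apply: (@bounded_integrable _ _ _ _ _ 1); first exact: measurable_cos_phase.
  by move=> x; rewrite ler_norml cos_geN1 cos_le1.
by rewrite ih; case: ifPn => _; rewrite -EFinM ?mulr0// exprS mulrA.
Qed.

(** Points are tuples of arbitrary reals, but the measure sees only the fundamental cube; this is
    what allows a half-space to be compared with an arc of the circle. *)
Lemma torus_ae_period d (k : 'I_d) :
  {ae torus_measure d, forall x : tpoint R d, 0 <= tnth x k < 2 * pi}.
Proof.
exists (~` [set x : tpoint R d | period (tnth x k)]); split.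
- apply: measurableC.
  rewrite -[X in measurable X]setTI; apply: (@measurable_tnth _ _ d k) => //.
  exact: measurable_period.
- elim: d k => [[]//|d ih] k.
  rewrite /= /torus_step /pushforward.
  have [k'|] := unliftP ord0 k => ->.
    rewrite (_ : _ @^-1` _ = setT `*` ~` [set x : tpoint R d | period (tnth x k')]).
      rewrite product_measure1E//; first by rewrite [X in (_ * X)%E](ih k') mule0.
      apply: measurableC.
      rewrite -[X in measurable X]setTI; apply: (@measurable_tnth _ _ d k') => //.
      exact: measurable_period.
    apply/seteqP; split=> -[x y]/=; rewrite /ptcons tnthS; first by split.
    by case.
  rewrite (_ : _ @^-1` _ = ~` period `*` [set: tpoint R d]).
    rewrite product_measure1E//; last by apply: measurableC; exact: measurable_period.
    by rewrite /= /circle_measure /mrestr setICl measure0 mul0e.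
  by apply/seteqP; split=> -[x y]/= => [h|[h _]//]; split.
- move=> x /= h hp; apply: h; move: hp.
  by rewrite /period/= in_itv/=.
Qed.

(** The total mass is the integral of the cosine with zero frequency and zero shift. *)
Lemma torus_measureT d : torus_measure d [set: tpoint R d] = ((2 * pi) ^+ d)%:E.
Proof.
have := torus_integral_cos [tuple of nseq d (0 : int)] 0.
rewrite (eq_integral (cst 1%E)); last first.
  move=> x _; rewrite /phase big1 ?addr0 ?cos0// => k _.
  by rewrite tnth_nseq mul0r.
rewrite integral_cst// mul1e => ->; rewrite cos0 mulr1; case: ifPn => // /forallPn[k].
by rewrite tnth_nseq eqxx.
Qed.

End TorusIntegral.

(** * Square integrable functions on the torus *)

Section SquareIntegrable.
Context {R : realType} {d : nat}.

Local Notation mu := (@torus_measure R d).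
Local Notation T := (tpoint R d).
Local Notation Ri f := (mu.-integrable setT (EFin \o f)).

Implicit Types (f g h : torus_fun R d) (j k : d.-tuple int).

Lemma cmeasurable_cst (c : R[i]) : cmeasurable (fun _ : T => c).
Proof. by split; exact: measurable_cst. Qed.

Lemma cmeasurableD f g : cmeasurable f -> cmeasurable g ->
  cmeasurable (fun x => f x + g x).
Proof.
move=> [f1 f2] [g1 g2]; split.
  by under eq_fun do rewrite ReD; exact: measurable_funD.
by under eq_fun do rewrite ImD; exact: measurable_funD.
Qed.

Lemma cmeasurableN f : cmeasurable f -> cmeasurable (fun x => - f x).
Proof.
move=> [f1 f2]; split.
  by under eq_fun do rewrite ReN; exact: measurableT_comp.
by under eq_fun do rewrite ImN; exact: measurableT_comp.
Qed.

Lemma cmeasurableB f g : cmeasurable f -> cmeasurable g ->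
  cmeasurable (fun x => f x - g x).
Proof. by move=> mf mg; apply: cmeasurableD => //; exact: cmeasurableN. Qed.

Lemma cmeasurableM f g : cmeasurable f -> cmeasurable g ->
  cmeasurable (fun x => f x * g x).
Proof.
move=> [f1 f2] [g1 g2]; split.
  under eq_fun do rewrite Re_mul.
  by apply: measurable_funB; exact: measurable_funM.
under eq_fun do rewrite Im_mul.
by apply: measurable_funD; exact: measurable_funM.
Qed.

Lemma cmeasurableJ f : cmeasurable f -> cmeasurable (fun x => (f x)^*%C).
Proof.
move=> [f1 f2]; split; first by under eq_fun do rewrite Re_conj.
by under eq_fun do rewrite Im_conj; exact: measurableT_comp.
Qed.

Lemma measurable_sqc f : cmeasurable f -> measurable_fun setT (fun x => sqc (f x)).
Proof.
by move=> [f1 f2]; apply: measurable_funD; apply: measurable_funX.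
Qed.

Lemma Ri_le (a b : T -> R) : measurable_fun setT a ->
  (forall x, `|a x| <= b x) -> Ri b -> Ri a.
Proof.
move=> ma ab; apply: le_integrable => //; first by apply/measurable_EFinP.
by move=> x _; rewrite /= lee_fin (le_trans (ab x))// ler_norm.
Qed.

Lemma RiD (a b : T -> R) : Ri a -> Ri b -> Ri (fun x => a x + b x).
Proof. by move=> ia ib; have := integrableD measurableT ia ib. Qed.

Lemma RiZ (c : R) (a : T -> R) : Ri a -> Ri (fun x => c * a x).
Proof. by move=> ia; have := integrableZl measurableT c ia. Qed.

Lemma RiN (a : T -> R) : Ri a -> Ri (fun x => - a x).
Proof. by move=> ia; have := integrableN ia. Qed.

Lemma RiB (a b : T -> R) : Ri a -> Ri b -> Ri (fun x => a x - b x).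
Proof. by move=> ia ib; apply: RiD => //; exact: RiN. Qed.

Lemma RintD (a b : T -> R) : Ri a -> Ri b ->
  \int[mu]_x (a x + b x) = \int[mu]_x a x + \int[mu]_x b x.
Proof. exact: RintegralD. Qed.

Lemma RintB (a b : T -> R) : Ri a -> Ri b ->
  \int[mu]_x (a x - b x) = \int[mu]_x a x - \int[mu]_x b x.
Proof. exact: RintegralB. Qed.

Lemma RintZ (c : R) (a : T -> R) : Ri a ->
  \int[mu]_x (c * a x) = c * \int[mu]_x a x.
Proof. exact: RintegralZl. Qed.

Lemma RintN (a : T -> R) : Ri a -> \int[mu]_x (- a x) = - \int[mu]_x a x.
Proof.
by move=> ia; under eq_Rintegral do rewrite -mulN1r; rewrite RintZ// mulN1r.
Qed.

Lemma le_Rint (a b : T -> R) : Ri a -> Ri b -> (forall x, a x <= b x) ->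
  \int[mu]_x a x <= \int[mu]_x b x.
Proof. by move=> ia ib ab; apply: le_Rintegral => // x _; exact: ab. Qed.

Lemma EFin_Rint (a : T -> R) : Ri a ->
  (\int[mu]_x a x)%:E = (\int[mu]_x (a x)%:E)%E.
Proof.
by move=> ia; rewrite /Rintegral fineK//; exact: (integrable_fin_num _ ia).
Qed.

Definition Cint f : Prop := Ri (fun x => Re (f x)) /\ Ri (fun x => Im (f x)).

Lemma CintD f g : Cint f -> Cint g -> Cint (fun x => f x + g x).
Proof.
move=> [f1 f2] [g1 g2]; split.
  by under eq_fun do rewrite ReD; exact: RiD.
by under eq_fun do rewrite ImD; exact: RiD.
Qed.

Lemma CintZ (c : R[i]) f : Cint f -> Cint (fun x => c * f x).
Proof.
move=> [f1 f2]; split.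
  by under eq_fun do rewrite Re_mul; apply: RiB; exact: RiZ.
by under eq_fun do rewrite Im_mul; apply: RiD; exact: RiZ.
Qed.

Lemma CintB f g : Cint f -> Cint g -> Cint (fun x => f x - g x).
Proof.
move=> cf cg; have := CintD cf (CintZ (-1) cg).
by congr Cint; apply/funext => x; rewrite mulN1r.
Qed.

Lemma cintegralD f g : Cint f -> Cint g ->
  cintegral (fun x => f x + g x) = cintegral f + cintegral g.
Proof.
move=> [f1 f2] [g1 g2]; apply: complexP; rewrite /= ?ReD ?ImD.
  by under eq_Rintegral do rewrite ReD; exact: RintD.
by under eq_Rintegral do rewrite ImD; exact: RintD.
Qed.

Lemma cintegralZ (c : R[i]) f : Cint f ->
  cintegral (fun x => c * f x) = c * cintegral f.
Proof.
move=> [f1 f2]; apply: complexP; rewrite ?Re_mul ?Im_mul/=.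
  under eq_Rintegral do rewrite Re_mul.
  by rewrite RintB ?RintZ//; exact: RiZ.
under eq_Rintegral do rewrite Im_mul.
by rewrite RintD ?RintZ//; exact: RiZ.
Qed.

Lemma cintegralJ f : Cint f -> cintegral (fun x => (f x)^*%C) = (cintegral f)^*%C.
Proof.
move=> [f1 f2]; apply: complexP; rewrite ?Re_conj ?Im_conj/=.
  by under eq_Rintegral do rewrite Re_conj.
by under eq_Rintegral do rewrite Im_conj; rewrite RintN.
Qed.

Lemma Cint0 : Cint (fun=> 0).
Proof. by split; exact: integrable0. Qed.

Lemma cintegral0 : cintegral (fun _ : T => 0) = 0.
Proof. by apply: complexP => /=; rewrite /Rintegral integral0. Qed.

Lemma Cint_sum (I : Type) (s : seq I) (F : I -> torus_fun R d) :
  (forall i, Cint (F i)) -> Cint (fun x => \sum_(i <- s) F i x).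
Proof.
move=> mF; elim: s => [|i s ih].
  by under eq_fun do rewrite big_nil; exact: Cint0.
by under eq_fun do rewrite big_cons; exact: CintD.
Qed.

Lemma cintegral_sum (I : Type) (s : seq I) (F : I -> torus_fun R d) :
  (forall i, Cint (F i)) ->
  cintegral (fun x => \sum_(i <- s) F i x) = \sum_(i <- s) cintegral (F i).
Proof.
move=> mF; elim: s => [|i s ih].
  rewrite big_nil -[RHS]cintegral0.
  by congr cintegral; apply/funext => x; rewrite big_nil.
rewrite big_cons -ih -cintegralD//; last exact: Cint_sum.
by congr cintegral; apply/funext => x; rewrite big_cons.
Qed.

(** The square of the $L^2$ norm as a real number; [L2normE] relates it to [L2norm] for functions
    satisfying [inL2]. *)
Definition n2 f : R := \int[mu]_x sqc (f x).

Lemma n2_ge0 f : 0 <= n2 f.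
Proof. by apply: Rintegral_ge0 => x _; exact: sqc_ge0. Qed.

Lemma L2norm_int f :
  L2norm f = ((\int[mu]_x (sqc (f x))%:E) `^ 2^-1)%E.
Proof.
rewrite /L2norm unlock; congr (_ `^ _)%E; apply: eq_integral => x _.
by rewrite /= powR_mulrn// real_normK ?num_real// sqr_normcE.
Qed.

Lemma inL2P f : inL2 f <-> cmeasurable f /\ Ri (fun x => sqc (f x)).
Proof.
split=> [] [mf h]; split => //.
  apply/integrableP; split; first by apply/measurable_EFinP; exact: measurable_sqc.
  rewrite (_ : (\int[mu]_x _)%E = (\int[mu]_x (sqc (f x))%:E)%E); last first.
    by apply: eq_integral => x _; rewrite gee0_abs// lee_fin sqc_ge0.
  move: h; rewrite L2norm_int.
  by apply: lty_poweRy; rewrite invr_eq0 pnatr_eq0.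
rewrite L2norm_int -EFin_Rint// poweR_EFin; exact: ltry.
Qed.

Lemma L2normE f : inL2 f -> L2norm f = (Num.sqrt (n2 f))%:E.
Proof.
move=> /inL2P[_ h]; rewrite L2norm_int -EFin_Rint// poweR_EFin.
by rewrite powR12_sqrt// n2_ge0.
Qed.

Lemma inL2_meas f : inL2 f -> cmeasurable f. Proof. by case. Qed.

Lemma inL2_int f : inL2 f -> Ri (fun x => sqc (f x)).
Proof. by move=> /inL2P[]. Qed.

Lemma inL2_le f (b : T -> R) : cmeasurable f -> Ri b ->
  (forall x, sqc (f x) <= b x) -> inL2 f.
Proof.
move=> mf ib fb; apply/inL2P; split => //; apply: (Ri_le (b := b)) => //.
  exact: measurable_sqc.
by move=> x; rewrite ger0_norm// sqc_ge0.
Qed.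

Lemma inL2D f g : inL2 f -> inL2 g -> inL2 (fun x => f x + g x).
Proof.
move=> If Ig; apply: (@inL2_le _ (fun x => 2 * (sqc (f x) + sqc (g x)))).
- by apply: cmeasurableD; exact: inL2_meas.
- by apply: RiZ; apply: RiD; exact: inL2_int.
- by move=> x; exact: sqcD_le.
Qed.

Lemma n2D_le f g : inL2 f -> inL2 g -> n2 (fun x => f x + g x) <= 2 * (n2 f + n2 g).
Proof.
move=> If Ig; rewrite /n2 -RintD -?RintZ; try exact: inL2_int; last first.
  by apply: RiD; exact: inL2_int.
apply: le_Rint; first exact: (inL2_int (inL2D If Ig)).
  by apply: RiZ; apply: RiD; exact: inL2_int.
by move=> x; exact: sqcD_le.
Qed.

Lemma inL2_bddM f g (A : R) : cmeasurable f -> (forall x, sqc (f x) <= A) ->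
  inL2 g -> inL2 (fun x => f x * g x).
Proof.
move=> mf fA Ig; apply: (@inL2_le _ (fun x => A * sqc (g x))).
- by apply: cmeasurableM => //; exact: inL2_meas.
- by apply: RiZ; exact: inL2_int.
- by move=> x; rewrite sqcM ler_wpM2r// sqc_ge0.
Qed.

Lemma inL2Z (c : R[i]) f : inL2 f -> inL2 (fun x => c * f x).
Proof. by move=> If; apply: (@inL2_bddM _ _ (sqc c)) => //; exact: cmeasurable_cst. Qed.

Lemma n2Z (c : R[i]) f : inL2 f -> n2 (fun x => c * f x) = sqc c * n2 f.
Proof.
move=> If; rewrite /n2 -RintZ; last exact: inL2_int.
by apply: eq_Rintegral => x _; rewrite sqcM.
Qed.

Lemma inL2B f g : inL2 f -> inL2 g -> inL2 (fun x => f x - g x).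
Proof.
move=> If Ig; have := inL2D If (inL2Z (-1) Ig).
by congr inL2; apply/funext => x; rewrite mulN1r.
Qed.

Lemma inL2J f : inL2 f -> inL2 (fun x => (f x)^*%C).
Proof.
move=> If; apply: (@inL2_le _ (fun x => sqc (f x))).
- by apply: cmeasurableJ; exact: inL2_meas.
- exact: inL2_int.
- by move=> x; rewrite sqcJ.
Qed.

Lemma inL2_bdd f (A : R) : cmeasurable f -> (forall x, sqc (f x) <= A) -> inL2 f.
Proof.
move=> mf fA; apply: (@inL2_le _ (fun=> A)) => //.
by apply: (@bounded_integrable _ _ _ _ _ `|A|) => //; exact: measurable_cst.
Qed.

Lemma inL2_cst (c : R[i]) : inL2 (fun _ : T => c).
Proof. by apply: (@inL2_bdd _ (sqc c)) => //; exact: cmeasurable_cst. Qed.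

Lemma inL2_sum (I : Type) (s : seq I) (F : I -> torus_fun R d) :
  (forall i, inL2 (F i)) -> inL2 (fun x => \sum_(i <- s) F i x).
Proof.
move=> mF; elim: s => [|i s ih].
  by under eq_fun do rewrite big_nil; exact: inL2_cst.
by under eq_fun do rewrite big_cons; exact: inL2D.
Qed.

Lemma CintM f g : inL2 f -> inL2 g -> Cint (fun x => f x * g x).
Proof.
move=> If Ig.
have [m1 m2] := cmeasurableM (inL2_meas If) (inL2_meas Ig).
have ib : Ri (fun x => sqc (f x) + sqc (g x)) by apply: RiD; exact: inL2_int.
split; apply: Ri_le ib => // x; rewrite ler_norml; apply/andP; rewrite ?Re_mul ?Im_mul /sqc; split;
have := sqr_ge0 (Re (f x) + Re (g x)); have := sqr_ge0 (Re (f x) - Re (g x));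
have := sqr_ge0 (Im (f x) + Im (g x)); have := sqr_ge0 (Im (f x) - Im (g x));
have := sqr_ge0 (Re (f x) + Im (g x)); have := sqr_ge0 (Re (f x) - Im (g x));
have := sqr_ge0 (Im (f x) + Re (g x)); have := sqr_ge0 (Im (f x) - Re (g x)); nra.
Qed.

Lemma Cint_L2 f : inL2 f -> Cint f.
Proof.
move=> If; have := CintM If (inL2_cst 1).
by congr Cint; apply/funext => x; rewrite mulr1.
Qed.

Lemma cintegral_CS f g : inL2 f -> inL2 g ->
  sqc (cintegral (fun x => f x * g x)) <= n2 f * n2 g.
Proof.
move=> If Ig; set c := cintegral _.
have cfg := CintM If Ig.
(* The integral of $\bar c fg$ is $|c|^2$; the integrand is split by $2|xy|\le t|x|^2+t^{-1}|y|^2$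
   with a free parameter. The choice $t=$ [n2 g] gives the claim. *)
have h (t : R) : 0 < t -> 2 * sqc c <= t * n2 f + t^-1 * (sqc c * n2 g).
  move=> t0.
  have -> : 2 * sqc c = \int[mu]_x (2 * Re (c^*%C * (f x * g x))).
    have ch := CintZ c^*%C cfg.
    rewrite RintZ; last by case: ch.
    rewrite -[X in _ = 2 * X]/(Re (cintegral (fun x => c^*%C * (f x * g x)))).
    by rewrite cintegralZ// Re_mul Re_conj Im_conj mulNr opprK /sqc !expr2.
  rewrite /n2 -!RintZ; try by exact: inL2_int.
    rewrite -RintD; last 2 first.
    - by apply: RiZ; exact: inL2_int.
    - by apply: RiZ; apply: RiZ; exact: inL2_int.
    apply: le_Rint.
    - by apply: RiZ; case: (CintZ c^*%C cfg).
    - by apply: RiD; apply: RiZ; [|apply: RiZ]; exact: inL2_int.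
    - move=> x; rewrite -(ler_pM2l t0) mulrDr [t * (t^-1 * _)]mulrA mulfV ?gt_eqF// mul1r -sqcM.
      rewrite mulrCA (_ : c^*%C * (f x * g x) = f x * (c^*%C * g x)); last by rewrite mulrCA.
      have -> : sqc (c * g x) = sqc (c^*%C * g x) by rewrite !sqcM sqcJ.
      rewrite [Re _]Re_mul /sqc; set A := c^*%C * g x.
      have := sqr_ge0 (t * Re (f x) - Re A); have := sqr_ge0 (t * Im (f x) + Im A).
      nra.
  by apply: RiZ; exact: inL2_int.
have F0 := n2_ge0 f; have G0 := n2_ge0 g; have S0 := sqc_ge0 c.
(* If [n2 g] vanishes, the previous inequality reads $2|c|^2\le t\,$[n2 f] for every $t>0$, and a
   small $t$ contradicts $|c|^2>0$. *)
have [G1|G1] := eqVneq (n2 g) 0.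
  rewrite G1 mulr0; rewrite leNgt; apply/negP => Sp.
  have := h (sqc c / (n2 f + 1)); rewrite G1 !mulr0 addr0 divr_gt0//; last by lra.
  move=> /(_ isT); rewrite -mulrAC ler_pdivlMr; last by lra.
  nra.
have Gp : 0 < n2 g by rewrite lt_neqAle eq_sym G1.
have := h (n2 g) Gp; rewrite [_^-1 * _]mulrC -mulrA mulfV// mulr1.
nra.
Qed.

Lemma n2B f g : inL2 f -> inL2 g ->
  n2 (fun x => f x - g x) =
  n2 f - 2 * Re (cintegral (fun x => f x * (g x)^*%C)) + n2 g.
Proof.
move=> If Ig; have [c1 c2] := CintM If (inL2J Ig).
rewrite /n2/= -RintZ// -RintB -?RintD//; try exact: inL2_int; last 2 first.
- by apply: RiB; [exact: inL2_int|exact: RiZ].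
- exact: RiZ.
apply: eq_Rintegral => x _; rewrite /sqc !reimE; ring.
Qed.

End SquareIntegrable.

(** * Fourier coefficients *)

Section Fourier.
Context {R : realType} {d : nat}.

Local Notation mu := (@torus_measure R d).
Local Notation T := (tpoint R d).
Local Notation Ri f := (mu.-integrable setT (EFin \o f)).
Local Notation P := ((2 * pi : R) ^+ d).

Implicit Types (f g h : torus_fun R d) (j k : d.-tuple int).

Definition jadd j k : d.-tuple int := [tuple tnth j i + tnth k i | i < d].
Definition jneg j : d.-tuple int := [tuple - tnth j i | i < d].
Definition jsub j k : d.-tuple int := jadd j (jneg k).
Definition jzero : d.-tuple int := [tuple 0 | i < d].

Lemma jnegK : involutive jneg.
Proof. by move=> j; apply: eq_from_tnth => i; rewrite !tnth_mktuple opprK. Qed.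

Lemma jsub_injr k : injective (jsub k).
Proof.
move=> i j e; apply: eq_from_tnth => l.
have := congr1 (fun t : d.-tuple int => tnth t l) e.
by rewrite !tnth_mktuple => /addrI/oppr_inj.
Qed.

Lemma jsub_injl j : injective (jsub^~ j).
Proof.
move=> i k e; apply: eq_from_tnth => l.
have := congr1 (fun t : d.-tuple int => tnth t l) e.
by rewrite !tnth_mktuple => /addIr.
Qed.

Lemma jsub_eq0 j k : (jsub j k == jzero) = (j == k).
Proof.
apply/eqP/eqP => [e|->].
  apply: eq_from_tnth => l; have := congr1 (fun t : d.-tuple int => tnth t l) e.
  by rewrite !tnth_mktuple => /eqP; rewrite subr_eq0 => /eqP.
by apply: eq_from_tnth => l; rewrite !tnth_mktuple subrr.
Qed.

Lemma jsubK j k : jadd (jsub j k) k = j.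
Proof. by apply: eq_from_tnth => l; rewrite !tnth_mktuple subrK. Qed.

Lemma phaseD j k (x : T) : phase (jadd j k) x = phase j x + phase k x.
Proof.
rewrite /phase -big_split/=; apply: eq_bigr => i _.
by rewrite tnth_mktuple intrD mulrDl.
Qed.

Lemma phaseN j (x : T) : phase (jneg j) x = - phase j x.
Proof.
by rewrite /phase -sumrN; apply: eq_bigr => i _; rewrite tnth_mktuple mulrNz mulNr.
Qed.

Lemma plane_waveE j (x : T) :
  plane_wave j x = (cos (phase j x) +i* sin (phase j x))%C.
Proof. by []. Qed.

Lemma plane_waveM j k (x : T) :
  plane_wave j x * plane_wave k x = plane_wave (jadd j k) x.
Proof.
rewrite !plane_waveE phaseD; apply: complexP; rewrite ?Re_mul ?Im_mul/=.
  by rewrite cosD.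
by rewrite sinD addrC.
Qed.

Lemma plane_waveJ j (x : T) : (plane_wave j x)^*%C = plane_wave (jneg j) x.
Proof. by rewrite !plane_waveE phaseN cosN sinN. Qed.

Lemma sqc_plane_wave j (x : T) : sqc (plane_wave j x) = 1.
Proof. by rewrite /sqc/= cos2Dsin2. Qed.

Lemma cmeasurable_plane_wave j : cmeasurable (plane_wave j : torus_fun R d).
Proof.
have h : (fun x : T => sin (phase j x)) = (fun x => cos (phase j x + - (pi / 2))).
  by apply/funext => x; rewrite cosBpihalf.
split.
  have := measurable_cos_phase j (0 : R).
  by congr measurable_fun; apply/funext => x; rewrite addr0.
by rewrite (_ : (fun x => _) = (fun x : T => sin (phase j x)))// h; exact: measurable_cos_phase.
Qed.

Lemma inL2_plane_wave j : inL2 (plane_wave j : torus_fun R d).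
Proof.
apply: (@inL2_bdd _ _ _ 1); first exact: cmeasurable_plane_wave.
by move=> x; rewrite sqc_plane_wave.
Qed.

Lemma jzeroP j : [forall k, tnth j k == 0] = (j == jzero).
Proof.
apply/forallP/eqP => [h|-> k]; last by rewrite tnth_mktuple.
by apply: eq_from_tnth => l; rewrite tnth_mktuple; exact/eqP.
Qed.

Lemma cintegral_plane_wave j :
  cintegral (plane_wave j : torus_fun R d) = (if j == jzero then P%:C else 0)%C.
Proof.
have h (a : R) : \int[mu]_x cos (phase j x + a) = if j == jzero then P * cos a else 0.
  by rewrite /Rintegral torus_integral_cos jzeroP.
apply: complexP => /=.
  rewrite (_ : (\int[mu]_x _) = \int[mu]_x cos (phase j x + 0)); last first.
    by apply: eq_Rintegral => x _; rewrite addr0.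
  by rewrite h cos0 mulr1; case: ifP.
rewrite (_ : (\int[mu]_x _) = \int[mu]_x cos (phase j x + - (pi / 2))); last first.
  by apply: eq_Rintegral => x _; rewrite cosBpihalf.
by rewrite h cosN cos_pihalf mulr0; case: ifP.
Qed.

Lemma P_gt0 : 0 < P. Proof. by rewrite exprn_gt0// pi2_gt0. Qed.

Lemma inL2_Mplane f j : inL2 f -> inL2 (fun x => f x * (plane_wave j x)^*%C).
Proof.
move=> If; under eq_fun do rewrite mulrC.
apply: (@inL2_bddM _ _ _ _ 1) => //.
  by apply: cmeasurableJ; exact: cmeasurable_plane_wave.
by move=> x; rewrite sqcJ sqc_plane_wave.
Qed.

Lemma Cint_Mplane f j : Cint f -> Cint (fun x => f x * (plane_wave j x)^*%C).
Proof.
move=> [i1 i2].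
have b (a : T -> R) (m : T -> R) : measurable_fun setT m -> (forall x, `|m x| <= 1) ->
    Ri a -> Ri (fun x => a x * m x).
  move=> mm m1 ia; apply: (Ri_le (b := fun x => `|a x|)).
  - apply: measurable_funM => //; apply/measurable_EFinP.
    exact: (measurable_int _ ia).
  - by move=> x; rewrite normrM ler_piMr.
  - exact: integrable_norm ia.
have [p1 p2] := cmeasurable_plane_wave j.
have c1 (x : T) : `|Re (plane_wave j x)| <= 1 by rewrite ler_norml cos_geN1 cos_le1.
have s1 (x : T) : `|Im (plane_wave j x)| <= 1 by rewrite ler_norml sin_geN1 sin_le1.
split.
  under eq_fun do rewrite Re_mul Re_conj Im_conj mulrN opprK.
  by apply: RiD; exact: b.
under eq_fun do rewrite Im_mul Re_conj Im_conj mulrN.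
by apply: RiD; [apply: RiN|]; exact: b.
Qed.

Lemma fourier_coefD f g j : Cint f -> Cint g ->
  fourier_coef (fun x => f x + g x) j = fourier_coef f j + fourier_coef g j.
Proof.
move=> cf cg; rewrite /fourier_coef -mulrDr -cintegralD; try exact: Cint_Mplane.
by congr (_ * cintegral _); apply/funext => x; rewrite mulrDl.
Qed.

Lemma fourier_coefZ (c : R[i]) f j : Cint f ->
  fourier_coef (fun x => c * f x) j = c * fourier_coef f j.
Proof.
move=> cf; rewrite /fourier_coef [RHS]mulrCA -[in RHS]cintegralZ; last exact: Cint_Mplane.
by congr (_ * cintegral _); apply/funext => x; rewrite mulrA.
Qed.

Lemma eq_fourier_coef f g j : (forall x, f x = g x) -> fourier_coef f j = fourier_coef g j.
Proof. by move=> /funext ->. Qed.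

Lemma fourier_coefB f g j : Cint f -> Cint g ->
  fourier_coef (fun x => f x - g x) j = fourier_coef f j - fourier_coef g j.
Proof.
move=> cf cg; rewrite -[X in _ = _ + X]mulN1r -fourier_coefZ// -fourier_coefD//.
  by apply: eq_fourier_coef => x; rewrite mulN1r.
exact: CintZ.
Qed.

Lemma fourier_coef0 j : fourier_coef (fun _ : T => 0) j = 0.
Proof.
rewrite /fourier_coef (_ : (fun x : T => _) = fun=> 0) ?cintegral0 ?mulr0//.
by apply/funext => x; rewrite mul0r.
Qed.

Lemma fourier_coef_sum (I : Type) (s : seq I) (F : I -> torus_fun R d) j :
  (forall i, Cint (F i)) ->
  fourier_coef (fun x => \sum_(i <- s) F i x) j = \sum_(i <- s) fourier_coef (F i) j.
Proof.
move=> mF; elim: s => [|i s ih].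
  rewrite big_nil -[RHS](fourier_coef0 j).
  by apply: eq_fourier_coef => x; rewrite big_nil.
rewrite big_cons -ih -fourier_coefD//; last exact: Cint_sum.
by apply: eq_fourier_coef => x; rewrite big_cons.
Qed.

Lemma fourier_coefJ f j : Cint f ->
  fourier_coef (fun x => (f x)^*%C) j = (fourier_coef f (jneg j))^*%C.
Proof.
move=> cf; rewrite /fourier_coef [RHS]rmorphM; congr (_ * _); first by rewrite [RHS]conjc_real.
rewrite -[RHS]cintegralJ; last exact: Cint_Mplane.
by congr cintegral; apply/funext => x; rewrite -[in RHS]plane_waveJ conjcK -rmorphM.
Qed.

Lemma fourier_coef_Mplane f j k :
  fourier_coef (fun x => f x * plane_wave k x) j = fourier_coef f (jsub j k).
Proof.
rewrite /fourier_coef; congr (_ * cintegral _); apply/funext => x.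
rewrite -mulrA !plane_waveJ plane_waveM; congr (_ * plane_wave _ _).
by apply: eq_from_tnth => l; rewrite !tnth_mktuple opprD opprK addrC.
Qed.

Lemma fourier_coef_plane_wave j k :
  fourier_coef (plane_wave k : torus_fun R d) j = (k == j)%:R.
Proof.
rewrite /fourier_coef (_ : (fun x : T => _) = plane_wave (jsub k j)).
  rewrite cintegral_plane_wave jsub_eq0; case: eqP => _; last by rewrite mulr0.
  by rewrite -rmorphM/= mulVf ?rmorph1// gt_eqF// P_gt0.
by apply/funext => x; rewrite plane_waveJ plane_waveM.
Qed.

Lemma cintegral_Mplane f j :
  cintegral (fun x => f x * (plane_wave j x)^*%C) = (P%:C)%C * fourier_coef f j.
Proof. by rewrite /fourier_coef mulrA -rmorphM/= mulfV ?rmorph1 ?mul1r// gt_eqF// P_gt0. Qed.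

Definition trig (J : seq (d.-tuple int)) (c : d.-tuple int -> R[i]) : torus_fun R d :=
  fun x => \sum_(j <- J) c j * plane_wave j x.

Lemma inL2_trig J c : inL2 (trig J c).
Proof. by apply: inL2_sum => j; apply: inL2Z; exact: inL2_plane_wave. Qed.

Lemma fourier_coef_trig J c j : uniq J ->
  fourier_coef (trig J c) j = if j \in J then c j else 0.
Proof.
move=> uJ; rewrite fourier_coef_sum; last first.
  by move=> i; apply: Cint_L2; apply: inL2Z; exact: inL2_plane_wave.
under eq_bigr => i _.
  rewrite fourier_coefZ; last by apply: Cint_L2; exact: inL2_plane_wave.
  rewrite fourier_coef_plane_wave; over.
elim: J uJ => [|i J ih]/=; first by rewrite big_nil.
move=> /andP[iJ uJ]; rewrite big_cons ih// in_cons [j == i]eq_sym.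
have [<-|_] := eqVneq i j; last by rewrite mulr0 add0r.
by rewrite (negbTE iJ) mulr1 addr0.
Qed.

Lemma inner_trig f J c : inL2 f ->
  cintegral (fun x => f x * (trig J c x)^*%C) =
  (P%:C)%C * \sum_(j <- J) (c j)^*%C * fourier_coef f j.
Proof.
move=> If; rewrite big_distrr/=.
rewrite (_ : (fun x : T => _) =
    fun x => \sum_(j <- J) (c j)^*%C * (f x * (plane_wave j x)^*%C)); last first.
  apply/funext => x; rewrite /trig rmorph_sum/= big_distrr/=.
  by apply: eq_bigr => j _; rewrite rmorphM/= mulrCA.
rewrite cintegral_sum; last by move=> j; apply: CintZ; apply: Cint_L2; exact: inL2_Mplane.
apply: eq_bigr => j _; rewrite cintegralZ; last by apply: Cint_L2; exact: inL2_Mplane.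
by rewrite cintegral_Mplane mulrCA.
Qed.

Lemma Re_mulJ (z : R[i]) : Re (z^*%C * z) = sqc z.
Proof. by rewrite Re_mul Re_conj Im_conj mulNr opprK /sqc !expr2. Qed.

Lemma n2_inner f : inL2 f -> n2 f = Re (cintegral (fun x => f x * (f x)^*%C)).
Proof.
move=> If; apply: eq_Rintegral => x _.
by rewrite mulrC Re_mulJ.
Qed.

Lemma n2_trig J c : uniq J -> n2 (trig J c) = P * \sum_(j <- J) sqc (c j).
Proof.
move=> uJ; rewrite n2_inner; last exact: inL2_trig.
rewrite inner_trig; last exact: inL2_trig.
rewrite Re_mul/= mul0r subr0; congr (_ * _).
rewrite Re_sum big_seq [RHS]big_seq; apply: eq_bigr => j jJ.
by rewrite fourier_coef_trig// jJ Re_mulJ.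
Qed.

(** Pythagoras: the partial Fourier sum is the orthogonal projection of [f], so the cross term is
    minus twice its squared norm. *)
Lemma n2_sub_trig f J : inL2 f -> uniq J ->
  n2 (fun x => f x - trig J (fourier_coef f) x) =
  n2 f - P * \sum_(j <- J) sqc (fourier_coef f j).
Proof.
move=> If uJ; rewrite n2B//; last exact: inL2_trig.
rewrite n2_trig// inner_trig// Re_mul/= mul0r subr0 Re_sum.
have -> : \sum_(j <- J) Re ((fourier_coef f j)^*%C * fourier_coef f j) =
    \sum_(j <- J) sqc (fourier_coef f j) by apply: eq_bigr => j _; exact: Re_mulJ.
by move: (n2 f) (P * _) => a b; lra.
Qed.

Lemma bessel f : inL2 f -> sumB (fun j => sqc (fourier_coef f j)) (P^-1 * n2 f).
Proof.
move=> If J uJ; rewrite ler_pdivlMl ?P_gt0// -subr_ge0 -n2_sub_trig//.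
exact: n2_ge0.
Qed.

Lemma sqc_fourier_coef_le f j : inL2 f -> P * sqc (fourier_coef f j) <= n2 f.
Proof. by move=> If; rewrite -ler_pdivlMl ?P_gt0//; exact: sumB_single (bessel If). Qed.

End Fourier.
Arguments jzero {d}.

(** * Fourier coefficients determine the function *)

Section StepApproximation.
Context {R : realType}.
Implicit Types (u : R^nat) (x y : R).

Lemma cvg_harmonic_bound u (l K : R) : (\forall n \near \oo, `|u n - l| <= K / n.+1%:R) ->
  u n @[n --> \oo] --> l.
Proof.
move=> h; apply/subr_cvg0.
have c0 : K / n.+1%:R @[n --> \oo] --> (0 : R).
  by rewrite -(mulr0 K); apply: cvgM; [exact: cvg_cst|exact: cvg_harmonic].
apply: (@squeeze_cvgr _ _ _ _ (fun n => - (K / n.+1%:R)) (fun n => K / n.+1%:R)) => //.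
  by apply: filterS h => n; rewrite ler_norml.
by rewrite -oppr0; exact: cvgN.
Qed.

Lemma cvg_le_bound u (l B : R) : u n @[n --> \oo] --> l -> (forall n, u n <= B) ->
  l <= B.
Proof.
move=> ul uB; rewrite -(cvg_lim _ ul)//; apply: limr_le; last exact: nearW.
by apply/cvg_ex; exists l.
Qed.

Lemma bernoulli_ge x n : -1 <= x -> 1 + n%:R * x <= (1 + x) ^+ n.
Proof.
move=> x1; elim: n => [|n ih]; first by rewrite mul0r addr0.
rewrite exprS -natr1 (@le_trans _ _ ((1 + x) * (1 + n%:R * x)))//.
  have := mulr_ge0 (ler0n R n) (sqr_ge0 x); nra.
by rewrite ler_wpM2l// -lerBlDl sub0r.
Qed.

(** Combine $(1-x)^n(1+x)^n\le 1$ with Bernoulli's inequality for the second factor. *)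
Lemma exprB1_le x n : 0 <= x <= 1 -> (1 - x) ^+ n <= (1 + n%:R * x)^-1.
Proof.
move=> /andP[x0 x1]; have nx : 0 <= n%:R * x by rewrite mulr_ge0.
have b : 1 + n%:R * x <= (1 + x) ^+ n by rewrite bernoulli_ge// (le_trans _ x0).
rewrite -[leRHS]mul1r ler_pdivlMr; last by lra.
rewrite (@le_trans _ _ ((1 - x) ^+ n * (1 + x) ^+ n))//.
  by rewrite ler_wpM2l// exprn_ge0// subr_ge0.
by rewrite -exprMn exprn_ile1//; nra.
Qed.

(* [(1 - q^N)^(2^N)] with [N = (n+1)^2] is close to 1 where [2 q <= 1 - a/(n+1)]
   and close to 0 where [2 q >= 1 + a]. *)
Definition bump (n : nat) (q : R) : R :=
  (1 - q ^+ (n.+1 ^ 2)) ^+ (2 ^ (n.+1 ^ 2)).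

Lemma bump_itv n q : 0 <= q <= 1 -> 0 <= bump n q <= 1.
Proof.
move=> /andP[q0 q1]; have h : 0 <= q ^+ (n.+1 ^ 2) <= 1.
  by rewrite exprn_ge0// exprn_ile1.
by rewrite /bump exprn_ge0 ?exprn_ile1//; move: h => /andP[]; lra.
Qed.

(** Bernoulli's inequality gives $1-(1-q^N)^{2^N}\le(2q)^N$. Since $N=(n+1)^2$, the gap $a/(n+1)$ is
    still amplified to $1+(n+1)a$ by the power $N$. *)
Lemma bump_large n q a : 0 < a <= 1 -> 0 <= q -> q <= 1 ->
  2 * q <= 1 - a / n.+1%:R -> 1 - bump n q <= a^-1 / n.+1%:R.
Proof.
move=> /andP[a0 a1] q0 q1 qa; set N := (n.+1 ^ 2)%N.
have n0 : 0 < n.+1%:R :> R by rewrite ltr0n.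
have q01 : 0 <= q ^+ N <= 1 by rewrite exprn_ge0// exprn_ile1.
have := @bernoulli_ge (- q ^+ N) (2 ^ N) _.
rewrite -[(1 + _) ^+ _]/(bump n q) => /(_ _)/le_trans; rewrite lerN2 => h.
have : 1 - bump n q <= (2 * q) ^+ N.
  have : 1 + (2 ^ N)%:R * - q ^+ N <= bump n q by apply: h => //; case/andP: q01.
  by rewrite exprMn natrX; lra.
move=> /le_trans; apply.
have an : 0 <= a / n.+1%:R <= 1.
  rewrite divr_ge0 ?(ltW a0)//= ler_pdivrMr// mul1r (le_trans a1)//.
  by rewrite ler1n.
rewrite (@le_trans _ _ ((1 - a / n.+1%:R) ^+ N))//.
  by apply: lerXn2r; rewrite ?nnegrE ?mulr_ge0// subr_ge0; case/andP: an.
rewrite (le_trans (exprB1_le _ an))//.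
have -> : N%:R * (a / n.+1%:R) = n.+1%:R * a.
  by rewrite /N natrX expr2; field; rewrite gt_eqF.
rewrite -invfM lef_pV2 ?posrE ?mulr_gt0//; last by rewrite addr_gt0 ?mulr_gt0.
by rewrite mulrC lerDr.
Qed.

(** Here $(1-q^N)^{2^N}\le 1/(1+(2q)^N)$, and $(2q)^N\ge(1+a)^N\ge 1+Na$ by Bernoulli's
    inequality. *)
Lemma bump_small n q a : 0 < a -> 0 <= q -> q <= 1 ->
  1 + a <= 2 * q -> bump n q <= a^-1 / n.+1%:R.
Proof.
move=> a0 q0 q1 qa; set N := (n.+1 ^ 2)%N.
have n0 : 0 < n.+1%:R :> R by rewrite ltr0n.
have n1 : 1 <= n.+1%:R :> R by rewrite ler1n.
have q01 : 0 <= q ^+ N <= 1 by rewrite exprn_ge0// exprn_ile1.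
rewrite (le_trans (exprB1_le _ q01))// natrX -exprMn.
have : 1 + N%:R * a <= (2 * q) ^+ N.
  have a1 : -1 <= a by lra.
  apply: (le_trans (bernoulli_ge N a1)).
  by apply: lerXn2r; rewrite ?nnegrE; lra.
rewrite /N natrX => h.
rewrite -invfM lef_pV2 ?posrE ?mulr_gt0//; last by apply: ltr_wpDr => //; rewrite exprn_ge0; lra.
rewrite (@le_trans _ _ (n.+1%:R ^+ 2 * a))//; last by lra.
by rewrite mulrC ler_wpM2r ?(ltW a0)// expr2 ler_peMl// ltW.
Qed.

(** The affine argument crosses the critical value $1/2$ of [bump] at $y=c-1/(n+1)$; this shift puts
    $y=c$ itself on the side where the limit is 1. Dividing by 8 keeps the argument in $[0,1]$ for
    $c,y\in[-1,1]$. *)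
Definition arcstep (c y : R) (n : nat) : R :=
  bump n (2^-1 + (c - n.+1%:R^-1 - y) / 8).

Lemma arcstep_q_itv (c y : R) n : -1 <= c <= 1 -> -1 <= y <= 1 ->
  0 <= 2^-1 + (c - n.+1%:R^-1 - y) / 8 <= 1.
Proof.
move=> /andP[c0 c1] /andP[y0 y1].
have : 0 <= (n.+1%:R^-1 : R) <= 1 by rewrite invr_ge0 ler0n/= invf_le1// ler1n.
by move: (n.+1%:R^-1) => z /andP[]; lra.
Qed.

Lemma arcstep_cvg (c y : R) : -1 <= c <= 1 -> -1 <= y <= 1 ->
  arcstep c y n @[n --> \oo] --> ((c <= y)%R%:R : R).
Proof.
move=> c1 y1; have [cy|yc] := leP c y.
  apply: (@cvg_harmonic_bound (arcstep c y) 1 4); apply: nearW => n.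
  have /andP[q0 q1] := arcstep_q_itv n c1 y1.
  have /andP[b0 b1] := bump_itv n (arcstep_q_itv n c1 y1).
  rewrite distrC ger0_norm ?subr_ge0// -[4]invrK; apply: bump_large => //.
    by lra.
  by move: (n.+1%:R^-1) => z; lra.
pose a : R := (c - y) / 8.
apply: (@cvg_harmonic_bound (arcstep c y) 0 a^-1).
have : \forall n \near \oo, (n.+1%:R^-1 : R) < (c - y) / 2.
  by apply: (cvgr_lt (0 : R)); [exact: cvg_harmonic|lra].
apply: filterS => n hn.
have /andP[q0 q1] := arcstep_q_itv n c1 y1.
have /andP[b0 b1] := bump_itv n (arcstep_q_itv n c1 y1).
rewrite subr0 ger0_norm//; apply: bump_small => //; rewrite /a; first by lra.
by move: hn; move: (n.+1%:R^-1) => z; lra.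
Qed.

End StepApproximation.

Section Uniqueness.
Context {R : realType} {d : nat}.

Local Notation mu := (@torus_measure R d).
Local Notation T := (tpoint R d).
Local Notation Ri f := (mu.-integrable setT (EFin \o f)).

Implicit Types (f g h : torus_fun R d) (j k : d.-tuple int) (m : T -> R).

Definition null_coefs f : Prop := Cint f /\ forall j, fourier_coef f j = 0.

Lemma null_coefsD f g : null_coefs f -> null_coefs g -> null_coefs (fun x => f x + g x).
Proof.
move=> [cf f0] [cg g0]; split; first exact: CintD.
by move=> j; rewrite fourier_coefD// f0 g0 addr0.
Qed.

Lemma null_coefsZ (c : R[i]) f : null_coefs f -> null_coefs (fun x => c * f x).
Proof.
move=> [cf f0]; split; first exact: CintZ.
by move=> j; rewrite fourier_coefZ// f0 mulr0.
Qed.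

Lemma null_coefs_plane f k : null_coefs f -> null_coefs (fun x => f x * plane_wave k x).
Proof.
move=> [cf f0]; split; last by move=> j; rewrite fourier_coef_Mplane.
have := Cint_Mplane (jneg k) cf.
by congr Cint; apply/funext => x; rewrite plane_waveJ jnegK.
Qed.

(** Multipliers that keep all Fourier coefficients equal to zero. They form an algebra closed under
    bounded pointwise limits, which allows a passage from trigonometric polynomials to indicators of
    arbitrary measurable sets. *)
Definition preserves_null m : Prop :=
  [/\ measurable_fun setT m, exists A, forall x, `|m x| <= A &
      forall f, null_coefs f -> null_coefs (fun x => (m x)%:C%C * f x)].

Lemma preserves_null_cst (c : R) : preserves_null (fun=> c).
Proof.
split; first exact: measurable_cst; first by exists `|c|.
by move=> f; exact: null_coefsZ.
Qed.

Lemma preserves_nullD m m' : preserves_null m -> preserves_null m' ->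
  preserves_null (fun x => m x + m' x).
Proof.
move=> [mm [A mA] pm] [mm' [A' mA'] pm']; split.
- exact: measurable_funD.
- by exists (A + A') => x; rewrite (le_trans (ler_normD _ _))// lerD.
- move=> f f0; have := null_coefsD (pm f f0) (pm' f f0).
  by congr null_coefs; apply/funext => x; rewrite -mulrDl rmorphD.
Qed.

Lemma preserves_nullM m m' : preserves_null m -> preserves_null m' ->
  preserves_null (fun x => m x * m' x).
Proof.
move=> [mm [A mA] pm] [mm' [A' mA'] pm']; split.
- exact: measurable_funM.
- by exists (A * A') => x; rewrite normrM ler_pM.
- move=> f f0; have := pm _ (pm' f f0).
  by congr null_coefs; apply/funext => x; rewrite mulrA rmorphM.
Qed.

Lemma preserves_nullX m n : preserves_null m -> preserves_null (fun x => m x ^+ n).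
Proof.
move=> pm; elim: n => [|n ih]; first exact: preserves_null_cst.
by under eq_fun do rewrite exprS; exact: preserves_nullM.
Qed.

Lemma preserves_nullB m m' : preserves_null m -> preserves_null m' ->
  preserves_null (fun x => m x - m' x).
Proof.
move=> pm pm'; have := preserves_nullD pm (preserves_nullM (preserves_null_cst (-1)) pm').
by congr preserves_null; apply/funext => x; rewrite mulN1r.
Qed.

(** By Euler's formula the cosine is a combination of $e^{\pm\mathrm{i}x_i}$, and multiplication by
    a plane wave only shifts the coefficients. *)
Lemma preserves_null_cos (i : 'I_d) (t : R) :
  preserves_null (fun x => cos (tnth x i - t)).
Proof.
pose e : d.-tuple int := [tuple (l == i)%:R | l < d].
have pe (x : T) : phase e x = tnth x i.
  rewrite /phase (bigD1 i)//= big1 ?addr0; last first.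
    by move=> l li; rewrite tnth_mktuple (negbTE li) mul0r.
  by rewrite tnth_mktuple eqxx mul1r.
split.
- by have := measurable_cos_phase e (- t); congr measurable_fun; apply/funext => x; rewrite pe.
- by exists 1 => x; rewrite ler_norml cos_geN1 cos_le1.
- move=> f f0.
  have h1 := null_coefsZ (cos t / 2 +i* - (sin t / 2))%C (null_coefs_plane e f0).
  have h2 := null_coefsZ (cos t / 2 +i* (sin t / 2))%C (null_coefs_plane (jneg e) f0).
  have := null_coefsD h1 h2.
  congr null_coefs; apply/funext => x; rewrite -plane_waveJ plane_waveE pe cosB.
  by apply: complexP; rewrite !reimE/= ?mul0r; field.
Qed.

(** Dominated convergence, applied to the real and imaginary parts of each coefficient, with the
    modulus of the unmultiplied integrand as dominating function. *)
Lemma preserves_null_lim (m_ : (T -> R)^nat) m :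
  (forall n, preserves_null (m_ n)) -> (forall n x, `|m_ n x| <= 1) ->
  (forall x, m_ n x @[n --> \oo] --> m x) -> preserves_null m.
Proof.
move=> pm m1 mm.
have mme n : measurable_fun setT (m_ n) by case: (pm n).
have mmm : measurable_fun setT m by apply: (@measurable_fun_cvg _ _ _ _ m_) => // x _.
have mb x : `|m x| <= 1.
  by apply: (@cvg_le_bound _ (fun n => `|m_ n x|)) => //; apply: cvg_norm; exact: mm.
split=> //; first by exists 1.
have Rim (a : T -> R) (m' : T -> R) : measurable_fun setT m' -> (forall x, `|m' x| <= 1) ->
    Ri a -> Ri (fun x => m' x * a x).
  move=> m'm m'1 ia; apply: (Ri_le (b := fun x => `|a x|)).
  - by apply: measurable_funM => //; apply/measurable_EFinP; exact: measurable_int ia.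
  - by move=> x; rewrite normrM ler_piMl.
  - exact: integrable_norm ia.
have lim0 (a : T -> R) : Ri a -> (forall n, \int[mu]_x (m_ n x * a x) = 0) ->
    \int[mu]_x (m x * a x) = 0.
  move=> ia z.
  have := @dominated_cvg _ _ _ mu setT measurableT (fun n x => (m_ n x * a x)%:E)
     (fun x => (m x * a x)%:E) (fun x => (`|a x|)%:E).
  have -> : (fun n => (\int[mu]_x (m_ n x * a x)%:E)%E) = (fun=> 0%E).
    by apply/funext => n; rewrite -EFin_Rint ?z//; exact: Rim.
  move=> /(_ _ _ _ _ _)/cvg_lim h; rewrite /Rintegral -h//.
  - by rewrite lim_cst.
  - by move=> n; apply: (measurable_int mu); exact: Rim.
  - move=> x _; apply: cvg_EFin; first exact: nearW.
    by apply: cvgM; [exact: mm|exact: cvg_cst].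
  - exact: integrable_norm ia.
  - by move=> n x _; rewrite lee_fin normrM ler_piMl.
move=> f [cf f0]; split.
  case: cf => f1 f2; split.
    by under eq_fun do rewrite Re_mul/= mul0r subr0; exact: Rim.
  by under eq_fun do rewrite Im_mul/= mul0r addr0; exact: Rim.
move=> j; have [c1 c2] := Cint_Mplane j cf.
have rw m' : (fun x : T => (m' x)%:C%C * f x * (plane_wave j x)^*%C) =
    (fun x => (m' x)%:C%C * (f x * (plane_wave j x)^*%C)).
  by apply/funext => x; rewrite mulrA.
have z n : cintegral (fun x => (m_ n x)%:C%C * (f x * (plane_wave j x)^*%C)) = 0.
  case: (pm n) => _ _ /(_ f)[//|_ /(_ j)].
  by rewrite -rw => h; rewrite cintegral_Mplane h mulr0.
rewrite /fourier_coef rw; apply/eqP; rewrite mulf_eq0; apply/orP; right; apply/eqP.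
have rr m' : (fun x : T => Re ((m' x)%:C%C * (f x * (plane_wave j x)^*%C))) =
   (fun x => m' x * Re (f x * (plane_wave j x)^*%C)).
  by apply/funext => x; rewrite Re_mul/= mul0r subr0.
have ri m' : (fun x : T => Im ((m' x)%:C%C * (f x * (plane_wave j x)^*%C))) =
   (fun x => m' x * Im (f x * (plane_wave j x)^*%C)).
  by apply/funext => x; rewrite Im_mul/= mul0r addr0.
apply: complexP; rewrite /= ?rr ?ri; apply: lim0 => // n.
  by have := congr1 (@complex.Re R) (z n); rewrite /= rr.
by have := congr1 (@complex.Im R) (z n); rewrite /= ri.
Qed.

Lemma Cint_ae f g : cmeasurable g -> f = g %[ae mu] -> Cint f -> Cint g.
Proof.
move=> [g1 g2] fg [f1 f2].
have h (a b : T -> R) : measurable_fun setT b -> a = b %[ae mu] -> Ri a -> Ri b.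
  move=> mb ab /integrableP[ma ia]; apply/integrableP; split; first by apply/measurable_EFinP.
  rewrite (ae_eq_integral (fun x => `|(a x)%:E|)%E)//.
  - by apply/measurableT_comp => //; apply/measurable_EFinP.
  - by apply/measurableT_comp.
  - by apply: filterS ab => x abx _; rewrite (abx I).
split; [apply: h f1 => //|apply: h f2 => //]; by apply: filterS fg => x E _; rewrite (E I).
Qed.

Lemma cintegral_ae f g : Cint f -> Cint g -> f = g %[ae mu] -> cintegral f = cintegral g.
Proof.
move=> [f1 f2] [g1 g2] fg.
apply: complexP => /=; congr fine; apply: ae_eq_integral => //;
  try (by apply: (measurable_int mu)); by apply: filterS fg => x E _; rewrite (E I).
Qed.

Lemma fourier_coef_ae f g j : Cint f -> Cint g -> f = g %[ae mu] ->
  fourier_coef f j = fourier_coef g j.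
Proof.
move=> cf cg fg; congr (_ * _); apply: cintegral_ae; try exact: Cint_Mplane.
by apply: filterS fg => x E _; rewrite (E I).
Qed.

Lemma preserves_null_ae m m' : preserves_null m -> measurable_fun setT m' ->
  (exists A, forall x, `|m' x| <= A) -> m = m' %[ae mu] -> preserves_null m'.
Proof.
move=> [mm mA pm] mm' [A mA'] mm'e; split => //; first by exists A.
move=> f f0; have [c1 c2] := pm f f0.
have ae : (fun x => (m x)%:C%C * f x) = (fun x => (m' x)%:C%C * f x) %[ae mu].
  by apply: filterS mm'e => x E _; rewrite (E I).
have mf : cmeasurable f.
  by case: f0 => [] [i1 i2] _; split; apply/measurable_EFinP; apply: (measurable_int mu).
have c' : Cint (fun x => (m' x)%:C%C * f x).
  by apply: Cint_ae ae c1; apply: cmeasurableM => //; split => //; exact: measurable_cst.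
by split => // j; rewrite -(fourier_coef_ae j c1 c' ae) c2.
Qed.

(** For $0\le b<2\pi$ the trace of the half-space on the period is the arc of centre and radius
    $b/2$, that is $\cos(x_i-b/2)\ge\cos(b/2)$; its indicator is the limit of the polynomials
    [arcstep] in that cosine. *)
Lemma preserves_null_halfspace (i : 'I_d) (b : R) :
  preserves_null \1_[set x : T | tnth x i <= b].
Proof.
have mi : measurable [set x : T | tnth x i <= b].
  rewrite (_ : [set _ | _] = setT `&` (fun x : T => tnth x i) @^-1` `]-oo, b]).
    exact: measurable_tnth.
  by apply/seteqP; split => x /=; rewrite in_itv/= => //; case.
have per := @torus_ae_period R d i.
have bd : exists A, forall x, `|(\1_[set x : T | tnth x i <= b] x : R)| <= A.
  by exists 1 => x; rewrite indicE; case: (_ \in _); rewrite ?normr1 ?normr0.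
have mI : measurable_fun setT (\1_[set x : T | tnth x i <= b] : T -> R).
  exact: measurable_indic.
have [b0|b0] := ltP b 0.
  apply: (preserves_null_ae (preserves_null_cst 0)) => //.
  apply: filterS per => x /andP[x0 _] _; rewrite indicE memNset//=.
  by apply/negP; rewrite -ltNge (lt_le_trans b0).
have [b1|b1] := leP (2 * pi) b.
  apply: (preserves_null_ae (preserves_null_cst 1)) => //.
  apply: filterS per => x /andP[_ x0] _; rewrite indicE mem_set//=.
  by rewrite (le_trans (ltW x0)).
pose c := cos (b / 2).
have c1 : -1 <= c <= 1 by rewrite cos_geN1 cos_le1.
have y1 (x : T) : -1 <= cos (tnth x i - b / 2) <= 1 by rewrite cos_geN1 cos_le1.
apply: (@preserves_null_ae (fun x => (c <= cos (tnth x i - b / 2))%R%:R)) => //.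
  apply: (@preserves_null_lim (fun n x => arcstep c (cos (tnth x i - b / 2)) n)).
  - move=> n; rewrite /arcstep /bump; apply: preserves_nullX.
    apply: preserves_nullB; first exact: preserves_null_cst.
    apply: preserves_nullX; apply: preserves_nullD; first exact: preserves_null_cst.
    apply: preserves_nullM; last exact: preserves_null_cst.
    apply: preserves_nullB; first exact: preserves_null_cst.
    exact: preserves_null_cos.
  - move=> n x; have /andP[p0 p1] := bump_itv n (arcstep_q_itv n c1 (y1 x)).
    by rewrite ger0_norm.
  - by move=> x; exact: arcstep_cvg.
apply: filterS per => x /andP[x0 x1] _.
rewrite indicE; congr ((nat_of_bool _)%:R); rewrite /c; apply/idP/idP.
  move=> h; rewrite mem_set//=; move: h; apply: contraTT; rewrite -!ltNge => bx.
  have p0 := pi_gt0 R.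
  (* The angle lies in $]b/2,2\pi-b/2[$; beyond $\pi$ it is reflected into $[0,\pi]$, where the
     cosine decreases. *)
  have [xp|xp] := leP (tnth x i - b / 2) pi.
    by rewrite ltr_cos ?in_itv/=; try lra; apply/andP; split; lra.
  rewrite (_ : cos (tnth x i - b / 2) = cos (2 * pi - (tnth x i - b / 2))); last first.
    by rewrite -[LHS]cosN -[LHS]cosD2pi -[pi *+ 2]mulr_natl addrC.
  by rewrite ltr_cos ?in_itv/=; try lra; apply/andP; split; lra.
rewrite inE/= => xb; have p0 := pi_gt0 R.
have -> : cos (tnth x i - b / 2) = cos `|tnth x i - b / 2|.
  by have [z0|z0] := ger0P (tnth x i - b / 2); rewrite // cosN.
rewrite leNgt.
have ax : `|tnth x i - b / 2| <= b / 2 by rewrite ler_norml; lra.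
rewrite ltr_cos ?in_itv/= ?normr_ge0/=; first by rewrite -leNgt.
  by apply/andP; split; lra.
by lra.
Qed.

End Uniqueness.

Section UniquenessTheorem.
Context {R : realType} {d : nat}.

Local Notation mu := (@torus_measure R d).
Local Notation T := (tpoint R d).
Local Notation Ri f := (mu.-integrable setT (EFin \o f)).

Implicit Types (f g h : torus_fun R d) (j k : d.-tuple int) (m : T -> R).

Let PN (A : set T) := preserves_null (\1_A : T -> R).

(** Finite unions come from $1_{A\cup B}=1_A+1_B-1_A1_B$, countable ones from the bounded limit of
    the finite unions. *)
Lemma preserves_null_sigma_algebra : sigma_algebra setT PN.
Proof.
have PNC A : PN A -> PN (setT `\` A).
  move=> pA; have := preserves_nullB (preserves_null_cst 1) pA.
  congr preserves_null; apply/funext => x.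
  rewrite !indicE setTD in_setC; case: (x \in A); first by rewrite subrr.
  by rewrite subr0.
split.
- by rewrite /PN indic0; exact: preserves_null_cst.
- exact: PNC.
- move=> A pA; pose U n := \bigcup_(i < n) A i.
  have pU n : PN (U n).
    elim: n => [|n ih]; first by rewrite /U bigcup_mkord big_ord0 /PN indic0; exact: preserves_null_cst.
    rewrite /U bigcup_mkord big_ord_recr/= -bigcup_mkord -/(U n).
    have := preserves_nullB (preserves_nullD ih (pA n)) (preserves_nullM ih (pA n)).
    congr preserves_null; apply/funext => x.
    rewrite !indicE in_setU; case: (x \in U n); case: (x \in A n) => /=; ring.
  apply: (preserves_null_lim pU).
    by move=> n x; rewrite indicE; case: (_ \in _); rewrite ?normr1 ?normr0.
  move=> x; apply: cvg_near_cst.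
  have [[i _ Aix]|nA] := pselect ((\bigcup_k A k) x).
    exists i.+1 => // n /= ni; rewrite !indicE !mem_set//.
      by exists i.
    by exists i.
  apply: nearW => n; rewrite !indicE !memNset// => -[i _ Ai]; apply: nA; by exists i.
Qed.

(** The product $\sigma$-algebra is generated by the coordinates and the Borel sets of the line by
    open rays, whose preimages are complements of the half-spaces already treated. *)
Lemma preserves_null_indic (A : set T) : measurable A -> PN A.
Proof.
have [PN0 PNC PNU] := preserves_null_sigma_algebra.
apply: smallest_sub; first exact: preserves_null_sigma_algebra.
rewrite -bigcup_seq/=; apply: bigcup_sub => i _ A' [B mB <-]; rewrite setTI.
pose S : set (set (measurableTypeR R)) :=
  [set B | PN ((fun x : T => tnth x i) @^-1` B)].
have sS : sigma_algebra setT S.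
  split.
  - by rewrite /S/= preimage_set0.
  - by move=> C /= pC; rewrite setTD preimage_setC -setTD; exact: PNC.
  - by move=> F pF; rewrite /S/= preimage_bigcup; exact: PNU.
have : <<s (RGenOInfty.G (R:=R)) >> `<=` S.
  apply: smallest_sub => // _ [x ->]; rewrite /S/=.
  rewrite (_ : _ @^-1` _ = setT `\` [set t : T | tnth t i <= x]).
    by apply: PNC; exact: preserves_null_halfspace.
  apply/seteqP; split => t /=; rewrite in_itv/= andbT.
    by move=> xt; split => //; apply/negP; rewrite -ltNge.
  by move=> [_ /negP]; rewrite -ltNge.
by apply; rewrite -[X in X B]RGenOInfty.measurableE.
Qed.

(** Multiply by the indicator of the set where the real part is positive: the coefficient at
    frequency zero has a nonnegative integrand as its real part and still vanishes. *)
Lemma null_coefs_Re_le0 f : null_coefs f -> {ae mu, forall x, Re (f x) <= 0}.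
Proof.
move=> f0; have [[f1 f2] _] := f0.
pose A := [set x : T | 0 < Re (f x)].
have m1 : measurable_fun setT (fun x => Re (f x)).
  by apply/measurable_EFinP; exact: (measurable_int mu).
have mA : measurable A.
  rewrite /A -[X in measurable X]setTI.
  rewrite (_ : _ `&` _ = setT `&` (fun x => Re (f x)) @^-1` `]0, +oo[%classic); last first.
    by congr (_ `&` _); apply/seteqP; split => x /=; rewrite in_itv/= andbT.
  exact: m1.
have [_ _ /(_ f f0)[[c1 _] /(_ jzero)]] := preserves_null_indic mA.
rewrite /fourier_coef => /eqP; rewrite mulf_eq0 => /orP[|/eqP].
  move=> /eqP/(congr1 (@complex.Re R))/= /eqP.
  by rewrite invr_eq0 gt_eqF// P_gt0.
rewrite (_ : (fun x : T => _) = (fun x => (\1_A x)%:C%C * f x)); last first.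
  apply/funext => x; rewrite (_ : plane_wave jzero x = 1) ?rmorph1 ?mulr1//.
  rewrite plane_waveE /phase big1 ?cos0 ?sin0// => i _.
  by rewrite tnth_mktuple mulr0z mul0r.
move=> /(congr1 (@complex.Re R))/= h.
have ae0 : ae_eq mu setT (fun x => (Re ((\1_A x)%:C%C * f x))%:E) (cst 0%E).
  apply/(ae_eq_integral_abs mu measurableT); first exact: (measurable_int mu).
  rewrite (_ : (\int[mu]_x _)%E = (\int[mu]_x (Re ((\1_A x)%:C%C * f x))%:E)%E).
    by rewrite -EFin_Rint// h.
  apply: eq_integral => x _; rewrite gee0_abs// lee_fin Re_mul/= mul0r subr0.
  rewrite indicE; case: (boolP (x \in A)) => [|_]; last by rewrite mul0r.
  by rewrite inE /A/= mul1r => /ltW.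
apply: filterS ae0 => x /(_ I)/= [].
rewrite Re_mul/= mul0r subr0 indicE leNgt => h'; apply/negP => xA; move: h'.
by rewrite mem_set//= mul1r => e; move: xA; rewrite e ltxx.
Qed.

(** The sign statement is applied to $f$, $-f$, $\mathrm{i}f$ and $-\mathrm{i}f$. *)
Lemma null_coefs_ae0 f : null_coefs f -> f = (fun=> 0) %[ae mu].
Proof.
move=> f0.
have h1 := null_coefs_Re_le0 f0.
have h2 := null_coefs_Re_le0 (null_coefsZ (-1) f0).
have h3 := null_coefs_Re_le0 (null_coefsZ (0 +i* 1)%C f0).
have h4 := null_coefs_Re_le0 (null_coefsZ (0 +i* -1)%C f0).
apply: filterS3 (filterI h1 h2) h3 h4 => x [{}h1]; rewrite !Re_mul/= => {}h2 {}h3 {}h4 _.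
by apply: complexP => /=; apply/eqP; rewrite eq_le; apply/andP; split; lra.
Qed.

Lemma fourier_coef_inj f g : Cint f -> Cint g ->
  (forall j, fourier_coef f j = fourier_coef g j) -> f = g %[ae mu].
Proof.
move=> cf cg fg.
have : null_coefs (fun x => f x - g x).
  split; first exact: CintB.
  by move=> j; rewrite fourier_coefB// fg subrr.
move=> /null_coefs_ae0; apply: filterS => x h _.
by apply/eqP; rewrite -subr_eq0 (h I).
Qed.

End UniquenessTheorem.

(** * Completeness and the Riesz-Fischer theorem *)

Lemma cvg_summable_increments (R : realType) (u v : R^nat) (B : R) :
  (forall n, `|u n.+1 - u n| <= v n) -> (forall n, \sum_(k < n) v k <= B) ->
  cvgn u.
Proof.
move=> uv vB.
have cs : cvgn (series (telescope u)).
  apply: normed_cvg; apply: nondecreasing_is_cvgn.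
    by apply: nondecreasing_series => n _ _; exact: normr_ge0.
  exists B => _ [n _ <-]; rewrite /= seriesEord/= (le_trans _ (vB n))//.
  by apply: ler_sum => k _; exact: uv.
rewrite (_ : u = (fun n => series (telescope u) n + u 0%N)).
  by apply: is_cvgD => //; exact: is_cvg_cst.
by apply/funext => n; rewrite telescopeK/= subrK.
Qed.

Section Completeness.
Context {R : realType} {d : nat}.

Local Notation mu := (@torus_measure R d).
Local Notation T := (tpoint R d).
Local Notation Ri f := (mu.-integrable setT (EFin \o f)).
Local Notation P := ((2 * pi : R) ^+ d).

Implicit Types (f g h : torus_fun R d) (j k : d.-tuple int).

Lemma eq_n2_ae f g : inL2 f -> inL2 g -> f = g %[ae mu] -> n2 f = n2 g.
Proof.
move=> /inL2_int if_ /inL2_int ig fg; rewrite /n2 /Rintegral; congr fine.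
apply: ae_eq_integral => //; try exact: (measurable_int mu).
by apply: filterS fg => x E _; rewrite (E I).
Qed.

Lemma inL2_ae f g : cmeasurable g -> f = g %[ae mu] -> inL2 f -> inL2 g.
Proof.
move=> mg fg If; have If' := inL2_int If; have mf := inL2_meas If.
apply/inL2P; split=> //; apply/integrableP; split.
  by apply/measurable_EFinP; exact: measurable_sqc.
move/integrableP : If' => [_]; rewrite (ae_eq_integral (fun x => `|(sqc (g x))%:E|)%E)//.
- by apply/measurableT_comp => //; apply/measurable_EFinP; exact: measurable_sqc.
- by apply/measurableT_comp => //; apply/measurable_EFinP; exact: measurable_sqc.
- by apply: filterS fg => x E _ /=; rewrite (E I).
Qed.

(** The constant 4 is stable under the induction: splitting off the first increment gives $2(4\cdot
    4^{-n-1}+4^{-n})=4\cdot 4^{-n}$. *)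
Lemma n2_increments (g_ : nat -> torus_fun R d) : (forall n, inL2 (g_ n)) ->
  (forall n, n2 (fun x => g_ n.+1 x - g_ n x) <= (4^-1) ^+ n) ->
  forall n l, n2 (fun x => g_ (n + l)%N x - g_ n x) <= 4 * (4^-1) ^+ n.
Proof.
move=> Ig gn n l; elim: l n => [|l ih] n.
  rewrite addn0 (_ : (fun x => _) = fun=> 0); last by apply/funext => x; rewrite subrr.
  by rewrite /n2 sqc0 Rintegral_cst// mul0r mulr_ge0// exprn_ge0.
rewrite addnS -addSn.
rewrite (_ : (fun x => _) = fun x => (g_ (n.+1 + l)%N x - g_ n.+1 x) + (g_ n.+1 x - g_ n x)); last first.
  by apply/funext => x; rewrite addrA subrK.
rewrite (le_trans (n2D_le _ _))//; try exact: inL2B.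
have := ih n.+1; have := gn n; rewrite exprS; set q := 4^-1 ^+ n; lra.
Qed.

(** The classical completeness argument: the sum of the moduli of the increments has a finite
    integral, hence the sequence converges almost everywhere, and Fatou's lemma carries the distance
    bounds to the limit. *)
Lemma L2_complete (g_ : nat -> torus_fun R d) : (forall n, inL2 (g_ n)) ->
  (forall n, n2 (fun x => g_ n.+1 x - g_ n x) <= (4^-1) ^+ n) ->
  exists2 G, inL2 G & forall n, n2 (fun x => G x - g_ n x) <= 4 * (4^-1) ^+ n.
Proof.
move=> Ig gn.
pose rho n (x : T) : R := normc (g_ n.+1 x - g_ n x).
have mrho n : measurable_fun setT (rho n).
  rewrite (_ : rho n = Num.sqrt \o (fun x => sqc (g_ n.+1 x - g_ n x))); last first.
    by apply/funext => x; rewrite /= -normcE.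
  have ms : measurable_fun setT (@Num.sqrt R).
    by apply: continuous_measurable_fun; exact: sqrt_continuous.
  apply: measurableT_comp ms _.
  by apply: measurable_sqc; apply: cmeasurableB; exact: inL2_meas.
have rho0 n x : 0 <= rho n x by exact: normc_ge0.
have Irho n : Ri (rho n).
  apply: (Ri_le (b := fun x => 1 + sqc (g_ n.+1 x - g_ n x))) => //.
    move=> x; rewrite ger0_norm// -sqr_normcE -/(rho n x).
    by have := sqr_ge0 (rho n x - 2^-1); nra.
  apply: RiD; last by apply: inL2_int; exact: inL2B.
  by apply: (@bounded_integrable _ _ _ _ _ 1) => [|x]; [exact: measurable_cst|rewrite normr1].
have rhoint n : \int[mu]_x rho n x <= (P + 1) * (2^-1) ^+ n.
  (* The inequality $\rho\le(t+\rho^2/t)/2$ with $t=2^{-n}$ turns the squared $L^2$ bound $4^{-n}$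
     into a summable $L^1$ bound. *)
  set t : R := (2^-1) ^+ n.
  have t0 : 0 < t by rewrite exprn_gt0.
  have Ic : Ri (fun=> t).
    apply: (@bounded_integrable _ _ _ _ _ t) => [|x]; first exact: measurable_cst.
    by rewrite ger0_norm// ltW.
  have Is : Ri (fun x => sqc (g_ n.+1 x - g_ n x)) by apply: inL2_int; exact: inL2B.
  apply: (@le_trans _ _ (\int[mu]_x (2^-1 * (t + t^-1 * sqc (g_ n.+1 x - g_ n x))))).
    apply: le_Rint => //; first by apply: RiZ; apply: RiD => //; exact: RiZ.
    move=> x; rewrite -sqr_normcE -/(rho n x).
    rewrite ler_pdivlMl// -(ler_pM2l t0) mulrDr [t * (t^-1 * _)]mulrA mulfV ?gt_eqF// mul1r.
    by have := sqr_ge0 (rho n x - t); nra.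
  rewrite RintZ; last by apply: RiD => //; exact: RiZ.
  rewrite RintD//; last exact: RiZ.
  rewrite RintZ// Rintegral_cst//.
  rewrite (_ : fine _ = P); last by rewrite [X in fine X]torus_measureT.
  have : t^-1 * n2 (fun x => g_ n.+1 x - g_ n x) <= t.
    rewrite ler_pdivrMl// (le_trans (gn n))// /t -exprMn.
    by rewrite (_ : 2^-1 * 2^-1 = 4^-1 :> R)//; lra.
  rewrite -/(n2 (fun x => g_ n.+1 x - g_ n x)).
  have P0 := P_gt0 (R := R) (d := d); nra.
pose H (x : T) := (\sum_(0 <= n <oo) (rho n x)%:E)%E.
have mH : measurable_fun setT H.
  apply: ge0_emeasurable_sum => [n x _ _|n _]; first by rewrite lee_fin.
  by apply/measurable_EFinP.
have Hfin : mu.-integrable setT H.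
  apply/integrableP; split => //.
  rewrite (eq_integral H); last first.
    by move=> x _; rewrite gee0_abs//; apply: nneseries_ge0 => n _ _; rewrite lee_fin.
  rewrite integral_nneseries//; last 2 first.
  - by move=> n; apply/measurable_EFinP.
  - by move=> n x _; rewrite lee_fin.
  apply: (@le_lt_trans _ _ ((P + 1) * 2)%:E); last exact: ltry.
  apply: lime_le.
    by apply: is_cvg_nneseries => n _ _; apply: integral_ge0 => x _; rewrite lee_fin.
  apply: nearW => n.
  rewrite big_mkord (eq_bigr (fun k : 'I_n => (\int[mu]_x rho k x)%:E)); last first.
    by move=> k _; rewrite EFin_Rint.
  rewrite sumEFin lee_fin (@le_trans _ _ (\sum_(k < n) (P + 1) * (2^-1) ^+ k))//.
    by apply: ler_sum => k _; exact: rhoint.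
  rewrite -big_distrr/= ler_wpM2l//; first by have := P_gt0 (R := R) (d := d); lra.
  have := @subrX1 R 2^-1 n; set S := \sum_(i < n) _; set q := _ ^+ n.
  have : 0 <= q by rewrite exprn_ge0.
  lra.
pose A := [set x | (H x < +oo)%E].
have mA : measurable A.
  rewrite (_ : A = setT `&` A); first exact: emeasurable_fun_infty_o.
  by rewrite setTI.
have aeA : {ae mu, forall x, A x}.
  apply: filterS (integrable_ae measurableT Hfin) => x /(_ I).
  by rewrite /A/= ge0_fin_numE//; apply: nneseries_ge0 => n _ _; rewrite lee_fin.
(* Cutting off by the indicator of [A] makes the sequence converge at every point, so that its limit
   is measurable, and alters it on a null set only. *)
pose g' n : torus_fun R d := fun x => (\1_A x)%:C%C * g_ n x.
have mg' n : cmeasurable (g' n).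
  apply: cmeasurableM; last exact: inL2_meas.
  by split => /=; [exact: measurable_indic|exact: measurable_cst].
have g'g n : g_ n = g' n %[ae mu].
  by apply: filterS aeA => x Ax _; rewrite /g' indicE mem_set// mul1r.
have Ig' n : inL2 (g' n) by apply: inL2_ae (g'g n) _.
have cg x : A x -> cvgn (fun n => Re (g_ n x)) /\ cvgn (fun n => Im (g_ n x)).
  rewrite /A/= => Ax.
  have rB n : \sum_(k < n) rho k x <= fine (H x).
    rewrite -lee_fin fineK; last first.
      by rewrite ge0_fin_numE//; apply: nneseries_ge0 => i _ _; rewrite lee_fin.
    rewrite -sumEFin -(big_mkord xpredT (fun i => (rho i x)%:E)).
    by apply: nneseries_lim_ge => i _; rewrite lee_fin.
  split; apply: (@cvg_summable_increments _ _ (rho ^~ x) _ _ rB) => n.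
    by rewrite -ReB; exact: Re_le_normc.
  by rewrite -ImB; exact: Im_le_normc.
pose G : torus_fun R d := fun x => (limn (fun n => Re (g' n x)) +i* limn (fun n => Im (g' n x)))%C.
have cg' x : cvgn (fun n => Re (g' n x)) /\ cvgn (fun n => Im (g' n x)).
  rewrite /g' indicE; case: (boolP (x \in A)) => [|_].
    rewrite inE => /cg[c1 c2].
    by split; [move: c1|move: c2]; congr (cvgn _); apply/funext => n; rewrite mul1r.
  by split; under eq_fun do rewrite mul0r; exact: is_cvg_cst.
have mG : cmeasurable G.
  split.
    apply: (@measurable_fun_cvg _ _ _ _ (fun n x => Re (g' n x))) => [n|x _].
      by case: (mg' n).
    by case: (cg' x).
  apply: (@measurable_fun_cvg _ _ _ _ (fun n x => Im (g' n x))) => [n|x _].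
    by case: (mg' n).
  by case: (cg' x).
have bound n : (\int[mu]_x (sqc (G x - g' n x))%:E <= (4 * (4^-1) ^+ n)%:E)%E.
  pose F l x := (sqc (g' (n + l)%N x - g' n x))%:E.
  have mF l : measurable_fun setT (F l).
    by apply/measurable_EFinP; apply: measurable_sqc; exact: cmeasurableB.
  have FG x : F ^~ x @ \oo --> (sqc (G x - g' n x))%:E.
    apply: cvg_EFin; first exact: nearW.
    have [c1 c2] := cg' x.
    have sh (u : nat -> R) (l : R) : u l @[l --> \oo] --> l ->
        u (n + l)%N @[l --> \oo] --> l.
      by rewrite -(cvg_shiftn n); under eq_fun do rewrite addnC.
    have e (z : nat -> R[i]) (w c : R[i]) : Re (z l) @[l --> \oo] --> Re w ->
        Im (z l) @[l --> \oo] --> Im w ->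
        sqc (z (n + l)%N - c) @[l --> \oo] --> sqc (w - c).
      move=> /sh al /sh bl; rewrite /sqc ReB ImB.
      under eq_fun do rewrite ReB ImB.
      apply: cvgD; rewrite !expr2; under eq_fun do rewrite expr2;
        by apply: cvgM; apply: cvgB => //; exact: cvg_cst.
    exact: (e (fun n => g' n x) (G x)).
  have -> : (\int[mu]_x (sqc (G x - g' n x))%:E = \int[mu]_x limn_einf (F ^~ x))%E.
    apply: eq_integral => x _; rewrite limn_einf_lim; apply/esym/cvg_lim => //.
    by apply: cvg_einfs; exact: FG.
  apply: (le_trans (fatou _ measurableT mF _)).
    by move=> l x _; rewrite lee_fin sqc_ge0.
  rewrite limn_einf_lim; apply: lime_le; first exact: is_cvg_einfs.
  apply: nearW => l; apply: (@le_trans _ _ (\int[mu]_x F l x)%E).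
    by apply: ereal_inf_lbound; exists l => //=.
  rewrite -EFin_Rint; last by apply: inL2_int; exact: inL2B.
  rewrite lee_fin -/(n2 (fun x => g' (n + l)%N x - g' n x)).
  rewrite (@eq_n2_ae _ (fun x => g_ (n + l)%N x - g_ n x)); try exact: inL2B.
    exact: n2_increments.
  by apply: filterS2 (g'g (n + l)%N) (g'g n) => x E1 E2 _; rewrite (E1 I) (E2 I).
have IGg n : inL2 (fun x => G x - g' n x).
  have mGg : cmeasurable (fun x => G x - g' n x) by exact: cmeasurableB.
  apply/inL2P; split => //; apply/integrableP; split.
    by apply/measurable_EFinP; exact: measurable_sqc.
  rewrite (eq_integral (fun x => (sqc (G x - g' n x))%:E)); last first.
    by move=> x _; rewrite gee0_abs// lee_fin sqc_ge0.
  by rewrite (le_lt_trans (bound n))// ltry.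
have IG : inL2 G.
  have := inL2D (IGg 0%N) (Ig' 0%N).
  by congr inL2; apply/funext => x; rewrite subrK.
exists G => // n.
have IG' : inL2 (fun x => G x - g_ n x) by exact: inL2B.
rewrite (eq_n2_ae IG' (IGg n)).
  by have := bound n; rewrite -(EFin_Rint (inL2_int (IGg n))) lee_fin.
by apply: filterS (g'g n) => x E _; rewrite (E I).
Qed.

End Completeness.

Section RieszFischer.
Context {R : realType} {d : nat}.

Local Notation mu := (@torus_measure R d).
Local Notation T := (tpoint R d).
Local Notation Ri f := (mu.-integrable setT (EFin \o f)).
Local Notation P := ((2 * pi : R) ^+ d).

Implicit Types (f g h : torus_fun R d) (j k : d.-tuple int).

Lemma le_geometric_bound (x C a : R) : (forall n, x <= a + C * (4^-1) ^+ n) -> x <= a.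
Proof.
move=> h; rewrite -(addr0 a) -(mulr0 C).
have : (a + C * 4^-1 ^+ n) @[n --> \oo] --> a + C * 0.
  apply: cvgD; first exact: cvg_cst.
  by apply: cvgM; [exact: cvg_cst|apply: cvg_expr; rewrite ger0_norm; lra].
move=> c; rewrite -(cvg_lim _ c)//; apply: limr_ge; last exact: nearW.
by apply/cvg_ex; eexists; exact: c.
Qed.

Lemma trig_filter (J : seq (d.-tuple int)) (p : pred (d.-tuple int))
    (c : d.-tuple int -> R[i]) x :
  trig J c x = trig [seq j <- J | p j] c x + trig [seq j <- J | ~~ p j] c x.
Proof. by rewrite /trig (bigID p)/= !big_filter. Qed.

(** The frequencies common to [J] and [J'] cancel; those left over avoid [J] or [J'], so each group
    is a tail. *)
Lemma n2_trigB (J J' : seq (d.-tuple int)) (c : d.-tuple int -> R[i]) (e e' : R) :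
  uniq J -> uniq J' ->
  (forall K, uniq K -> (forall j, j \in K -> j \notin J) -> \sum_(j <- K) sqc (c j) <= e) ->
  (forall K, uniq K -> (forall j, j \in K -> j \notin J') -> \sum_(j <- K) sqc (c j) <= e') ->
  n2 (fun x => trig J' c x - trig J c x) <= 2 * P * (e + e').
Proof.
move=> uJ uJ' Je Je'.
pose D := [seq j <- J' | j \notin J]; pose D' := [seq j <- J | j \notin J'].
have -> : (fun x => trig J' c x - trig J c x) =
    (fun x : T => trig D c x + -1 * trig D' c x).
  apply/funext => x; rewrite (trig_filter J' [in J]) (trig_filter J [in J']).
  rewrite (_ : trig [seq j <- J | j \in J'] c x = trig [seq j <- J' | j \in J] c x); last first.
    apply: perm_big; apply: uniq_perm; rewrite ?filter_uniq// => j.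
    by rewrite !mem_filter andbC.
  by rewrite mulN1r opprD addrACA subrr add0r.
rewrite (le_trans (n2D_le _ _))//; [exact: inL2_trig|by apply: inL2Z; exact: inL2_trig|].
rewrite n2Z; last exact: inL2_trig.
rewrite (_ : sqc (-1) = 1); last by rewrite sqcN /sqc/= expr1n expr0n addr0.
have uD : uniq D by exact: filter_uniq.
have uD' : uniq D' by exact: filter_uniq.
rewrite mul1r !n2_trig// -mulrA ler_pM2l// -mulrDr ler_pM2l ?P_gt0//.
by apply: lerD; [apply: Je|apply: Je'] => // j; rewrite mem_filter => /andP[].
Qed.

Lemma riesz_fischer (c : d.-tuple int -> R[i]) (B : R) : sumB (fun j => sqc (c j)) B ->
  exists2 f, inL2 f & (forall j, fourier_coef f j = c j) /\ n2 f <= P * B.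
Proof.
move=> cB; have P0 := P_gt0 (R := R) (d := d).
(* With this tolerance $2P(e_n+e_{n+1})=\frac58 4^{-n}$, within the increments allowed by
   [L2_complete]. *)
pose e n : R := (4 * P)^-1 * 4^-1 ^+ n.
have e0 n : 0 < e n by rewrite /e mulr_gt0// ?exprn_gt0 ?invr_gt0// mulr_gt0.
have /choice[J hJ] : forall n, exists J, uniq J /\
    forall K, uniq K -> (forall j, j \in K -> j \notin J) -> \sum_(j <- K) sqc (c j) <= e n.
  by move=> n; have [J uJ hJ] := sumB_tail cB (e0 n); exists J.
have uJ n : uniq (J n) by case: (hJ n).
have [n||G IG Gn] := @L2_complete R d (fun n => trig (J n) c); first exact: inL2_trig.
  move=> n; have [_ h1] := hJ n; have [_ h2] := hJ n.+1.
  rewrite (le_trans (n2_trigB _ _ h1 h2))// /e exprS.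
  have q0 : 0 <= 4^-1 ^+ n :> R by rewrite exprn_ge0.
  rewrite -mulrDr mulrA (_ : 2 * P * (4 * P)^-1 = 2^-1); last by field; rewrite gt_eqF.
  lra.
have Gc j : fourier_coef G j = c j.
  apply/eqP; rewrite -subr_eq0; apply/eqP/sqc_eq0/eqP; rewrite eq_le sqc_ge0 andbT.
  (* The two errors contribute $2(4+\frac14)P^{-1}4^{-n}$; 9 rounds this factor up. *)
  apply: (@le_geometric_bound _ (9 * P^-1)) => n; rewrite add0r.
  have h1 : sqc (fourier_coef G j - fourier_coef (trig (J n) c) j) <= P^-1 * (4 * 4^-1 ^+ n).
    rewrite ler_pdivlMl// -fourier_coefB; try by apply: Cint_L2 => //; exact: inL2_trig.
    apply: le_trans (Gn n); apply: sqc_fourier_coef_le; apply: inL2B => //.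
    exact: inL2_trig.
  have h2 : sqc (fourier_coef (trig (J n) c) j - c j) <= e n.
    rewrite fourier_coef_trig//; case: ifPn => [_|jJ].
      by rewrite subrr sqc0 ltW.
    rewrite sub0r sqcN; have [_ /(_ [:: j] isT)] := hJ n; rewrite big_seq1; apply.
    by move=> i; rewrite inE => /eqP ->.
  have -> : fourier_coef G j - c j = (fourier_coef G j - fourier_coef (trig (J n) c) j) +
     (fourier_coef (trig (J n) c) j - c j) by rewrite addrA subrK.
  rewrite (le_trans (sqcD_le _ _))//; move: h1 h2; rewrite /e invfM.
  set q := _ ^+ n; set p := P^-1.
  have : 0 <= p * q by rewrite mulr_ge0 ?invr_ge0 ?(ltW P0)// exprn_ge0.
  nra.
exists G => //; split=> //.
apply: (@le_geometric_bound _ 4) => n.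
have := Gn n; rewrite (_ : trig (J n) c = trig (J n) (fourier_coef G)); last first.
  by apply/funext => x; apply: eq_bigr => j _; rewrite Gc.
rewrite n2_sub_trig// => /le_trans h.
have : P * \sum_(j <- J n) sqc (fourier_coef G j) <= P * B.
  rewrite ler_pM2l//; under eq_bigr do rewrite Gc; exact: cB.
have := h _ (lexx _); lra.
Qed.

(** The converse of Bessel's inequality: Riesz-Fischer produces a function with these coefficients
    and the right norm, and it is [f] because the coefficients determine the function. *)
Lemma parseval_le f B : inL2 f -> sumB (fun j => sqc (fourier_coef f j)) B -> n2 f <= P * B.
Proof.
move=> If /riesz_fischer[g Ig [gf /(le_trans _)]]; apply.
rewrite (@eq_n2_ae _ _ f g)//; apply: fourier_coef_inj; try exact: Cint_L2.
by move=> j; rewrite gf.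
Qed.

Lemma trig_approx f (e : R) : inL2 f -> 0 < e ->
  exists2 J, uniq J & n2 (fun x => f x - trig J (fourier_coef f) x) <= e.
Proof.
move=> If e0; have P0 := P_gt0 (R := R) (d := d).
have fB := bessel If.
have [J uJ hJ] := sumB_tail fB (divr_gt0 e0 P0).
exists J => //; rewrite n2_sub_trig//.
suff /(parseval_le If) : sumB (fun j => sqc (fourier_coef f j))
    (\sum_(j <- J) sqc (fourier_coef f j) + e / P).
  by rewrite mulrDr (mulrC e) mulrA mulfV ?gt_eqF// mul1r; lra.
move=> K uK; rewrite (bigID [in J])/= lerD//.
  rewrite -big_filter; apply: ler_sum_sub => //; first exact: filter_uniq.
    by move=> j; rewrite mem_filter => /andP[].
  by move=> j; exact: sqc_ge0.
rewrite -big_filter; apply: hJ; first exact: filter_uniq.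
by move=> j; rewrite mem_filter => /andP[].
Qed.

Lemma normc_trig_le f (A : R) J (x : T) : sumB (fun j => normc (fourier_coef f j)) A ->
  uniq J -> normc (trig J (fourier_coef f) x) <= A.
Proof.
move=> fA uJ; rewrite (le_trans (normc_sum _ _))// (le_trans _ (fA J uJ))//.
apply: ler_sum => j _; rewrite Normc.normcM.
by rewrite [X in _ * X]normcE sqc_plane_wave sqrtr1 mulr1.
Qed.

(** Every partial Fourier sum is bounded by [A] pointwise, so the excess of $|f|$ over [A] is at
    most the distance to that sum, whose $L^2$ norm is as small as desired. Hence the squared excess
    [phi] has integral zero. *)
Lemma Linf_of_l1 f (A : R) : inL2 f -> sumB (fun j => normc (fourier_coef f j)) A ->
  {ae mu, forall x, normc (f x) <= A}.
Proof.
move=> If fA; have A0 := sumB_ge0 fA.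
pose phi (x : T) := Num.max (normc (f x) - A) 0 ^+ 2.
have mf := inL2_meas If.
have mphi : measurable_fun setT phi.
  apply: measurable_funX; apply: measurable_maxr; last exact: measurable_cst.
  apply: measurable_funB; last exact: measurable_cst.
  rewrite (_ : (fun x => _) = Num.sqrt \o (fun x => sqc (f x))); last first.
    by apply/funext => x; rewrite /= -normcE.
  have ms : measurable_fun setT (@Num.sqrt R).
    by apply: continuous_measurable_fun; exact: sqrt_continuous.
  by apply: measurableT_comp ms _; exact: measurable_sqc.
have phi0 x : 0 <= phi x by exact: sqr_ge0.
have le J x : uniq J -> phi x <= sqc (f x - trig J (fourier_coef f) x).
  move=> uJ; rewrite -sqr_normcE /phi ler_sqr ?nnegrE ?normc_ge0 ?le_max ?lexx ?orbT//.
  rewrite ge_max normc_ge0 andbT.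
  have := normc_trig_le x fA uJ.
  have := ler_normcD (f x - trig J (fourier_coef f) x) (trig J (fourier_coef f) x).
  rewrite subrK; lra.
have Iphi : Ri phi.
  apply: (Ri_le (b := fun x => sqc (f x - trig [::] (fourier_coef f) x))) => //.
    by move=> x; rewrite ger0_norm// le.
  by apply: inL2_int; apply: inL2B => //; exact: inL2_trig.
have iphi : \int[mu]_x phi x = 0.
  apply/eqP; rewrite eq_le Rintegral_ge0// andbT.
  apply/ler_addgt0Pl => e e0; rewrite addr0.
  have [J uJ /(le_trans _)] := trig_approx If e0; apply.
  apply: le_Rint => //; last by move=> x; exact: le.
  by apply: inL2_int; apply: inL2B => //; exact: inL2_trig.
have ae0 : ae_eq mu setT (fun x => (phi x)%:E) (cst 0%E).
  apply/(ae_eq_integral_abs mu measurableT); first by apply/measurable_EFinP.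
  rewrite (eq_integral (fun x => (phi x)%:E)); last by move=> x _; rewrite gee0_abs// lee_fin.
  by rewrite -EFin_Rint// iphi.
apply: filterS ae0 => x /(_ I)[] /eqP; rewrite sqrf_eq0 => /eqP h.
by rewrite -subr_le0 -h le_max lexx.
Qed.

Lemma inL2_le_ae f (b : T -> R) : cmeasurable f -> Ri b ->
  {ae mu, forall x, sqc (f x) <= b x} -> inL2 f.
Proof.
move=> mf ib fb; apply/inL2P; split => //; apply/integrableP; split.
  by apply/measurable_EFinP; exact: measurable_sqc.
have /integrableP[mb] := ib; apply: le_lt_trans; apply: ae_ge0_le_integral => //.
- by apply/measurableT_comp => //; apply/measurable_EFinP; exact: measurable_sqc.
- exact: measurableT_comp.
- apply: filterS fb => x h _; rewrite lee_fin ger0_norm ?sqc_ge0//.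
  by rewrite (le_trans h)// ler_norm.
Qed.

Lemma n2_le_ae f g (a : R) : inL2 f -> inL2 g ->
  {ae mu, forall x, sqc (f x) <= a * sqc (g x)} -> n2 f <= a * n2 g.
Proof.
move=> If Ig h; rewrite /n2 -RintZ; last exact: inL2_int.
have i2 : Ri (fun x => a * sqc (g x)) by apply: RiZ; exact: inL2_int.
rewrite -lee_fin !EFin_Rint//; last exact: inL2_int.
(* The sign of [a] is not given, so the majorant is nonnegative only almost everywhere; the maximum
   with 0 makes it so everywhere. *)
rewrite (ae_eq_integral (fun x => (Num.max (a * sqc (g x)) 0)%:E) (fun x => (a * sqc (g x))%:E))//.
- apply: ae_ge0_le_integral => //.
  + by move=> x _; rewrite lee_fin sqc_ge0.
  + by apply/measurable_EFinP; apply: measurable_sqc; exact: inL2_meas.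
  + by move=> x _; rewrite lee_fin le_max lexx orbT.
  + apply/measurable_EFinP; apply: measurable_maxr; last exact: measurable_cst.
    by apply: measurable_funM => //; apply: measurable_sqc; exact: inL2_meas.
  + by apply: filterS h => x h _; rewrite lee_fin le_max h.
- exact: (measurable_int mu).
- apply/measurable_EFinP; apply: measurable_maxr; last exact: measurable_cst.
  by apply: measurable_funM => //; apply: measurable_sqc; exact: inL2_meas.
- apply: filterS h => x h _; congr EFin; apply/esym/max_idPl.
  exact: le_trans (sqc_ge0 _) h.
Qed.

(** Replacing $f$ by a partial Fourier sum makes the coefficient of the product a finite
    convolution; by Cauchy-Schwarz the error is controlled by an $L^2$ distance, hence uniformly in
    [k]. *)
Lemma prod_coef_approx f g (e : R) : inL2 f -> inL2 g -> 0 < e ->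
  exists2 J, uniq J & forall k,
    sqc (fourier_coef (fun x => f x * g x) k -
         \sum_(j <- J) fourier_coef f j * fourier_coef g (jsub k j)) <= e.
Proof.
move=> If Ig e0; have P0 := P_gt0 (R := R) (d := d).
have G0 := n2_ge0 g.
(* Cauchy-Schwarz multiplies the approximation error by [n2 g] and the normalisation divides by
   $P^2$; the added 1 avoids dividing by zero. *)
have e1 : 0 < e * P ^+ 2 / (n2 g + 1).
  apply: divr_gt0; first by apply: mulr_gt0 => //; exact: exprn_gt0.
  exact: ltr_wpDl.
have [J uJ hJ] := trig_approx If e1; exists J => // k.
have IJ := inL2_trig J (fourier_coef f).
have -> : \sum_(j <- J) fourier_coef f j * fourier_coef g (jsub k j) =
    fourier_coef (fun x => trig J (fourier_coef f) x * g x) k.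
  rewrite (_ : (fun x => _) = (fun x => \sum_(j <- J) fourier_coef f j * (g x * plane_wave j x))).
    rewrite fourier_coef_sum; last first.
      move=> j; apply: CintZ; apply: Cint_L2.
      by have := inL2_Mplane (jneg j) Ig; congr inL2; apply/funext => x; rewrite plane_waveJ jnegK.
    apply: eq_bigr => j _; rewrite fourier_coefZ ?fourier_coef_Mplane//.
    apply: Cint_L2.
    by have := inL2_Mplane (jneg j) Ig; congr inL2; apply/funext => x; rewrite plane_waveJ jnegK.
  apply/funext => x; rewrite /trig big_distrl/=; apply: eq_bigr => j _.
  by rewrite -mulrA [plane_wave _ _ * _]mulrC.
rewrite -fourier_coefB; try exact: CintM.
rewrite (_ : (fun x => _) = (fun x => (f x - trig J (fourier_coef f) x) * g x)); last first.
  by apply/funext => x; rewrite mulrBl.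
have := cintegral_CS (inL2B If IJ) (inL2_Mplane k Ig).
rewrite (_ : (fun x => _) = (fun x => (f x - trig J (fourier_coef f) x) * g x * (plane_wave k x)^*%C)); last first.
  by apply/funext => x; rewrite mulrA.
rewrite cintegral_Mplane sqcM sqcR (_ : n2 (fun x => g x * (plane_wave k x)^*%C) = n2 g); last first.
  by apply: eq_Rintegral => x _; rewrite sqcM sqcJ sqc_plane_wave mulr1.
move=> h; rewrite -(ler_pM2l (exprn_gt0 2 P0)) (le_trans h)//.
rewrite (@le_trans _ _ (e * P ^+ 2 / (n2 g + 1) * n2 g))// ?ler_wpM2r//.
rewrite [leRHS]mulrC -[leRHS]mulr1 -mulrA ler_wpM2l//.
  by rewrite mulr_ge0 ?(ltW e0)// exprn_ge0// ltW.
by rewrite mulrC ler_pdivrMr ?mul1r ?ltr_wpDl// lerDl.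
Qed.

End RieszFischer.

(** * Weighted families of coefficients *)

Section RealPowers.
Context {R : realType}.
Implicit Types (x y s p q r : R).

Lemma ler_powRl s x y : 0 <= s -> 0 <= x -> x <= y -> x `^ s <= y `^ s.
Proof.
by move=> s0 x0 xy; apply: ge0_ler_powR; rewrite ?nnegrE// (le_trans x0).
Qed.

Lemma powRD_le s x y : 0 <= s -> 0 <= x -> 0 <= y ->
  (x + y) `^ s <= 2 `^ s * (x `^ s + y `^ s).
Proof.
move=> s0; wlog xy : x y / x <= y => [h x0 y0|x0 y0].
  have [xy|/ltW yx] := leP x y; first exact: h.
  by rewrite addrC [X in _ * X]addrC h.
rewrite (@le_trans _ _ ((2 * y) `^ s))//; first by apply: ler_powRl; lra.
by rewrite powRM// ler_wpM2l ?powR_ge0// lerDr powR_ge0.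
Qed.

(** From $e^{1/2}\le 2$ one gets $2^s\ge(e^{s/4})^2\ge(1+s/4)^2\ge s$. *)
Lemma le_powR2 s : 0 <= s -> s <= 2 `^ s.
Proof.
move=> s0; have e2 : expR (2^-1) <= 2 :> R.
  have := @expR_ge1Dx R (- 2^-1); rewrite expRN => h.
  by rewrite -[leRHS]invrK -[leLHS]invrK lef_pV2 ?posrE ?invr_gt0 ?expR_gt0//; lra.
rewrite (@le_trans _ _ ((expR 2^-1) `^ s))//; last first.
  by apply: ler_powRl; rewrite ?expR_ge0.
rewrite -expRM (_ : 2^-1 * s = s / 4 + s / 4); last by lra.
rewrite expRD; have := @expR_ge1Dx R (s / 4); set e := expR _ => he.
have := sqr_ge0 (s / 4 - 1).
have : (1 + s / 4) * (1 + s / 4) <= e * e by apply: ler_pM; lra.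
lra.
Qed.

(** The factor 2 of the pure powers does not depend on $s$. With $y\le x$: if $2sy\le x$ then
    $(1+y/x)^s\le e^{1/2}\le 2$. Otherwise $x<2sy$, and one factor $x$ of $(2x)^s$ is traded for
    $2sy$, with $s\le 2^s$ accounting for the base 4. *)
Lemma powRD_tame s x y : 1 <= s -> 0 <= x -> 0 <= y ->
  (x + y) `^ s <= 2 * (x `^ s + y `^ s) +
    2 * 4 `^ s * (x `^ (s - 1) * y + x * y `^ (s - 1)).
Proof.
move=> s1; wlog yx : x y / y <= x => [h x0 y0|x0 y0].
  have [yx|/ltW xy] := leP y x; first exact: h.
  by have := h y x xy y0 x0; rewrite (addrC y x); lra.
have a0 := powR_ge0 x s; have b0 := powR_ge0 y s.
have c0 := powR_ge0 x (s - 1); have d0 := powR_ge0 y (s - 1).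
have k0 := powR_ge0 4 s.
have s0 : 0 < s by lra.
have [xz|xn0] := eqVneq x 0.
  have yz : y = 0 by lra.
  by rewrite xz yz addr0 powR0 ?gt_eqF// !mulr0 !mul0r !addr0 mulr0.
have xp : 0 < x by rewrite lt_neqAle eq_sym xn0.
have xd : 0 <= x * y `^ (s - 1) by rewrite mulr_ge0.
have cy : 0 <= x `^ (s - 1) * y by rewrite mulr_ge0.
have [small|large] := leP (2 * s * y) x.
  have : (x + y) `^ s <= 2 * x `^ s.
    rewrite (_ : x + y = x * (1 + y / x)); last by field.
    have yx0 : 0 <= y / x by rewrite divr_ge0.
    rewrite powRM//; last by lra.
    rewrite mulrC ler_wpM2r//.
    rewrite (@le_trans _ _ (expR (y / x) `^ s))//.
      by apply: ler_powRl; [lra|lra|exact: expR_ge1Dx].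
    rewrite -expRM (@le_trans _ _ (expR (2^-1)))//.
      rewrite ler_expR mulrAC ler_pdivrMr//; lra.
    have := @expR_ge1Dx R (- 2^-1); rewrite expRN => h.
    by rewrite -[leRHS]invrK -[leLHS]invrK lef_pV2 ?posrE ?invr_gt0 ?expR_gt0//; lra.
  have : 0 <= 2 * 4 `^ s * (x `^ (s - 1) * y + x * y `^ (s - 1)).
    by rewrite mulr_ge0 ?mulr_ge0 ?addr_ge0.
  lra.
have : (x + y) `^ s <= 2 * 4 `^ s * (x `^ (s - 1) * y).
  rewrite (@le_trans _ _ ((2 * x) `^ s))//; first by apply: ler_powRl; lra.
  rewrite powRM// -(mulr_powRB1 x0 s0).
  rewrite (@le_trans _ _ (2 `^ s * (2 * s * y * x `^ (s - 1))))//.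
    by rewrite ler_wpM2l ?powR_ge0// ler_wpM2r// ltW.
  rewrite (_ : 4 = 2 * 2 :> R); last by lra.
  rewrite powRM//; have := le_powR2 (ltW s0); have := powR_ge0 2 s.
  set u := 2 `^ s; set v := x `^ (s - 1) in c0 cy * => u0 su.
  rewrite (_ : u * _ = 2 * u * (v * y) * s); last by ring.
  rewrite [leRHS](_ : _ = 2 * u * (v * y) * u); last by ring.
  by rewrite ler_wpM2l// mulr_ge0// mulr_ge0.
have : 0 <= 2 * 4 `^ s * (x * y `^ (s - 1)) by rewrite mulr_ge0 ?mulr_ge0.
lra.
Qed.

(** One of the two terms alone suffices, the first when $x\le\rho$ and the second when $x>\rho$. *)
Lemma powR_interp (rho x p q r : R) : 0 <= x -> 0 < rho -> p <= q -> q <= r -> 0 < q ->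
  x `^ q <= rho `^ (q - p) * x `^ p + rho `^ (q - r) * x `^ r.
Proof.
move=> x0 rho0 pq qr q0.
have h1 : 0 <= rho `^ (q - p) * x `^ p by rewrite mulr_ge0 ?powR_ge0.
have h2 : 0 <= rho `^ (q - r) * x `^ r by rewrite mulr_ge0 ?powR_ge0.
have [xz|xn0] := eqVneq x 0.
  by rewrite {1}xz powR0 ?gt_eqF// addr_ge0.
have xp : 0 < x by rewrite lt_neqAle eq_sym xn0.
have [xr|rx] := leP x rho.
  rewrite (@le_trans _ _ (rho `^ (q - p) * x `^ p))// ?lerDl//.
  have -> : x `^ q = x `^ (q - p) * x `^ p by rewrite -powRD ?subrK ?xn0 ?implybT.
  rewrite ler_wpM2r ?powR_ge0//.
  by apply: ler_powRl; lra.
rewrite (@le_trans _ _ (rho `^ (q - r) * x `^ r))// ?lerDr//.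
have -> : x `^ q = x `^ (q - r) * x `^ r by rewrite -powRD ?subrK ?xn0 ?implybT.
  rewrite ler_wpM2r ?powR_ge0//.
rewrite -(opprB r q) !powRN lef_pV2 ?posrE ?powR_gt0//.
by apply: ler_powRl; lra.
Qed.

Lemma sqr_powR_interp (rho x p q r : R) : 0 <= x -> 0 < rho -> p <= q -> q <= r -> 0 < q ->
  (x `^ q) ^+ 2 <= 2 * (rho `^ (q - p)) ^+ 2 * (x `^ p) ^+ 2 +
                   2 * (rho `^ (q - r)) ^+ 2 * (x `^ r) ^+ 2.
Proof.
move=> x0 rho0 pq qr q0.
have := powR_interp x0 rho0 pq qr q0.
have := powR_ge0 x q; set a := rho `^ _ * _; set b := rho `^ _ * _ => h0 h.
suff : (x `^ q) ^+ 2 <= 2 * a ^+ 2 + 2 * b ^+ 2 by rewrite /a /b !exprMn !mulrA.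
rewrite (@le_trans _ _ ((a + b) ^+ 2))//; first by rewrite ler_sqr ?nnegrE//; lra.
have := sqr_ge0 (a - b); nra.
Qed.

End RealPowers.

(** * Convergence of the lattice sum *)

Section LatticeSum.
Context {R : realType}.

(** Cauchy condensation: the $2^k$ terms of a dyadic block are each at most $2^{-kq}$, so the block
    contributes at most $t^k$ with $t=2^{1-q}<1$. *)
Lemma sumB_dyadic (q : R) : 1 < q ->
  sumB (fun n : nat => n.+1%:R `^ (- q)) (1 + (1 - 2 `^ (1 - q))^-1).
Proof.
move=> q1; set t := 2 `^ (1 - q).
have t0 : 0 <= t by exact: powR_ge0.
have t1 : t < 1.
  by rewrite /t /powR pnatr_eq0/= expR_lt1 nmulr_rlt0 ?subr_lt0// ln_gt0// ltr1n.
have t1' : 0 < 1 - t by lra.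
have block k : \sum_(0 <= n < 2 ^ k) (n.+1%:R : R) `^ (- q) <= 1 + \sum_(i < k) t ^+ i.
  elim: k => [|k ih].
    by rewrite big_nat1 big_ord0 powR1 addr0.
  rewrite (@big_cat_nat _ _ _ (2 ^ k))//=; last by rewrite leq_exp2l.
  rewrite big_ord_recr/= addrA lerD//.
  rewrite (@le_trans _ _ (\sum_(2 ^ k <= n < 2 ^ k.+1) ((2 ^ k)%:R : R) `^ (- q)))//.
    rewrite !big_nat; apply: ler_sum => n /andP[kn _].
    rewrite !powRN lef_pV2 ?posrE ?powR_gt0 ?ltr0n ?expn_gt0//.
    by apply: ler_powRl; rewrite ?ler_nat//; [lra|exact: leqW].
  rewrite sumr_const_nat expnS mul2n -addnn addnK -[leLHS]mulr_natl.
  have -> : (2 ^ k)%:R = 2 `^ k%:R :> R by rewrite powR_mulrn// natrX.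
  rewrite -powRrM -powRD ?pnatr_eq0 ?implybT// /t -powR_mulrn ?powR_ge0// -powRrM.
  by rewrite (_ : k%:R + k%:R * - q = (1 - q) * k%:R)//; ring.
move=> K uK.
pose N := (2 ^ (\max_(n <- K) n).+1)%N.
have sub : {subset K <= index_iota 0 N}.
  move=> n nK; rewrite mem_index_iota/=.
  have nm : (n <= \max_(n <- K) n)%N by exact: (@leq_bigmax_seq _ K xpredT id n nK isT).
  by apply: leq_ltn_trans nm _; rewrite (ltn_trans (ltnSn _))//; exact: ltn_expl.
apply: (le_trans (ler_sum_sub uK (iota_uniq _ _) sub _)).
  by move=> n; exact: powR_ge0.
apply: (le_trans (block _)); rewrite lerD2l.
rewrite -[leRHS]mul1r ler_pdivlMr//.
set m := _.+1; have := subrX1 t m; set S := \sum_(i < _) _.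
have : 0 <= t ^+ m by rewrite exprn_ge0.
nra.
Qed.

Lemma sumB_natS (F : nat -> R) (B : R) : (forall n, 0 <= F n) ->
  sumB (fun n => F n.+1) B -> sumB F (F 0%N + B).
Proof.
move=> F0 FB K uK; rewrite (bigID (pred1 0%N))/= lerD//.
  have <- : \sum_(i <- [:: 0%N]) F i = F 0%N by rewrite big_seq1.
  rewrite -big_filter.
  apply: ler_sum_sub => //; first exact: filter_uniq.
  by move=> n; rewrite mem_filter inE => /andP[].
rewrite -big_filter; set L := [seq n <- K | _].
have -> : \sum_(n <- L) F n = \sum_(n <- map predn L) F n.+1.
  rewrite big_map big_seq [RHS]big_seq; apply: eq_bigr => n.
  by rewrite mem_filter -lt0n => /andP[n0 _]; rewrite prednK.
apply: FB; rewrite map_inj_in_uniq ?filter_uniq// => x y.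
by rewrite !mem_filter; case: x => //= x _; case: y => //= y _ ->.
Qed.

Lemma sumB_int (F : nat -> R) (B : R) : (forall n, 0 <= F n) -> sumB F B ->
  sumB (fun m : int => F `|m|%N) (2 * B).
Proof.
move=> F0 FB K uK; rewrite (bigID (fun m : int => 0 <= m))/=.
rewrite -big_filter -[X in _ + X]big_filter.
have h (p : pred int) : {in p &, injective absz} ->
    \sum_(m <- [seq m <- K | p m]) F `|m|%N <= B.
  move=> pinj; rewrite -(big_map absz xpredT F); apply: FB.
  rewrite map_inj_in_uniq ?filter_uniq// => x y.
  by rewrite !mem_filter => /andP[px _] /andP[py _]; exact: pinj.
have := h (fun m => 0 <= m) _; have := h (fun m => ~~ (0 <= m)) _.
move=> h1 h2; rewrite mulr_natl mulr2n lerD ?h1 ?h2//.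
- by move=> [x|x] [y|y]//= _ _ ->.
- by move=> [x|x] [y|y]//= _ _ []->.
Qed.

(** A finite set of tuples is contained in the product of its set of heads and its set of tails,
    over which the sum factors. *)
Lemma sumB_tuple (F : int -> R) (B : R) d : (forall n, 0 <= F n) -> sumB F B ->
  sumB (fun j : d.-tuple int => \prod_(k < d) F (tnth j k)) (B ^+ d).
Proof.
move=> F0 FB; have B0 := sumB_ge0 FB.
elim: d => [|d ih] K uK.
  case: K uK => [|x [|y K]] /=; first by rewrite big_nil.
    by rewrite big_seq1 big_ord0 expr0.
  by rewrite (tuple0 x) (tuple0 y) inE eqxx.
pose sp (j : d.+1.-tuple int) := (thead j, [tuple of behead j]).
have spI : injective sp.
  move=> j l e; apply: val_inj; rewrite (tuple_eta j) (tuple_eta l)/=.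
  have /= -> := congr1 fst e.
  by have := congr1 (fun z : int * d.-tuple int => val z.2) e => /= ->.
pose G (z : int * d.-tuple int) := F z.1 * \prod_(k < d) F (tnth z.2 k).
have G0 z : 0 <= G z by rewrite mulr_ge0// prodr_ge0.
rewrite (eq_bigr (G \o sp)); last first.
  move=> j _; rewrite big_ord_recl /G/=; congr (_ * _).
  by apply: eq_bigr => k _; rewrite [in LHS](tuple_eta j) tnthS.
rewrite -(big_map sp xpredT G).
pose A := undup (map (fun j : d.+1.-tuple int => thead j) K).
pose L := undup (map (fun j : d.+1.-tuple int => [tuple of behead j]) K).
rewrite (@le_trans _ _ (\sum_(z <- [seq (a, l) | a <- A, l <- L]) G z))//.
  apply: ler_sum_sub => //; first by rewrite map_inj_uniq.
    by apply: allpairs_uniq; rewrite ?undup_uniq// => -[? ?] [? ?].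
  move=> _ /mapP[j jK ->]; apply/allpairsP; exists (sp j); split => //.
    by rewrite mem_undup; apply/mapP; exists j.
  by rewrite mem_undup; apply/mapP; exists j.
rewrite big_allpairs exprS /G/=.
rewrite (@le_trans _ _ (\sum_(a <- A) F a * B ^+ d))//.
  apply: ler_sum => a _; rewrite -big_distrr/= ler_wpM2l//.
  by apply: ih; exact: undup_uniq.
by rewrite -big_distrl/= ler_wpM2r ?exprn_ge0//; apply: FB; exact: undup_uniq.
Qed.

(** Each factor $1+j_k^2$ is at most $1+|j|^2$, so the summand is at most the product over $k$ of
    $(1+j_k^2)^{-s_0/d}$; the one-dimensional sums converge because $2s_0/d>1$. *)
Lemma lattice_sum d (s0 : R) : (1 <= d)%N -> d%:R / 2 < s0 ->
  exists2 C, 0 < C &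
    sumB (fun j : d.-tuple int => (1 + freq_norm j ^+ 2) `^ (- s0)) (C : R).
Proof.
move=> d1 ds0; pose r := s0 / d%:R.
have d0 : 0 < d%:R :> R by rewrite ltr0n.
have r0 : 2^-1 < r by rewrite /r ltr_pdivlMr// mulrC.
pose F (n : nat) : R := (1 + n%:R ^+ 2) `^ (- r).
have F0 n : 0 <= F n by exact: powR_ge0.
have FB : exists B, sumB F B.
  eexists; apply: (sumB_natS F0); apply: sumB_le (@sumB_dyadic (2 * r) _) _ (lexx _).
    by lra.
  move=> n; have p1 : 0 < 1 + n.+1%:R ^+ 2 :> R by rewrite ltr_wpDr// sqr_ge0.
  rewrite /F !powRN lef_pV2 ?posrE ?powR_gt0 ?ltr0n//.
  rewrite powRrM powR_mulrn ?ler0n// ler_powRl ?sqr_ge0 ?lerDr//; lra.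
have [B FB'] := FB; have B0 := sumB_ge0 FB'.
have := @sumB_tuple _ _ d _ (sumB_int F0 FB').
move=> /(_ (fun _ => F0 _)) h.
exists ((2 * B) ^+ d + 1); first by rewrite ltr_wpDl// exprn_ge0// mulr_ge0.
apply: sumB_le h _ _; last by lra.
move=> j; rewrite /F.
have fj0 : 0 <= freq_norm j ^+ 2 :> R by exact: sqr_ge0.
have fE : freq_norm j ^+ 2 = \sum_(k < d) (tnth j k)%:~R ^+ 2 :> R.
  by rewrite sqr_sqrtr// sumr_ge0// => k _; rewrite sqr_ge0.
have absE (m : int) : (`|m|%N%:R : R) ^+ 2 = m%:~R ^+ 2.
  by rewrite pmulrn abszE intr_norm real_normK ?num_real.
have key (n : nat) (G : 'I_n -> R) : (forall k, 0 <= G k) ->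
    \prod_(k < n) (1 + G k) `^ (- r) = (\prod_(k < n) (1 + G k)) `^ (- r).
  move=> G0; elim: n G G0 => [|n ih] G G0; first by rewrite !big_ord0 powR1.
  rewrite !big_ord_recl powRM ?ih//; first by rewrite addr_ge0.
  by rewrite prodr_ge0// => k _; rewrite addr_ge0.
rewrite (eq_bigr (fun k => (1 + (tnth j k)%:~R ^+ 2) `^ (- r))); last first.
  by move=> k _; rewrite absE.
rewrite key; last by move=> k; exact: sqr_ge0.
have -> : s0 = d%:R * r by rewrite /r mulrC divfK// gt_eqF.
rewrite -mulrN powRrM powR_mulrn ?addr_ge0//.
have p1 : 0 < \prod_(k < d) (1 + (tnth j k)%:~R ^+ 2 : R).
  by apply: prodr_gt0 => k _; rewrite ltr_wpDr// sqr_ge0.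
rewrite !powRN lef_pV2 ?posrE ?powR_gt0//; last by rewrite exprn_gt0// ltr_wpDr.
apply: ler_powRl; [by lra|exact: ltW|].
rewrite -[X in _ <= _ ^+ X](card_ord d) -prodr_const.
apply: ler_prod => k _; rewrite addr_ge0 ?sqr_ge0//= lerD2l fE (bigD1 k)//= lerDl.
by rewrite sumr_ge0// => i _; rewrite sqr_ge0.
Qed.

End LatticeSum.

Section FrequencyNorm.
Context {R : realType} {d : nat}.
Implicit Types (j k : d.-tuple int).
Local Notation "| j |" := (freq_norm j : R) (at level 0, j at level 99).

Lemma freq_norm_ge0 j : 0 <= (freq_norm j : R).
Proof. exact: sqrtr_ge0. Qed.

Lemma freq_normN j : freq_norm (jneg j) = freq_norm j :> R.
Proof.
congr Num.sqrt; apply: eq_bigr => k _.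
by rewrite tnth_mktuple mulrNz sqrrN.
Qed.

Lemma sum_CS (I : Type) (s : seq I) (a b : I -> R) :
  (\sum_(i <- s) a i * b i) ^+ 2 <=
  (\sum_(i <- s) a i ^+ 2) * (\sum_(i <- s) b i ^+ 2).
Proof.
elim: s => [|i s ih]; first by rewrite !big_nil expr0n mul0r.
rewrite !big_cons; move: ih; set S := \sum_(j <- s) a j * b j.
set A := \sum_(j <- s) a j ^+ 2; set B := \sum_(j <- s) b j ^+ 2 => ih.
have A0 : 0 <= A by apply: sumr_ge0 => j _; exact: sqr_ge0.
have B0 : 0 <= B by apply: sumr_ge0 => j _; exact: sqr_ge0.
suff : 2 * (a i * b i * S) <= a i ^+ 2 * B + A * b i ^+ 2 by nra.
have : 0 <= a i ^+ 2 * B + A * b i ^+ 2 by apply: addr_ge0; apply: mulr_ge0; rewrite ?sqr_ge0.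
set X := a i ^+ 2 * B + A * b i ^+ 2 => X0.
set Y := 2 * (a i * b i * S).
suff : Y ^+ 2 <= X ^+ 2 by rewrite leNgt => /negP YX; rewrite leNgt; apply/negP => XY; apply: YX; nra.
have h1 : 4 * ((a i * b i) ^+ 2 * (A * B)) <= X ^+ 2.
  by have := sqr_ge0 (a i ^+ 2 * B - A * b i ^+ 2); rewrite /X; nra.
apply: le_trans h1; have := ler_wpM2l (sqr_ge0 (a i * b i)) ih; rewrite /Y; nra.
Qed.

Lemma freq_normD j k : freq_norm (jadd j k) <= freq_norm j + freq_norm k :> R.
Proof.
have h (l : d.-tuple int) : (freq_norm l : R) ^+ 2 = \sum_(i < d) (tnth l i)%:~R ^+ 2.
  by rewrite sqr_sqrtr// sumr_ge0// => i _; rewrite sqr_ge0.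
have n0 := freq_norm_ge0; rewrite -ler_sqr ?nnegrE ?addr_ge0//.
have CS : \sum_(i < d) (tnth j i)%:~R * (tnth k i)%:~R <= freq_norm j * freq_norm k :> R.
  rewrite (le_trans (ler_norm _))// -[leRHS]ger0_norm ?mulr_ge0//.
  rewrite -ler_sqr ?nnegrE// !real_normK ?num_real// exprMn !h.
  exact: sum_CS.
have -> : (freq_norm (jadd j k) : R) ^+ 2 =
    freq_norm j ^+ 2 + 2 * (\sum_(i < d) (tnth j i)%:~R * (tnth k i)%:~R) + freq_norm k ^+ 2.
  rewrite !h big_distrr/= -!big_split/=; apply: eq_bigr => i _.
  by rewrite tnth_mktuple intrD; ring.
have := CS; nra.
Qed.

End FrequencyNorm.

Section WeightedSums.
Context {R : realType} {d : nat}.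
Implicit Types (j k : d.-tuple int) (a b : d.-tuple int -> R[i]).

(** The weight $|j|^{2s}$. The convention $0^0=1$ makes it identically one for $s=0$, so [sobB 0] is
    a squared $\ell^2$ bound; for $s\ne 0$ it vanishes at frequency zero, and an $L^2$ bound has to
    accompany it. *)
Definition fweight (s : R) j : R := (freq_norm j `^ s) ^+ 2.

Definition sobB (s : R) a (B : R) : Prop := sumB (fun j => fweight s j * sqc (a j)) B.
Definition l1B a (A : R) : Prop := sumB (fun j => normc (a j)) A.
Definition l1gradB a (A : R) : Prop := sumB (fun j => freq_norm j * normc (a j)) A.

Lemma fweight_ge0 s j : 0 <= fweight s j.
Proof. exact: sqr_ge0. Qed.

Lemma fweight0 j : fweight 0 j = 1.
Proof. by rewrite /fweight powRr0 expr1n. Qed.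

Lemma sobB0 a B : sobB 0 a B <-> sumB (fun j => sqc (a j)) B.
Proof. by split=> h; apply: sumB_le h _ (lexx _) => j; rewrite fweight0 mul1r. Qed.

(** The parameter [rho] is the frequency at which the two bounds exchange roles. It will be 1 for
    mere finiteness, $2M$ for the smallness of the data, large for continuity, and proportional to
    time for the growth estimate. *)
Lemma sobB_interp (rho p q r : R) a A B : 0 < rho -> p <= q -> q <= r -> 0 < q ->
  sobB p a A -> sobB r a B ->
  sobB q a (2 * (rho `^ (q - p)) ^+ 2 * A + 2 * (rho `^ (q - r)) ^+ 2 * B).
Proof.
move=> rho0 pq qr q0 aA aB.
have c1 : 0 <= 2 * (rho `^ (q - p)) ^+ 2 by rewrite mulr_ge0 ?sqr_ge0.
have c2 : 0 <= 2 * (rho `^ (q - r)) ^+ 2 by rewrite mulr_ge0 ?sqr_ge0.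
apply: sumB_le (sumBD (sumBZ c1 aA) (sumBZ c2 aB)) _ (lexx _) => j.
rewrite [X in _ <= X + _]mulrA [X in _ <= _ + X]mulrA -mulrDl ler_wpM2r ?sqc_ge0//.
exact: sqr_powR_interp (freq_norm_ge0 j) rho0 pq qr q0.
Qed.

Lemma sobBN s a B : sobB s a B -> sobB s (fun j => (a (jneg j))^*%C) B.
Proof.
move=> h; apply: sumB_le (sumB_inj (can_inj (@jnegK d)) h) _ (lexx _) => j /=.
by rewrite sqcJ /fweight freq_normN.
Qed.

Lemma l1BN a B : l1B a B -> l1B (fun j => (a (jneg j))^*%C) B.
Proof.
move=> h; apply: sumB_le (sumB_inj (can_inj (@jnegK d)) h) _ (lexx _) => j /=.
by rewrite normcJ.
Qed.

Lemma l1gradBN a B : l1gradB a B -> l1gradB (fun j => (a (jneg j))^*%C) B.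
Proof.
move=> h; apply: sumB_le (sumB_inj (can_inj (@jnegK d)) h) _ (lexx _) => j /=.
by rewrite normcJ freq_normN.
Qed.

Lemma sumB_CS (F G : d.-tuple int -> R) (A B : R) : (forall j, 0 <= F j) -> (forall j, 0 <= G j) ->
  sumB (fun j => F j ^+ 2) A -> sumB (fun j => G j ^+ 2) B ->
  sumB (fun j => F j * G j) (Num.sqrt (A * B)).
Proof.
move=> F0 G0 FA GB K uK; have A0 := sumB_ge0 FA; have B0 := sumB_ge0 GB.
have S0 : 0 <= \sum_(j <- K) F j * G j by apply: sumr_ge0 => j _; rewrite mulr_ge0.
rewrite -ler_sqr ?nnegrE ?sqrtr_ge0// sqr_sqrtr ?mulr_ge0//.
rewrite (le_trans (sum_CS _ _ _))// ler_pM// ?FA ?GB//.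
  by apply: sumr_ge0 => j _; exact: sqr_ge0.
by apply: sumr_ge0 => j _; exact: sqr_ge0.
Qed.

(** Embedding into the Wiener algebra: Cauchy-Schwarz after inserting
    $(1+|j|^2)^{-s/2}(1+|j|^2)^{s/2}$. *)
Lemma l1B_sob (s C : R) a A B : 0 <= s ->
  sumB (fun j : d.-tuple int => (1 + freq_norm j ^+ 2) `^ (- s)) C ->
  sobB 0 a A -> sobB s a B -> l1B a (Num.sqrt (C * (2 `^ s * (A + B)))).
Proof.
move=> s0 CB aA aB.
pose F j : R := (1 + freq_norm j ^+ 2) `^ (- s / 2).
pose G j : R := (1 + freq_norm j ^+ 2) `^ (s / 2) * normc (a j).
have one j : 0 < 1 + freq_norm j ^+ 2 :> R by rewrite ltr_wpDr// sqr_ge0.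
have half (q : R) j : ((1 + freq_norm j ^+ 2) `^ (q / 2)) ^+ 2 = (1 + freq_norm j ^+ 2) `^ q :> R.
  rewrite expr2 -powRD -?splitr//; apply/implyP => _; exact: lt0r_neq0 (one j).
have F0 j : 0 <= F j by exact: powR_ge0.
have G0 j : 0 <= G j by rewrite mulr_ge0 ?powR_ge0 ?normc_ge0.
have FC : sumB (fun j => F j ^+ 2) C.
  apply: sumB_le CB _ (lexx _) => j.
  by rewrite /F -powR_mulrn ?powR_ge0// -powRrM divfK.
have GB : sumB (fun j => G j ^+ 2) (2 `^ s * (A + B)).
  apply: sumB_le (sumBZ (powR_ge0 _ s) (sumBD aA aB)) _ (lexx _) => j.
  rewrite /G exprMn sqr_normcE -mulrDl mulrA ler_wpM2r ?sqc_ge0//.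
  rewrite half fweight0.
  rewrite (le_trans (powRD_le s0 ler01 (sqr_ge0 _)))// powR1.
  rewrite ler_wpM2l ?powR_ge0// lerD2l /fweight.
  by rewrite !expr2 powRM ?freq_norm_ge0.
apply: sumB_le (sumB_CS F0 G0 FC GB) _ (lexx _) => j.
rewrite /F /G mulrA -powRD; last by apply/implyP => _; exact: lt0r_neq0 (one j).
by rewrite mulNr addNr powRr0 mul1r.
Qed.

Lemma l1gradB_sob (s C : R) a B0 B1 B2 : 0 < s ->
  sumB (fun j : d.-tuple int => (1 + freq_norm j ^+ 2) `^ (- s)) C ->
  sobB 1 a B1 -> sobB (s + 1) a B2 -> B1 + B2 <= B0 ->
  l1gradB a (Num.sqrt (C * (2 `^ s * B0))).
Proof.
move=> s0 CB a1 a2 le0.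
pose b j : R[i] := (freq_norm j)%:C%C * a j.
have sb q : fweight q =1 fweight q by [].
have h0 : sobB 0 b B1.
  apply: sumB_le a1 _ (lexx _) => j.
  by rewrite fweight0 mul1r /b sqcM sqcR /fweight powRr1 ?freq_norm_ge0.
have hs : sobB s b B2.
  apply: sumB_le a2 _ (lexx _) => j.
  rewrite /b sqcM sqcR mulrA /fweight -exprMn.
  have s1 : 0 < s + 1 by lra.
  by rewrite -(mulr_powRB1 (freq_norm_ge0 j) s1) addrK [X in X ^+ 2 * _ <= _]mulrC lexx.
apply: sumB_le (l1B_sob (ltW s0) CB h0 hs) _ _.
  move=> j; rewrite /b Normc.normcM [X in _ <= X * _]normcE sqcR sqrtr_sqr ger0_norm//.
  exact: freq_norm_ge0.
apply: ler_wsqrtr; apply: ler_wpM2l; first exact: sumB_ge0 CB.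
by rewrite ler_wpM2l ?powR_ge0.
Qed.

End WeightedSums.

Local Arguments fourier_coef : simpl never.
Local Arguments Normc.normc : simpl never.
Local Arguments plane_wave : simpl never.
Local Arguments freq_norm : simpl never.

(** * Products *)

Lemma cvg_sum_seq (R : realType) (I : Type) (s : seq I) (u : I -> nat -> R) (l : I -> R) :
  (forall i, u i n @[n --> \oo] --> l i) ->
  \sum_(i <- s) u i n @[n --> \oo] --> \sum_(i <- s) l i.
Proof.
move=> ul; elim: s => [|i s ih].
  by rewrite big_nil; under eq_fun do rewrite big_nil; exact: cvg_cst.
by rewrite big_cons; under eq_fun do rewrite big_cons; exact: cvgD.
Qed.

Section Products.
Context {R : realType} {d : nat}.

Local Notation mu := (@torus_measure R d).
Local Notation T := (tpoint R d).
Local Notation fhat := fourier_coef.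
Local Notation fn := (@freq_norm R d).

Implicit Types (f g h : torus_fun R d) (j k : d.-tuple int) (J K : seq (d.-tuple int)).

(** A majorant of the convolution of the coefficients truncated to [J]; no infinite convolution is
    ever formed. *)
Definition absconv f g J k : R :=
  \sum_(j <- J) normc (fhat f j) * normc (fhat g (jsub k j)).

(** The truncations [J_] do not depend on [k], so that weighted sums over finitely many [k] pass to
    the limit together. *)
Lemma prod_coef_lim f g : inL2 f -> inL2 g ->
  exists J_ : nat -> seq (d.-tuple int), (forall n, uniq (J_ n)) /\
    forall k, exists2 v : nat -> R, (forall n, 0 <= v n <= absconv f g (J_ n) k) &
      v n @[n --> \oo] --> normc (fhat (fun x => f x * g x) k).
Proof.
move=> If Ig.
have /choice[J_ hJ] : forall n, exists J, uniq J /\ forall k,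
    sqc (fhat (fun x => f x * g x) k -
         \sum_(j <- J) fhat f j * fhat g (jsub k j)) <= n.+1%:R^-1 ^+ 2.
  move=> n; have e0 : 0 < n.+1%:R^-1 ^+ 2 :> R by rewrite exprn_gt0// invr_gt0.
  by have [J uJ hJ] := prod_coef_approx If Ig e0; exists J.
exists J_; split; first by move=> n; case: (hJ n).
move=> k; exists (fun n => normc (\sum_(j <- J_ n) fhat f j * fhat g (jsub k j))).
  move=> n; rewrite normc_ge0/= (le_trans (normc_sum _ _))//.
  by apply: ler_sum => j _; rewrite Normc.normcM.
apply: (@cvg_harmonic_bound _ _ _ 1); apply: nearW => n; rewrite mul1r.
rewrite (le_trans (normc_normrB _ _))// -sqc_normc_le ?invr_ge0// sqcB.
by case: (hJ n) => _; apply.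
Qed.

(** It suffices to bound truncated convolutions uniformly in [J], which is what the finite Young
    inequalities do. *)
Lemma prod_l1_bound f g (tau : d.-tuple int -> R) (B : R) K : inL2 f -> inL2 g ->
  (forall k, 0 <= tau k) ->
  (forall J, uniq J -> \sum_(k <- K) tau k * absconv f g J k <= B) ->
  \sum_(k <- K) tau k * normc (fhat (fun x => f x * g x) k) <= B.
Proof.
move=> If Ig t0 hB; have [J_ [uJ hJ]] := prod_coef_lim If Ig.
have /choice[v hv] : forall k, exists v : nat -> R, (forall n, 0 <= v n <= absconv f g (J_ n) k) /\
      v n @[n --> \oo] --> normc (fhat (fun x => f x * g x) k).
  by move=> k; have [v v1 v2] := hJ k; exists v.
apply: (@cvg_le_bound _ (fun n => \sum_(k <- K) tau k * v k n)).
  apply: cvg_sum_seq => k; apply: cvgM; first exact: cvg_cst.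
  by case: (hv k).
move=> n; apply: le_trans (hB _ (uJ n)); apply: ler_sum => k _.
by rewrite ler_wpM2l//; case: (hv k) => /(_ n)/andP[].
Qed.

Lemma prod_l2_bound f g (w : d.-tuple int -> R) (B : R) K : inL2 f -> inL2 g ->
  (forall k, 0 <= w k) ->
  (forall J, uniq J -> \sum_(k <- K) w k * absconv f g J k ^+ 2 <= B) ->
  \sum_(k <- K) w k * sqc (fhat (fun x => f x * g x) k) <= B.
Proof.
move=> If Ig t0 hB; have [J_ [uJ hJ]] := prod_coef_lim If Ig.
have /choice[v hv] : forall k, exists v : nat -> R, (forall n, 0 <= v n <= absconv f g (J_ n) k) /\
      v n @[n --> \oo] --> normc (fhat (fun x => f x * g x) k).
  by move=> k; have [v v1 v2] := hJ k; exists v.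
apply: (@cvg_le_bound _ (fun n => \sum_(k <- K) w k * v k n ^+ 2)).
  apply: cvg_sum_seq => k; apply: cvgM; first exact: cvg_cst.
  rewrite -sqr_normcE expr2; under eq_fun do rewrite expr2.
  by case: (hv k) => _ c; apply: cvgM.
move=> n; apply: le_trans (hB _ (uJ n)); apply: ler_sum => k _.
rewrite ler_wpM2l//; case: (hv k) => /(_ n)/andP[v0 v1] _.
by rewrite ler_sqr ?nnegrE// (le_trans v0).
Qed.

Lemma l1B_mul f g (A B : R) : inL2 f -> inL2 g -> l1B (fhat f) A -> l1B (fhat g) B ->
  l1B (fhat (fun x => f x * g x)) (A * B).
Proof.
move=> If Ig fA gB K uK.
have := @prod_l1_bound f g (fun=> 1) (A * B) K If Ig (fun=> ler01).
under eq_bigr do rewrite mul1r; apply => J uJ.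
under eq_bigr do rewrite mul1r.
exact: (Young_l1 (@jsub_injl d) (fun j => normc_ge0 _) (fun j => normc_ge0 _) fA gB uJ uK).
Qed.

Lemma freq_norm_sub j k : fn k <= fn j + fn (jsub k j).
Proof.
by rewrite addrC; have := @freq_normD R d (jsub k j) j; rewrite jsubK.
Qed.

Lemma l1gradB_mul f g (A B A1 B1 : R) : inL2 f -> inL2 g ->
  l1B (fhat f) A -> l1B (fhat g) B -> l1gradB (fhat f) A1 -> l1gradB (fhat g) B1 ->
  l1gradB (fhat (fun x => f x * g x)) (A1 * B + A * B1).
Proof.
move=> If Ig fA gB fA1 gB1 K uK.
apply: prod_l1_bound => // [k|J uJ]; first exact: freq_norm_ge0.
have n0 (h : torus_fun R d) j : 0 <= normc (fhat h j) by exact: normc_ge0.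
have n1 (h : torus_fun R d) j : 0 <= fn j * normc (fhat h j).
  by rewrite mulr_ge0// freq_norm_ge0.
have y1 := @Young_l1 _ _ (@jsub d) (@jsub_injl d) _ _ _ _ J K (n1 f) (n0 g) fA1 gB uJ uK.
have y2 := @Young_l1 _ _ (@jsub d) (@jsub_injl d) _ _ _ _ J K (n0 f) (n1 g) fA gB1 uJ uK.
apply: le_trans (lerD y1 y2); rewrite -big_split/=; apply: ler_sum => k _.
rewrite /absconv big_distrr/= -big_split/=; apply: ler_sum => j _.
rewrite -!mulrA [X in _ <= _ + X]mulrCA -mulrDl ler_wpM2r ?mulr_ge0//.
exact: freq_norm_sub.
Qed.

Lemma sqr_sum4 (a b c e : R) : (a + b + c + e) ^+ 2 <= 4 * (a ^+ 2 + b ^+ 2 + c ^+ 2 + e ^+ 2).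
Proof.
have := sqr_ge0 (a - b); have := sqr_ge0 (a - c); have := sqr_ge0 (a - e).
have := sqr_ge0 (b - c); have := sqr_ge0 (b - e); have := sqr_ge0 (c - e); nra.
Qed.

(** The assumed inequality between weights splits the weighted convolution into four, each bounded
    by a Young inequality with the $\ell^1$ norm on one factor; the 4 comes from squaring a sum of
    four terms. *)
Lemma l2_mul (rho sigma : d.-tuple int -> R) (c kappa : R) f g (A B A1 B1 Rf Rg Sf Sg : R) :
  (forall j, 0 <= rho j) -> (forall j, 0 <= sigma j) -> 0 <= c -> 0 <= kappa ->
  (forall j k, rho k <= c * (rho j + rho (jsub k j)) +
     kappa * (sigma j * fn (jsub k j) + fn j * sigma (jsub k j))) ->
  inL2 f -> inL2 g ->
  l1B (fhat f) A -> l1B (fhat g) B -> l1gradB (fhat f) A1 -> l1gradB (fhat g) B1 ->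
  sumB (fun j => rho j ^+ 2 * sqc (fhat f j)) Rf ->
  sumB (fun j => rho j ^+ 2 * sqc (fhat g j)) Rg ->
  sumB (fun j => sigma j ^+ 2 * sqc (fhat f j)) Sf ->
  sumB (fun j => sigma j ^+ 2 * sqc (fhat g j)) Sg ->
  sumB (fun j => rho j ^+ 2 * sqc (fhat (fun x => f x * g x) j))
    (4 * c ^+ 2 * (Rf * B ^+ 2 + A ^+ 2 * Rg) +
     4 * kappa ^+ 2 * (Sf * B1 ^+ 2 + A1 ^+ 2 * Sg)).
Proof.
move=> r0 s0 c0 k0 tri If Ig fA gB fA1 gB1 fR gR fS gS K uK.
apply: prod_l2_bound => // [k|J uJ]; first exact: sqr_ge0.
have n0 (h : torus_fun R d) j : 0 <= normc (fhat h j) by exact: normc_ge0.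
have n1 (h : torus_fun R d) j : 0 <= fn j * normc (fhat h j).
  by rewrite mulr_ge0// freq_norm_ge0.
have nr (h : torus_fun R d) j : 0 <= rho j * normc (fhat h j) by rewrite mulr_ge0.
have ns (h : torus_fun R d) j : 0 <= sigma j * normc (fhat h j) by rewrite mulr_ge0.
have sq (w : d.-tuple int -> R) h (C : R) : sumB (fun j => w j ^+ 2 * sqc (fhat h j)) C ->
    sumB (fun j => (w j * normc (fhat h j)) ^+ 2) C.
  by move=> hC; apply: sumB_le hC _ (lexx _) => j; rewrite exprMn sqr_normcE.
have YR := @Young_right R _ (@jsub d) (@jsub_injr d) (@jsub_injl d).
have YL := @Young_left R _ (@jsub d) (@jsub_injl d).
have y1 := YR _ _ _ _ J K (nr f) (n0 g) (sq _ _ _ fR) gB uJ uK.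
have y2 := YL _ _ _ _ J K (n0 f) (nr g) fA (sq _ _ _ gR) uJ uK.
have y3 := YR _ _ _ _ J K (ns f) (n1 g) (sq _ _ _ fS) gB1 uJ uK.
have y4 := YL _ _ _ _ J K (n1 f) (ns g) fA1 (sq _ _ _ gS) uJ uK.
set Y1 := \sum_(k <- K) _ in y1; set Y2 := \sum_(k <- K) _ in y2.
set Y3 := \sum_(k <- K) _ in y3; set Y4 := \sum_(k <- K) _ in y4.
apply: (@le_trans _ _ (4 * c ^+ 2 * (Y1 + Y2) + 4 * kappa ^+ 2 * (Y3 + Y4))); last first.
  by apply: lerD; rewrite ler_wpM2l ?lerD// mulr_ge0// sqr_ge0.
rewrite /Y1 /Y2 /Y3 /Y4 -!big_split/= !big_distrr/= -big_split/=.
apply: ler_sum => k _; rewrite -exprMn.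
set X1 := \sum_(j <- J) rho j * _ * _; set X2 := \sum_(j <- J) _ * (rho _ * _).
set X3 := \sum_(j <- J) sigma j * _ * _; set X4 := \sum_(j <- J) _ * (sigma _ * _).
have le : rho k * absconv f g J k <= c * X1 + c * X2 + kappa * X3 + kappa * X4.
  rewrite /absconv /X1 /X2 /X3 /X4 !big_distrr/= -!big_split/=; apply: ler_sum => j _.
  have := ler_wpM2r (mulr_ge0 (n0 f j) (n0 g (jsub k j))) (tri j k); lra.
have ge0 : 0 <= rho k * absconv f g J k.
  by rewrite mulr_ge0// sumr_ge0// => j _; rewrite mulr_ge0.
rewrite (@le_trans _ _ ((c * X1 + c * X2 + kappa * X3 + kappa * X4) ^+ 2))//.
  by rewrite ler_sqr ?nnegrE// (le_trans ge0).
rewrite (le_trans (sqr_sum4 _ _ _ _))// !exprMn; lra.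
Qed.

Lemma freq_powR_sub s j k : 0 <= s ->
  fn k `^ s <= 2 `^ s * (fn j `^ s + fn (jsub k j) `^ s).
Proof.
move=> s0; have n0 := @freq_norm_ge0 R d.
by rewrite (le_trans _ (powRD_le s0 _ _))//; apply: ler_powRl => //; exact: freq_norm_sub.
Qed.

Lemma sobB_mul s f g (A B Rf Rg : R) : 0 <= s -> inL2 f -> inL2 g ->
  l1B (fhat f) A -> l1B (fhat g) B -> sobB s (fhat f) Rf -> sobB s (fhat g) Rg ->
  sobB s (fhat (fun x => f x * g x)) (4 * 4 `^ s * (Rf * B ^+ 2 + A ^+ 2 * Rg)).
Proof.
move=> s0 If Ig fA gB fR gR K uK.
apply: prod_l2_bound => // [k|J uJ]; first exact: fweight_ge0.
have n0 (h : torus_fun R d) j : 0 <= normc (fhat h j) by exact: normc_ge0.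
pose rho j := fn j `^ s.
have r0 j : 0 <= rho j by exact: powR_ge0.
have nr (h : torus_fun R d) j : 0 <= rho j * normc (fhat h j) by rewrite mulr_ge0.
have sq h (C : R) : sobB s (fhat h) C -> sumB (fun j => (rho j * normc (fhat h j)) ^+ 2) C.
  by move=> hC; apply: sumB_le hC _ (lexx _) => j; rewrite exprMn sqr_normcE.
have YR := @Young_right R _ (@jsub d) (@jsub_injr d) (@jsub_injl d).
have YL := @Young_left R _ (@jsub d) (@jsub_injl d).
have y1 := YR _ _ _ _ J K (nr f) (n0 g) (sq _ _ fR) gB uJ uK.
have y2 := YL _ _ _ _ J K (n0 f) (nr g) fA (sq _ _ gR) uJ uK.
set Y1 := \sum_(k <- K) _ in y1; set Y2 := \sum_(k <- K) _ in y2.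
apply: (@le_trans _ _ (4 * 4 `^ s * (Y1 + Y2))); last first.
  by rewrite ler_wpM2l ?lerD// mulr_ge0// powR_ge0.
rewrite /Y1 /Y2 -!big_split/= !big_distrr/=.
apply: ler_sum => k _; rewrite -exprMn -/(rho k).
set X1 := \sum_(j <- J) rho j * _ * _; set X2 := \sum_(j <- J) _ * (rho _ * _).
have le : rho k * absconv f g J k <= 2 `^ s * (X1 + X2).
  rewrite /absconv /X1 /X2 -!big_split/= !big_distrr/=; apply: ler_sum => j _.
  have := ler_wpM2r (mulr_ge0 (n0 f j) (n0 g (jsub k j))) (freq_powR_sub j k s0).
  rewrite -/(rho k) -/(rho j) -/(rho (jsub k j)); lra.
have ge0 : 0 <= rho k * absconv f g J k.
  by rewrite mulr_ge0// sumr_ge0// => j _; rewrite mulr_ge0.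
rewrite (@le_trans _ _ ((2 `^ s * (X1 + X2)) ^+ 2))//.
  by rewrite ler_sqr ?nnegrE// (le_trans ge0).
rewrite exprMn (_ : 2 `^ s ^+ 2 = 4 `^ s); last first.
  by rewrite expr2 -powRM//; congr (_ `^ _); lra.
have := sqr_ge0 (X1 - X2); have := powR_ge0 (4 : R) s; nra.
Qed.

(** The case $c=2$, $\kappa=2\cdot 4^s$ of [l2_mul]: $4c^2=16$ is independent of $s$, and
    $4\kappa^2=16\cdot 16^s$ only multiplies terms with one derivative moved to the $\ell^1$
    factor. *)
Lemma sobB_mul_tame s f g (A B A1 B1 Rf Rg Sf Sg : R) : 1 <= s -> inL2 f -> inL2 g ->
  l1B (fhat f) A -> l1B (fhat g) B -> l1gradB (fhat f) A1 -> l1gradB (fhat g) B1 ->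
  sobB s (fhat f) Rf -> sobB s (fhat g) Rg ->
  sobB (s - 1) (fhat f) Sf -> sobB (s - 1) (fhat g) Sg ->
  sobB s (fhat (fun x => f x * g x))
    (16 * (Rf * B ^+ 2 + A ^+ 2 * Rg) + 16 * 16 `^ s * (Sf * B1 ^+ 2 + A1 ^+ 2 * Sg)).
Proof.
move=> s1 If Ig fA gB fA1 gB1 fR gR fS gS.
have k0 : 0 <= 2 * 4 `^ s :> R by rewrite mulr_ge0// powR_ge0.
have tri j k : fn k `^ s <= 2 * (fn j `^ s + fn (jsub k j) `^ s) +
    2 * 4 `^ s * (fn j `^ (s - 1) * fn (jsub k j) + fn j * fn (jsub k j) `^ (s - 1)).
  apply: le_trans (powRD_tame s1 (freq_norm_ge0 j) (freq_norm_ge0 _)).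
  by apply: ler_powRl; [lra|exact: freq_norm_ge0|exact: freq_norm_sub].
have h := @l2_mul (fun j => fn j `^ s) (fun j => fn j `^ (s - 1)) 2 (2 * 4 `^ s) f g
  A B A1 B1 Rf Rg Sf Sg (fun j => powR_ge0 _ _) (fun j => powR_ge0 _ _) (ler0n _ 2) k0 tri
  If Ig fA gB fA1 gB1 fR gR fS gS.
apply: sumB_le h _ _ => //.
have -> : 16 `^ s = (4 `^ s) ^+ 2 :> R.
  by rewrite expr2 -powRM//; congr (_ `^ _); lra.
by rewrite exprMn; lra.
Qed.

End Products.

(** * The power nonlinearity *)

Section Powers.
Context {R : realType}.
Implicit Types z w : R[i].

(** The alternating product $z\bar zz\bar z\cdots$ with $m+1$ factors, the form of $|z|^{2p}z$ in
    which product estimates apply one factor at a time. *)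
Fixpoint zpow z (m : nat) : R[i] :=
  if m is n.+1 then zpow z n * (if odd n then z else z^*%C) else z.

Lemma zpow_even z p : zpow z (2 * p) = `|z| ^+ (2 * p) * z.
Proof.
elim: p => [|p ih]; first by rewrite mul1r.
rewrite mulnS !addSn add0n /= mul2n odd_double/= -mul2n ih.
transitivity (`|z| ^+ (2 * p) * (z * z^*%C) * z); first by ring.
by rewrite -sqr_normc !exprS expr0; ring.
Qed.

Lemma zpow_le z (A : R) m : normc z <= A -> normc (zpow z m) <= A ^+ m.+1.
Proof.
move=> zA; elim: m => [|m ih]; first by rewrite expr1.
rewrite /= Normc.normcM exprSr ler_pM ?normc_ge0//.
by case: odd; rewrite ?normcJ.
Qed.

Lemma zpow_lip z w (A : R) m : normc z <= A -> normc w <= A ->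
  normc (zpow z m - zpow w m) <= m.+1%:R * A ^+ m * normc (z - w).
Proof.
move=> zA wA; have A0 : 0 <= A by exact: le_trans (normc_ge0 z) zA.
elim: m => [|m ih]; first by rewrite mul1r mul1r.
pose f (u : R[i]) := if odd m then u else u^*%C.
have fA u : normc (f u) = normc u by rewrite /f; case: odd; rewrite ?normcJ.
have fB : normc (f z - f w) = normc (z - w).
  by rewrite /f; case: odd => //; rewrite -rmorphB normcJ.
rewrite /= -/(f z) -/(f w).
have -> : zpow z m * f z - zpow w m * f w =
    (zpow z m - zpow w m) * f z + zpow w m * (f z - f w) by ring.
rewrite (le_trans (ler_normcD _ _))// !Normc.normcM fA fB.
have h1 : normc (zpow z m - zpow w m) * normc z <= m.+1%:R * A ^+ m * normc (z - w) * A.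
  by rewrite ler_pM ?normc_ge0.
have h2 : normc (zpow w m) * normc (z - w) <= A ^+ m.+1 * normc (z - w).
  by rewrite ler_wpM2r ?normc_ge0// zpow_le.
by apply: le_trans (lerD h1 h2) _; rewrite -[m.+2%:R]natr1 exprSr; nra.
Qed.

End Powers.

Section Nonlinearity.
Context {R : realType} {d : nat}.

Local Notation mu := (@torus_measure R d).
Local Notation T := (tpoint R d).
Local Notation fhat := fourier_coef.
Local Notation P := ((2 * pi : R) ^+ d).

Implicit Types (f g h : torus_fun R d) (j k : d.-tuple int).

Definition fpow f m : torus_fun R d := fun x => zpow (f x) m.

Lemma fourier_coefJE f : inL2 f ->
  fhat (fun x => (f x)^*%C) = (fun j => (fhat f (jneg j))^*%C).
Proof. by move=> If; apply/funext => j; rewrite fourier_coefJ//; exact: Cint_L2. Qed.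

Lemma inL2M f g (A : R) : inL2 f -> inL2 g -> l1B (fhat f) A -> inL2 (fun x => f x * g x).
Proof.
move=> If Ig fA; apply: (@inL2_le_ae _ _ _ (fun x => A ^+ 2 * sqc (g x))).
- by apply: cmeasurableM; exact: inL2_meas.
- by apply: RiZ; exact: inL2_int.
- apply: filterS (Linf_of_l1 If fA) => x fx; rewrite sqcM ler_wpM2r ?sqc_ge0//.
  by rewrite sqc_normc_le//; exact: sumB_ge0 fA.
Qed.

Definition fsel (b : bool) f : torus_fun R d := if b then f else fun x => (f x)^*%C.

Lemma fpowS f m : fpow f m.+1 = (fun x => fpow f m x * fsel (odd m) f x).
Proof. by apply/funext => x; rewrite /fpow /fsel/=; case: odd. Qed.

Lemma inL2_fsel b f : inL2 f -> inL2 (fsel b f).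
Proof. by case: b => // If; exact: inL2J. Qed.

Lemma l1B_fsel b f A : inL2 f -> l1B (fhat f) A -> l1B (fhat (fsel b f)) A.
Proof. by case: b => //= If fA; rewrite /fsel fourier_coefJE//; exact: l1BN. Qed.

Lemma l1gradB_fsel b f A : inL2 f -> l1gradB (fhat f) A -> l1gradB (fhat (fsel b f)) A.
Proof. by case: b => //= If fA; rewrite /fsel fourier_coefJE//; exact: l1gradBN. Qed.

Lemma sobB_fsel b s f A : inL2 f -> sobB s (fhat f) A -> sobB s (fhat (fsel b f)) A.
Proof. by case: b => //= If fA; rewrite /fsel fourier_coefJE//; exact: sobBN. Qed.

Lemma fpow_l1 f A m : inL2 f -> l1B (fhat f) A ->
  inL2 (fpow f m) /\ l1B (fhat (fpow f m)) (A ^+ m.+1).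
Proof.
move=> If fA; elim: m => [|m [ih1 ih2]]; first by rewrite expr1.
rewrite fpowS; split; first by apply: inL2M ih2 => //; exact: inL2_fsel.
by rewrite exprSr; apply: l1B_mul => //; [exact: inL2_fsel|exact: l1B_fsel].
Qed.

Lemma fpow_l1grad f A A1 m : inL2 f -> l1B (fhat f) A -> l1gradB (fhat f) A1 ->
  l1gradB (fhat (fpow f m)) (m.+1%:R * A ^+ m * A1).
Proof.
move=> If fA fA1; elim: m => [|m ih]; first by rewrite !mul1r.
have [Im lm] := fpow_l1 m If fA.
rewrite fpowS.
have := l1gradB_mul Im (inL2_fsel (odd m) If) lm (l1B_fsel (odd m) If fA) ih (l1gradB_fsel (odd m) If fA1).
move=> h; apply: sumB_le h _ _ => //.
by rewrite -[m.+2%:R]natr1 !exprSr; lra.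
Qed.

(** Each further factor contributes $4\cdot 4^s(E+1)$ where $E=(8\cdot 4^s)^m\ge 1$, hence at most
    $8\cdot 4^sE$. *)
Lemma fpow_sob f A s S m : 0 <= s -> inL2 f -> l1B (fhat f) A -> sobB s (fhat f) S ->
  sobB s (fhat (fpow f m)) ((8 * 4 `^ s) ^+ m * A ^+ (2 * m) * S).
Proof.
move=> s0 If fA fS; have A0 := sumB_ge0 fA; have S0 := sumB_ge0 fS.
elim: m => [|m ih]; first by rewrite muln0 !expr0 !mul1r.
have [Im lm] := fpow_l1 m If fA.
rewrite fpowS.
have := sobB_mul s0 Im (inL2_fsel (odd m) If) lm (l1B_fsel (odd m) If fA) ih (sobB_fsel (odd m) If fS).
move=> h; apply: sumB_le h _ _ => //.
have e4 : 1 <= 4 `^ s :> R by rewrite -[leLHS](powRr0 4); apply: ler_powR; lra.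
rewrite mulnS exprD -!exprM [(m.+1 * 2)%N]mulnC mulnS exprD [(8 * _) ^+ m.+1]exprS.
set E := (8 * 4 `^ s) ^+ m; set B := A ^+ (2 * m).
have E1 : 1 <= E by rewrite exprn_ege1//; lra.
have B0 : 0 <= B by exact: exprn_ge0.
set c := 4 `^ s in e4 *; set a := A ^+ 2.
have X0 : 0 <= c * (a * B * S).
  by rewrite !mulr_ge0 ?sqr_ge0//; lra.
nra.
Qed.

(** Induction with the tame product estimate: the main term evolves by $16(q+1)\le 32q$ with
    $q=32^m$. The lower-order term uses the crude bound in $H^{s-1}$ and the gradient bound of the
    power. *)
Lemma fpow_sob_tame f A A1 s S S1 m : 1 <= s -> 0 < A -> inL2 f ->
  l1B (fhat f) A -> l1gradB (fhat f) A1 -> sobB s (fhat f) S -> sobB (s - 1) (fhat f) S1 ->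
  sobB s (fhat (fpow f m))
    (A ^+ (2 * m) * (32 ^+ m * S + (64 * 16 `^ s) ^+ m * (A1 / A) ^+ 2 * S1)).
Proof.
move=> s1 A0 If fA fA1 fS fS1.
have S0 := sumB_ge0 fS; have S10 := sumB_ge0 fS1; have A10 := sumB_ge0 fA1.
have s10 : 0 <= s - 1 by lra.
elim: m => [|m ih].
  rewrite muln0 !expr0 !mul1r; apply: sumB_le fS _ _ => //.
  by rewrite lerDl mulr_ge0// sqr_ge0.
have [Im lm] := fpow_l1 m If fA.
have gm := fpow_l1grad m If fA fA1.
have cm := fpow_sob m s10 If fA fS1.
rewrite fpowS.
have := sobB_mul_tame s1 Im (inL2_fsel (odd m) If) lm (l1B_fsel (odd m) If fA) gm
  (l1gradB_fsel (odd m) If fA1) ih (sobB_fsel (odd m) If fS) cm (sobB_fsel (odd m) If fS1).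
move=> h; apply: sumB_le h _ _ => //.
have e4 : 4 <= 4 `^ s :> R.
  by rewrite -[leLHS](@powRr1 _ 4)//; apply: ler_powR; lra.
have e16 : 16 `^ s = 4 `^ s * 4 `^ s :> R.
  by rewrite -powRM//; congr (_ `^ _); lra.
have em : 4 `^ (s - 1) = 4 `^ s / 4 :> R.
  by rewrite powRB ?powRr1//; apply/implyP.
set c := 4 `^ s in e4 e16 em *.
(* The crude factor $8\cdot 4^{s-1}$ of the $H^{s-1}$ estimate is $2\cdot 4^s$. *)
rewrite em (_ : 8 * (c / 4) = 2 * c); last by lra.
have -> : A1 = (A1 / A) * A by rewrite divfK// gt_eqF.
rewrite mulfK ?gt_eqF//.
set th := A1 / A.
have th0 : 0 <= th by rewrite divr_ge0// ltW.
rewrite e16.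
have -> : A ^+ (2 * m.+1) = A ^+ (2 * m) * A ^+ 2 by rewrite mulnS addnC exprD.
have -> : (A ^+ m.+1) ^+ 2 = A ^+ (2 * m) * A ^+ 2 by rewrite -exprM mulnC mulnS addnC exprD.
have -> : (m.+1%:R * A ^+ m * (th * A)) ^+ 2 = m.+1%:R ^+ 2 * (A ^+ (2 * m) * A ^+ 2) * th ^+ 2.
  by rewrite !exprMn -[(A ^+ m) ^+ 2]exprM (mulnC m); ring.
set a := A ^+ 2; set B := A ^+ (2 * m).
rewrite [(th * A) ^+ 2]exprMn -/a.
set Z := (64 * (c * c)) ^+ m; rewrite ![_ ^+ m.+1]exprS -/Z.
set E := (2 * c) ^+ m; set q := 32 ^+ m.
have E1 : 1 <= E by rewrite exprn_ege1//; lra.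
have EZ : E <= Z by apply: lerXn2r; rewrite ?nnegrE; nra.
have q1 : 1 <= q by rewrite exprn_ege1//; lra.
(* The polynomial factor $(m+1)^2$ from the gradient of the power is absorbed by $4^m\le(2\cdot
   4^s)^m$. *)
have m2 : m.+1%:R ^+ 2 <= E.
  have h1 : (m.+1%:R : R) <= 2 ^+ m.
    by have := @bernoulli_ge R 1 m; rewrite mulr1 -natr1 addrC; apply; lra.
  rewrite (@le_trans _ _ ((2 ^+ m) ^+ 2))//; first by rewrite ler_sqr ?nnegrE// exprn_ge0.
  by rewrite -exprM mulnC exprM; apply: lerXn2r; rewrite ?nnegrE; lra.
set M2 := m.+1%:R ^+ 2 in m2 *.
have a0 : 0 <= a by exact: sqr_ge0.
have B0 : 0 <= B by rewrite exprn_ge0// ltW.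
set t := th ^+ 2; have t0 : 0 <= t by exact: sqr_ge0.
have Ba : 0 <= B * a by rewrite mulr_ge0.
have -> : 16 * (B * (q * S + Z * t * S1) * a + B * a * S) +
  16 * (c * c) * (E * B * S1 * (t * a) + M2 * (B * a) * t * S1) =
  (B * a) * (16 * (q + 1) * S + (16 * Z + 16 * (c * c) * (E + M2)) * (t * S1)) by ring.
rewrite ler_wpM2l// lerD//; first by rewrite ler_wpM2r//; lra.
have tS : 0 <= t * S1 by exact: mulr_ge0.
rewrite -[leRHS]mulrA; apply: (ler_wpM2r tS).
have : (c * c) * (E + M2) <= c * c * (2 * Z) by rewrite ler_wpM2l ?mulr_ge0; nra.
have c16 : 16 <= c * c by nra.
have Z0 : 0 <= Z by lra.
have := ler_wpM2r Z0 c16.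
by set X := c * c; lra.
Qed.

Definition nl p f : torus_fun R d := fun x => `|f x| ^+ (2 * p) * f x.

Lemma nlE p f : nl p f = fpow f (2 * p).
Proof. by apply/funext => x; rewrite /nl /fpow zpow_even. Qed.

Lemma n2_fpowB f g A m : inL2 f -> inL2 g -> l1B (fhat f) A -> l1B (fhat g) A ->
  n2 (fun x => fpow f m x - fpow g m x) <=
  (m.+1%:R * A ^+ m) ^+ 2 * n2 (fun x => f x - g x).
Proof.
move=> If Ig fA gA; have A0 := sumB_ge0 fA.
apply: n2_le_ae.
- by apply: inL2B; [case: (fpow_l1 m If fA)|case: (fpow_l1 m Ig gA)].
- exact: inL2B.
apply: filterS2 (Linf_of_l1 If fA) (Linf_of_l1 Ig gA) => x fx gx.
rewrite -[sqc (f x - g x)]sqr_normcE -exprMn sqc_normc_le; last first.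
  by rewrite !mulr_ge0 ?exprn_ge0 ?normc_ge0.
exact: zpow_lip.
Qed.

(* The junk value [0] is taken when [a] is not square summable. *)
Definition synth (a : d.-tuple int -> R[i]) : torus_fun R d :=
  if pselect (exists f, inL2 f /\ fhat f = a) is left e then projT1 (cid e) else fun=> 0.

Lemma synthP a B : sobB 0 a B -> inL2 (synth a) /\ fhat (synth a) = a.
Proof.
move=> /sobB0 aB; rewrite /synth; case: pselect => [e|[]].
  by case: (cid e).
have [f If [fa _]] := riesz_fischer aB.
by exists f; split => //; apply/funext.
Qed.

Definition nlhat p a : d.-tuple int -> R[i] := fhat (nl p (synth a)).

Lemma inL2_nl p a A B : sobB 0 a B -> l1B a A -> inL2 (nl p (synth a)).
Proof.
move=> /synthP[Ia ea] aA; rewrite nlE.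
by case: (@fpow_l1 _ A (2 * p) Ia); rewrite ?ea.
Qed.

Lemma nlhat_sob p a A B s S : 0 <= s -> sobB 0 a B -> l1B a A -> sobB s a S ->
  sobB s (nlhat p a) ((8 * 4 `^ s) ^+ (2 * p) * A ^+ (4 * p) * S).
Proof.
move=> s0 /synthP[Ia ea] aA aS; rewrite /nlhat nlE.
have := @fpow_sob _ A s S (2 * p) s0 Ia; rewrite ea => /(_ aA aS).
by rewrite mulnA.
Qed.

Lemma nlhat_tame p a A A1 B s S S1 : 1 <= s -> 0 < A -> sobB 0 a B -> l1B a A ->
  l1gradB a A1 -> sobB s a S -> sobB (s - 1) a S1 ->
  sobB s (nlhat p a)
    (A ^+ (4 * p) * (32 ^+ (2 * p) * S + (64 * 16 `^ s) ^+ (2 * p) * (A1 / A) ^+ 2 * S1)).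
Proof.
move=> s1 A0 /synthP[Ia ea] aA aA1 aS aS1; rewrite /nlhat nlE.
have := @fpow_sob_tame _ A A1 s S S1 (2 * p) s1 A0 Ia; rewrite ea => /(_ aA aA1 aS aS1).
by rewrite mulnA.
Qed.

(** The Lipschitz bound is pointwise on functions, through the sup bound implied by $\ell^1$;
    Parseval leads from coefficients to functions and Bessel back. *)
Lemma nl_lip p f g A D : inL2 f -> inL2 g -> l1B (fhat f) A -> l1B (fhat g) A ->
  sobB 0 (fun j => fhat f j - fhat g j) D ->
  sobB 0 (fun j => fhat (nl p f) j - fhat (nl p g) j) (((2 * p).+1%:R * A ^+ (2 * p)) ^+ 2 * D).
Proof.
move=> If Ig fA gA /sobB0 hD; rewrite !nlE; apply/sobB0.
have [If' _] := fpow_l1 (2 * p) If fA; have [Ig' _] := fpow_l1 (2 * p) Ig gA.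
have P0 := P_gt0 (R := R) (d := d).
have hD' : n2 (fun x => f x - g x) <= P * D.
  apply: parseval_le; first exact: inL2B.
  by apply: sumB_le hD _ (lexx _) => j; rewrite fourier_coefB//; exact: Cint_L2.
apply: sumB_le (bessel (inL2B If' Ig')) _ _.
  by move=> j; rewrite fourier_coefB//; exact: Cint_L2.
rewrite ler_pdivrMl// (le_trans (n2_fpowB _ If Ig fA gA))// mulrCA ler_wpM2l//.
exact: sqr_ge0.
Qed.

Lemma nlhat_lip p a b A B D : sobB 0 a B -> sobB 0 b B -> l1B a A -> l1B b A ->
  sobB 0 (fun j => a j - b j) D ->
  sobB 0 (fun j => nlhat p a j - nlhat p b j) (((2 * p).+1%:R * A ^+ (2 * p)) ^+ 2 * D).
Proof.
move=> /synthP[Ia ea] /synthP[Ib eb] aA bA abD.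
by apply: nl_lip; rewrite ?ea ?eb.
Qed.

End Nonlinearity.

(** * Curves of coefficients *)

Section TimeCalculus.
Context {R : realType}.

Lemma is_derive_sum_seq (I : Type) (K : seq I) (f : I -> R -> R) (df : I -> R) (x : R) :
  (forall i, is_derive x (1 : R) (f i) (df i)) ->
  is_derive x (1 : R) (fun y => \sum_(i <- K) f i y) (\sum_(i <- K) df i).
Proof.
move=> fd; elim: K => [|i K ih].
  by rewrite big_nil; under eq_fun do rewrite big_nil; exact: is_derive_cst.
by rewrite big_cons; under eq_fun do rewrite big_cons; exact: is_deriveD.
Qed.

Definition cderive (f : R -> R[i]) (l : R[i]) (t : R) : Prop :=
  is_derive t (1 : R) (fun y => Re (f y)) (Re l) /\
  is_derive t (1 : R) (fun y => Im (f y)) (Im l).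

Definition ccontinuous (f : R -> R[i]) : Prop :=
  continuous (fun y => Re (f y)) /\ continuous (fun y => Im (f y)).

Definition ccontinuous_within (a b : R) (f : R -> R[i]) : Prop :=
  {within `[a, b], continuous (fun y => Re (f y))} /\
  {within `[a, b], continuous (fun y => Im (f y))}.

Lemma within_continuousS (f : R -> R) (a b a' b' : R) : a <= a' -> b' <= b ->
  {within `[a, b], continuous f} -> {within `[a', b'], continuous f}.
Proof.
move=> aa bb; apply: continuous_subspaceW => x /=; rewrite !in_itv/= => /andP[h1 h2].
by rewrite (le_trans aa h1) (le_trans h2 bb).
Qed.

Lemma ccontinuous_withinS (f : R -> R[i]) (a b a' b' : R) : a <= a' -> b' <= b ->
  ccontinuous_within a b f -> ccontinuous_within a' b' f.
Proof. by move=> aa bb [f1 f2]; split; apply: within_continuousS aa bb _. Qed.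

(* Apply the scalar mean value theorem to the component of the curve along its
   own increment. *)
Lemma vector_mean_value (I : Type) (K : seq I) (w : I -> R) (b g : I -> R -> R[i])
    (t0 t1 B : R) :
  t0 <= t1 -> (forall i, 0 <= w i) ->
  (forall i, ccontinuous_within t0 t1 (b i)) ->
  (forall i x, t0 < x < t1 -> cderive (b i) (g i x) x) ->
  (forall x, t0 < x < t1 -> \sum_(i <- K) w i * sqc (g i x) <= B) ->
  \sum_(i <- K) w i * sqc (b i t1 - b i t0) <= (t1 - t0) ^+ 2 * B.
Proof.
move=> t01 w0 bc bd gB; have [<-|t0t1] := eqVneq t0 t1.
  by rewrite subrr expr0n mul0r big1// => i _; rewrite subrr sqc0 mulr0.
have tt : t0 < t1 by rewrite lt_neqAle t0t1.
pose D i := b i t1 - b i t0.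
pose H x := \sum_(i <- K) w i * (Re (D i) * Re (b i x) + Im (D i) * Im (b i x)).
pose dH x := \sum_(i <- K) w i * (Re (D i) * Re (g i x) + Im (D i) * Im (g i x)).
have Hd x : x \in `]t0, t1[ -> is_derive x (1 : R) H (dH x).
  rewrite in_itv/= => xt; apply: is_derive_sum_seq => i; have [d1 d2] := bd i x xt.
  by apply: is_deriveZ; apply: is_deriveD; exact: is_deriveZ.
have Hc : {within `[t0, t1], continuous H}.
  rewrite /H; elim: K {gB H dH Hd} => [|i K ih].
    rewrite (_ : (fun x => _) = fun=> 0); first by move=> x; exact: cvg_cst.
    by apply/funext => x; rewrite big_nil.
  rewrite (_ : (fun x => _) = fun x => w i * (Re (D i) * Re (b i x) + Im (D i) * Im (b i x)) +
     \sum_(i <- K) w i * (Re (D i) * Re (b i x) + Im (D i) * Im (b i x))); last first.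
    by apply/funext => x; rewrite big_cons.
  move=> x; have [c1 c2] := bc i.
  apply: cvgD; last exact: ih.
  apply: cvgM; first exact: cvg_cst.
  by apply: cvgD; (apply: cvgM; first exact: cvg_cst); [exact: c1|exact: c2].
have [c ct Hcc] := MVT tt Hd Hc.
set Y := \sum_(i <- K) w i * sqc (b i t1 - b i t0).
have YE : H t1 - H t0 = Y.
  rewrite /H /Y -sumrB; apply: eq_bigr => i _; rewrite -/(D i) /sqc.
  by rewrite /D !reimE; ring.
have h : 0 < t1 - t0 by rewrite subr_gt0.
have := gB c; rewrite in_itv/= in ct => /(_ ct) gc.
(* From $2ab\le a^2+b^2$ in each component. The mean value theorem gives $Y=(t_1-t_0)\,$[dH c], so
   $2Y\le Y+(t_1-t_0)^2B$. *)
have dHle : 2 * (t1 - t0) * dH c <= Y + (t1 - t0) ^+ 2 * B.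
  apply: (@le_trans _ _ (Y + (t1 - t0) ^+ 2 * \sum_(i <- K) w i * sqc (g i c))).
    rewrite /dH /Y !big_distrr/= -big_split/=; apply: ler_sum => i _; rewrite -/(D i) /sqc.
    have := mulr_ge0 (w0 i) (sqr_ge0 (Re (D i) - (t1 - t0) * Re (g i c))).
    have := mulr_ge0 (w0 i) (sqr_ge0 (Im (D i) - (t1 - t0) * Im (g i c))).
    lra.
  by rewrite lerD2l ler_wpM2l// sqr_ge0.
move: Hcc; rewrite YE; nra.
Qed.

Lemma primitive_exists (g : R -> R) (T : R) : 0 < T -> continuous g ->
  exists G : R -> R, G 0 = 0 /\ forall x, 0 <= x <= T -> is_derive x (1 : R) G (g x).
Proof.
move=> T0 cg.
(* The integral starts at $-1$ and integrability is taken up to $T+1$, so that 0 and $T$ are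
   interior points and the derivative there is two-sided. *)
pose F (x : R) : R := \int[lebesgue_measure]_(t in [set` Interval (BLeft (-1 : R)) (BRight x)]) g t.
exists (fun x => F x - F 0); split; first by rewrite subrr.
move=> x /andP[x0 xT].
have Ig : lebesgue_measure.-integrable [set` Interval (BLeft (-1 : R)) (BRight (T + 1))] (EFin \o g).
  apply: continuous_compact_integrable; first exact: segment_compact.
  by apply: continuous_subspaceT.
have xT1 : x < T + 1 by lra.
have ax : (-1 : R) < x by lra.
have [dF eF] := continuous_FTC1_closed xT1 Ig ax (cg x).
have h : is_derive x (1 : R) F (g x).
  by apply: DeriveDef => //; rewrite -eF derive1E.
rewrite -[g x]subr0; apply: is_deriveB; exact: is_derive_cst.
Qed.

Lemma cprimitive_exists (g : R -> R[i]) (T : R) : 0 < T -> ccontinuous g ->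
  exists G : R -> R[i], G 0 = 0 /\ forall x, 0 <= x <= T -> cderive G (g x) x.
Proof.
move=> T0 [c1 c2].
have [G1 [z1 d1]] := primitive_exists T0 c1.
have [G2 [z2 d2]] := primitive_exists T0 c2.
exists (fun x => (G1 x +i* G2 x)%C); split; first by rewrite z1 z2.
by move=> x xT; split => /=; [exact: d1|exact: d2].
Qed.

Lemma is_derive_continuous (f : R -> R) (l x : R) : is_derive x (1 : R) f l -> {for x, continuous f}.
Proof.
by move=> d; apply/differentiable_continuous/derivable1_diffP; case: d.
Qed.

Definition cis (t : R) : R[i] := (cos t +i* sin t)%C.

Lemma sqc_cis t : sqc (cis t) = 1.
Proof. by rewrite /sqc/= cos2Dsin2. Qed.

Lemma cisD t s : cis (t + s) = cis t * cis s.
Proof.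
by apply: complexP; rewrite ?Re_mul ?Im_mul/= ?cosD ?sinD// addrC.
Qed.

Lemma cis0 : cis 0 = 1.
Proof. by rewrite /cis cos0 sin0. Qed.

Lemma cisNK t : cis t * cis (- t) = 1.
Proof. by rewrite -cisD subrr cis0. Qed.

Lemma ccontinuous_cis (a : R) : ccontinuous (fun t => cis (a * t)).
Proof.
split.
  rewrite (_ : (fun y => _) = fun y : R => cos (a * y + 0)); first exact: continuous_cos_affine.
  by apply/funext => y; rewrite addr0.
rewrite (_ : (fun y => _) = fun y : R => cos (a * y + - (pi / 2))).
  exact: continuous_cos_affine.
by apply/funext => y; rewrite cosBpihalf.
Qed.

Lemma cderive_cis (a x : R) : cderive (fun t => cis (a * t)) ((0 +i* a)%C * cis (a * x)) x.
Proof.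
have h : is_derive x (1 : R) (fun t : R => a * t) a.
  by apply: is_derive_eq; rewrite [LHS]mulr1.
split; rewrite ?Re_mul ?Im_mul/=.
  have := @is_derive1_comp R cos (fun t => a * t) x _ _ (is_derive_cos _) h.
  by move=> d; apply: is_derive_eq d _; rewrite mul0r sub0r mulNr mulrC.
have := @is_derive1_comp R sin (fun t => a * t) x _ _ (is_derive_sin _) h.
by move=> d; apply: is_derive_eq d _; rewrite mul0r add0r mulrC.
Qed.

Lemma cderiveM (f g : R -> R[i]) (l k : R[i]) x : cderive f l x -> cderive g k x ->
  cderive (fun y => f y * g y) (l * g x + f x * k) x.
Proof.
move=> [f1 f2] [g1 g2]; split.
  under eq_fun do rewrite Re_mul.
  have := is_deriveB (is_deriveM f1 g1) (is_deriveM f2 g2).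
  move=> d; apply: is_derive_eq d _.
  by rewrite !reimE /GRing.scale/=; ring.
under eq_fun do rewrite Im_mul.
have := is_deriveD (is_deriveM f1 g2) (is_deriveM f2 g1).
move=> d; apply: is_derive_eq d _.
by rewrite !reimE /GRing.scale/=; ring.
Qed.

Lemma ccontinuousM (f g : R -> R[i]) : ccontinuous f -> ccontinuous g ->
  ccontinuous (fun y => f y * g y).
Proof.
move=> [f1 f2] [g1 g2]; split.
  rewrite (_ : (fun y => _) = fun y => Re (f y) * Re (g y) - Im (f y) * Im (g y)).
    by move=> x; apply: cvgB; apply: cvgM; [exact: f1|exact: g1|exact: f2|exact: g2].
  by apply/funext => y; rewrite Re_mul.
rewrite (_ : (fun y => _) = fun y => Re (f y) * Im (g y) + Im (f y) * Re (g y)).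
  by move=> x; apply: cvgD; apply: cvgM; [exact: f1|exact: g2|exact: f2|exact: g1].
by apply/funext => y; rewrite Im_mul.
Qed.

Lemma ccontinuous_cst (c : R[i]) : ccontinuous (fun=> c).
Proof. by split => x; exact: cvg_cst. Qed.

Lemma ccontinuousW (f : R -> R[i]) a b : ccontinuous f -> ccontinuous_within a b f.
Proof. by move=> [f1 f2]; split; exact: continuous_subspaceT. Qed.

(** The mean value inequality along $s\mapsto e^{\mathrm{i}ts}$ on $[0,1]$. *)
Lemma sqc_cis_sub (t : R) : sqc (cis t - 1) <= t ^+ 2.
Proof.
have := @vector_mean_value unit [:: tt] (fun=> 1) (fun _ s => cis (t * s))
  (fun _ s => (0 +i* t)%C * cis (t * s)) 0 1 (t ^+ 2) ler01 (fun=> ler01).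
rewrite big_seq1 mulr1 mulr0 cis0 mul1r subr0 expr1n mul1r; apply.
- by move=> _; apply: ccontinuousW; exact: ccontinuous_cis.
- by move=> _ x _; exact: cderive_cis.
- by move=> x _; rewrite big_seq1 mul1r sqcM sqc_cis mulr1 /sqc/= expr0n add0r.
Qed.

Lemma lipschitz_ccontinuous (f : R -> R[i]) (L : R) : 
  (forall x y, sqc (f x - f y) <= L * (x - y) ^+ 2) -> ccontinuous f.
Proof.
move=> fL; have L0 : 0 <= L.
  by have := le_trans (sqc_ge0 _) (fL 1 0); rewrite subr0 expr1n mulr1.
have key (h : R -> R) : (forall x y, (h x - h y) ^+ 2 <= L * (x - y) ^+ 2) -> continuous h.
  move=> hL x; apply/cvgrPdist_le => e e0.
  have d0 : 0 < e / (L + 1) by rewrite divr_gt0// ltr_wpDl.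
  near=> y.
  have xy : `|x - y| <= e / (L + 1) by near: y; apply: cvgr_dist_le => //; exact: cvg_id.
  have e1 : `|h x - h y| ^+ 2 <= e ^+ 2.
    rewrite real_normK ?num_real// (le_trans (hL x y))//.
    rewrite -[(x - y) ^+ 2]real_normK ?num_real//.
    rewrite (@le_trans _ _ (L * (e / (L + 1)) ^+ 2))//.
      by rewrite ler_wpM2l// lerXn2r ?nnegrE// ltW.
    rewrite exprMn mulrCA -[leRHS]mulr1 ler_wpM2l ?sqr_ge0//.
    rewrite exprVn ler_pdivrMr ?mul1r ?exprn_gt0 ?ltr_wpDl//.
    nra.
  by move: e1; rewrite ler_sqr ?nnegrE// ltW.
split; apply: key => x y; rewrite (le_trans _ (fL x y))// /sqc !reimE.
  by rewrite lerDl sqr_ge0.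
by rewrite lerDr sqr_ge0.
Unshelve. all: by end_near. Qed.

End TimeCalculus.

(** * Picard iteration *)

Section SobolevFamilies.
Context {R : realType} {d : nat}.
Local Notation fn := (@freq_norm R d).
Implicit Types (a b : d.-tuple int -> R[i]) (j : d.-tuple int).

Lemma sobB_le s a (A B : R) : sobB s a A -> A <= B -> sobB s a B.
Proof. by move=> h AB; apply: sumB_le h _ AB. Qed.

Lemma sobB_sqc s a b (A : R) : sobB s a A -> (forall j, sqc (b j) <= sqc (a j)) -> sobB s b A.
Proof. by move=> h ab; apply: sumB_le h _ (lexx _) => j; rewrite ler_wpM2l ?fweight_ge0. Qed.

Lemma sobBD s a b (A B : R) : sobB s a A -> sobB s b B ->
  sobB s (fun j => a j + b j) (2 * (A + B)).
Proof.
move=> hA hB; apply: sumB_le (sumBZ (ler0n _ 2) (sumBD hA hB)) _ (lexx _) => j.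
by rewrite -mulrDr mulrCA ler_wpM2l ?fweight_ge0// sqcD_le.
Qed.

Lemma sobBB s a b (A B : R) : sobB s a A -> sobB s b B ->
  sobB s (fun j => a j - b j) (2 * (A + B)).
Proof.
move=> hA hB; apply: sobBD => //.
by apply: sobB_sqc hB _ => j; rewrite sqcN.
Qed.

(** A substitute for Fatou's lemma: bounds are tested on finite sums, which pass to coefficientwise
    limits. *)
Lemma sobB_lim s (a_ : nat -> d.-tuple int -> R[i]) a (B : R) :
  (forall n, sobB s (a_ n) B) ->
  (forall j, Re (a_ n j) @[n --> \oo] --> Re (a j) /\ Im (a_ n j) @[n --> \oo] --> Im (a j)) ->
  sobB s a B.
Proof.
move=> hB ha K uK; apply: (@cvg_le_bound _ (fun n => \sum_(j <- K) fweight s j * sqc (a_ n j))).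
  apply: cvg_sum_seq => j; apply: cvgM; first exact: cvg_cst.
  have [h1 h2] := ha j.
  by rewrite /sqc; apply: cvgD; rewrite expr2; under eq_fun do rewrite expr2; exact: cvgM.
by move=> n; exact: hB.
Qed.

Lemma sobB_single (a : d.-tuple int -> R[i]) (B : R) j : sobB 0 a B -> sqc (a j) <= B.
Proof. by move=> /sobB0 h; exact: sumB_single h. Qed.

Lemma sobB_eq0 a : sobB 0 a (0 : R) -> a = fun=> 0.
Proof.
move=> h; apply/funext => j; apply: sqc_eq0; apply/eqP.
by rewrite eq_le sqc_ge0 andbT; exact: sobB_single h.
Qed.

(** The flow of the linear equation $\mathrm{i}u_t=\Delta u$ on Fourier coefficients. *)
Definition rot (t : R) a : d.-tuple int -> R[i] := fun j => cis (fn j ^+ 2 * t) * a j.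

Lemma rot_sob s t a (B : R) : sobB s a B -> sobB s (rot t a) B.
Proof. by move=> h; apply: sobB_sqc h _ => j; rewrite sqcM sqc_cis mul1r. Qed.

(** A time difference of the free flow costs a factor $|j|^2$, that is two derivatives, paid by the
    bound in [sobB 2]. *)
Lemma rot_lip t t' a b (D B2 : R) : sobB 0 (fun j => a j - b j) D -> sobB 2 b B2 ->
  sobB 0 (fun j => rot t a j - rot t' b j) (2 * (D + (t - t') ^+ 2 * B2)).
Proof.
move=> hD hB.
have -> : (fun j => rot t a j - rot t' b j) =
    (fun j => rot t (fun j => a j - b j) j + (rot t b j - rot t' b j)).
  by apply/funext => j; rewrite /rot; ring.
apply: sobBD; first exact: rot_sob.
apply: sumB_le (sumBZ (sqr_ge0 (t - t')) hB) _ (lexx _) => j.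
rewrite fweight0 mul1r /rot -mulrBl sqcM mulrA ler_wpM2r ?sqc_ge0//.
have -> : cis (fn j ^+ 2 * t) - cis (fn j ^+ 2 * t') =
   cis (fn j ^+ 2 * t') * (cis (fn j ^+ 2 * (t - t')) - 1).
  by rewrite mulrBr mulr1 -cisD; congr (cis _ - _); ring.
rewrite sqcM sqc_cis mul1r (le_trans (sqc_cis_sub _))// exprMn mulrC.
by rewrite /fweight (@powR_mulrn _ _ 2)// freq_norm_ge0.
Qed.

End SobolevFamilies.

Section Picard.
Context {R : realType} {d : nat}.
Local Notation fn := (@freq_norm R d).
Local Notation coefs := (d.-tuple int -> R[i]).
(** [q0] and [q1] bound the squared $L^2$ and $H^{s_1}$ norms of the datum, up to normalisation, and
    [A] is the $\ell^1$ bound available on the balls enlarged by 4. [K0] and [K1] keep the iterates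
    inside these balls, [KL] makes a step contract. *)
Variables (sg : R[i]) (p : nat) (s1 q0 q1 A T : R) (u0 : coefs).
Hypotheses (sg1 : sqc sg = 1) (s1_ge2 : 2 <= s1) (T_gt0 : 0 < T).
Hypothesis l1A : forall a : coefs, sobB 0 a (4 * q0) -> sobB s1 a (4 * q1) -> l1B a A.
Hypothesis K0 : T ^+ 2 * ((8 * 4 `^ 0) ^+ (2 * p) * A ^+ (4 * p)) <= 4^-1.
Hypothesis K1 : T ^+ 2 * ((8 * 4 `^ s1) ^+ (2 * p) * A ^+ (4 * p)) <= 4^-1.
Hypothesis KL : T ^+ 2 * ((2 * p).+1%:R * A ^+ (2 * p)) ^+ 2 <= 4^-1.
Hypothesis u0q0 : sobB 0 u0 q0.
Hypothesis u0q1 : sobB s1 u0 q1.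

Implicit Types (b : R -> coefs) (t : R) (j : d.-tuple int).

Local Notation Lam := (((2 * p).+1%:R * A ^+ (2 * p)) ^+ 2).
Local Notation Lb := ((8 * 4 `^ 0) ^+ (2 * p) * A ^+ (4 * p) * (4 * q0)).

(* The equation for the Fourier coefficients in the interaction picture: the
   unknown is [b] with [rot t (b t)] the coefficients of the solution. *)
Definition rhs b t : coefs :=
  fun j => sg * cis (- fn j ^+ 2 * t) * nlhat p (rot t (b t)) j.

Definition clamp t : R := Num.max 0 (Num.min t T).

Lemma clamp_itv t : 0 <= clamp t <= T.
Proof. by rewrite le_max lexx/= ge_max (ltW T_gt0)/= ge_min lexx orbT. Qed.

Lemma clamp_id t : 0 <= t <= T -> clamp t = t.
Proof. by move=> /andP[t0 tT]; rewrite /clamp (min_idPl tT) (max_idPr t0). Qed.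

Lemma clamp_lip t t' : (clamp t - clamp t') ^+ 2 <= (t - t') ^+ 2.
Proof.
have h x y : x <= y -> 0 <= clamp y - clamp x <= y - x.
  have := T_gt0; rewrite /clamp /Order.max /Order.min => T0 xy; apply/andP.
  by case: (ltP x T) => xT; case: (ltP y T) => yT; do ?case: ltP => ?; split; lra.
have [le|/ltW le] := leP t t'.
  rewrite -(sqrrN (clamp t - _)) -(sqrrN (t - _)) !opprB.
  by move: (h _ _ le) => /andP[h1 h2]; rewrite ler_sqr ?nnegrE// (le_trans h1).
by move: (h _ _ le) => /andP[h1 h2]; rewrite ler_sqr ?nnegrE// (le_trans h1).
Qed.

(* The factors [4] leave room for the nonlinear term: [2 (q + q) <= 4 q]. *)
Definition good b : Prop :=
  [/\ forall t, sobB 0 (b t) (4 * q0), forall t, sobB s1 (b t) (4 * q1) &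
      forall t t', sobB 0 (fun j => b t j - b t' j) ((t - t') ^+ 2 * Lb)].

(* Freezing [b'] outside [0, T] makes its bounds valid at all times. *)
Definition step b b' : Prop :=
  [/\ b' 0 = u0, forall t, b' t = b' (clamp t), forall j, ccontinuous (b' ^~ j) &
      forall j t, 0 < t < T -> cderive (b' ^~ j) (rhs b t j) t].

Lemma q0_ge0 : 0 <= q0. Proof. exact: sumB_ge0 u0q0. Qed.
Lemma q1_ge0 : 0 <= q1. Proof. exact: sumB_ge0 u0q1. Qed.

Lemma rhs_sob s b t (B : R) : sobB s (nlhat p (rot t (b t))) B -> sobB s (rhs b t) B.
Proof. by move=> h; apply: sobB_sqc h _ => j; rewrite /rhs !sqcM sg1 sqc_cis !mul1r. Qed.

Lemma good_l1 b t : good b -> l1B (rot t (b t)) A.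
Proof. by move=> [h0 h1 _]; apply: l1A; exact: rot_sob. Qed.

Lemma good_rot b t : good b -> sobB 0 (rot t (b t)) (4 * q0).
Proof. by move=> [h0 _ _]; exact: rot_sob. Qed.

Lemma good_sob2 b : good b -> exists B2, forall t, sobB 2 (b t) B2.
Proof.
move=> [h0 h1 _]; eexists => t.
by apply: (@sobB_interp _ _ 1 0 2 s1 (b t) _ _ _ _ _ _ (h0 t) (h1 t)).
Qed.

(** Lipschitz continuity in time, needed for the right-hand side to have primitives. The free flow
    loses two derivatives, which the $H^{s_1}$ bound provides since $s_1\ge 2$. *)
Lemma good_nlhat_lip b : good b -> exists2 C, 0 <= C & forall t t',
  sobB 0 (fun j => nlhat p (rot t (b t)) j - nlhat p (rot t' (b t')) j) (C * (t - t') ^+ 2).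
Proof.
move=> gb; have [B2 hB2] := good_sob2 gb; have [h0 h1 h2] := gb.
have B20 := sumB_ge0 (hB2 0).
have L0 : 0 <= Lb.
  have := sumB_ge0 (h2 1 0); rewrite subr0 expr1n mul1r//.
exists (Lam * (2 * (Lb + B2))).
  by rewrite mulr_ge0 ?sqr_ge0// mulr_ge0// addr_ge0.
move=> t t'.
have := nlhat_lip p (good_rot t gb) (good_rot t' gb) (good_l1 t gb) (good_l1 t' gb)
  (rot_lip t t' (h2 t t') (hB2 t')).
move/sobB_le; apply; rewrite mulrACA; nra.
Qed.

Lemma rhs_ccontinuous b j : good b -> ccontinuous (fun t => rhs b t j).
Proof.
move=> gb; have [C C0 hC] := good_nlhat_lip gb.
apply: ccontinuousM; first by apply: ccontinuousM; [exact: ccontinuous_cst|exact: ccontinuous_cis].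
apply: (@lipschitz_ccontinuous _ _ C) => t t'.
exact: sobB_single (hC t t').
Qed.

(** This replaces the bound on the Duhamel integral: the increment of a curve is controlled in any
    weighted norm by its derivative. *)
Lemma step_mv b b' s t t' (B : R) : step b b' -> 0 <= t -> t <= t' -> t' <= T ->
  (forall x, t < x < t' -> sobB s (rhs b x) B) ->
  sobB s (fun j => b' t' j - b' t j) ((t' - t) ^+ 2 * B).
Proof.
move=> [_ _ bc bd] t0 tt' t'T hB K uK.
apply: (@vector_mean_value _ _ _ _ (fun j => b' ^~ j) (fun j x => rhs b x j)) => //.
- by move=> j; exact: fweight_ge0.
- by move=> j; apply: ccontinuousW; exact: bc.
- by move=> j x /andP[tx xt']; apply: bd; rewrite (le_lt_trans t0)//= (lt_le_trans xt').
- by move=> x xt; exact: hB.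
Qed.

Lemma step_sob b b' s t (Q B : R) : step b b' -> 0 <= t <= T -> sobB s u0 Q ->
  (forall x, 0 < x < t -> sobB s (rhs b x) B) ->
  sobB s (b' t) (2 * (Q + t ^+ 2 * B)).
Proof.
move=> st /andP[t0 tT] uQ hB.
have := step_mv st (lexx 0) t0 tT hB; rewrite subr0.
move=> /(sobBD uQ); congr (sobB _ _ _).
by case: st => -> _ _ _; apply/funext => j; rewrite addrC subrK.
Qed.

Lemma good_rhs0 b t : good b -> sobB 0 (rhs b t) Lb.
Proof.
move=> gb; apply: rhs_sob.
exact: (nlhat_sob p (lexx 0) (good_rot t gb) (good_l1 t gb) (good_rot t gb)).
Qed.

Lemma good_rhs1 b t : good b ->
  sobB s1 (rhs b t) ((8 * 4 `^ s1) ^+ (2 * p) * A ^+ (4 * p) * (4 * q1)).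
Proof.
move=> gb; apply: rhs_sob; have s10 : 0 <= s1 by have := s1_ge2; lra.
apply: (nlhat_sob p s10 (good_rot t gb) (good_l1 t gb)).
by apply: rot_sob; case: gb.
Qed.

Lemma sqr_le_T t : 0 <= t <= T -> t ^+ 2 <= T ^+ 2.
Proof. by move=> /andP[t0 tT]; rewrite ler_sqr ?nnegrE// ltW. Qed.

Lemma step_good b b' : good b -> step b b' -> good b'.
Proof.
move=> gb st; have [_ cl _ _] := st.
have fit (X q t : R) : 0 <= X -> 0 <= q -> T ^+ 2 * X <= 4^-1 -> 0 <= t <= T ->
    2 * (q + t ^+ 2 * (X * (4 * q))) <= 4 * q.
  move=> X0 qq0 TX tT; have := ler_wpM2r X0 (sqr_le_T tT) => h.
  have := ler_wpM2r qq0 (le_trans h TX); lra.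
have X0 : 0 <= (8 * 4 `^ 0) ^+ (2 * p) * A ^+ (4 * p).
  have A0 : 0 <= A by exact: sumB_ge0 (good_l1 0 gb).
  by rewrite mulr_ge0 ?exprn_ge0 ?mulr_ge0 ?powR_ge0.
have X1 : 0 <= (8 * 4 `^ s1) ^+ (2 * p) * A ^+ (4 * p).
  have A0 : 0 <= A by exact: sumB_ge0 (good_l1 0 gb).
  by rewrite mulr_ge0 ?exprn_ge0 ?mulr_ge0 ?powR_ge0.
split.
- move=> t; rewrite cl; apply: sobB_le (step_sob st (clamp_itv t) u0q0 _) _.
    by move=> x _; exact: good_rhs0.
  by apply: fit => //; [exact: q0_ge0|exact: clamp_itv].
- move=> t; rewrite cl; apply: sobB_le (step_sob st (clamp_itv t) u0q1 _) _.
    by move=> x _; exact: good_rhs1.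
  by apply: fit => //; [exact: q1_ge0|exact: clamp_itv].
- move=> t t'; rewrite (cl t) (cl t').
  have L0 : 0 <= Lb by rewrite mulr_ge0// mulr_ge0// q0_ge0.
  have h (x y : R) : 0 <= x -> x <= y -> y <= T ->
      sobB 0 (fun j => b' y j - b' x j) ((y - x) ^+ 2 * Lb).
    by move=> x0 xy yT; apply: step_mv st x0 xy yT _ => z _; exact: good_rhs0.
  have /andP[c0 cT] := clamp_itv t; have /andP[c0' cT'] := clamp_itv t'.
  apply: (@sobB_le _ _ _ _ ((clamp t - clamp t') ^+ 2 * Lb)); last first.
    by rewrite ler_wpM2r// clamp_lip.
  have [le|/ltW le] := leP (clamp t') (clamp t); first exact: h.
  rewrite -(sqrrN (clamp t - _)) opprB.
  by apply: sobB_sqc (h _ _ c0 le cT') _ => j; rewrite sqcB.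
Qed.

Lemma step_exists b : good b -> exists b', step b b'.
Proof.
move=> gb.
have /choice[G hG] : forall j, exists G : R -> R[i], G 0 = 0 /\
    forall x, 0 <= x <= T -> cderive G (rhs b x j) x.
  by move=> j; apply: cprimitive_exists => //; exact: rhs_ccontinuous.
pose b' t : coefs := fun j => u0 j + G j (clamp t).
have clK t : clamp (clamp t) = clamp t by rewrite clamp_id// clamp_itv.
have cc : continuous clamp.
  suff [] : ccontinuous (fun t => (clamp t)%:C%C) by [].
  apply: (@lipschitz_ccontinuous _ _ 1) => x y.
  by rewrite -rmorphB sqcR mul1r clamp_lip.
exists b'; split.
- apply/funext => j; rewrite /b' clamp_id ?lexx ?(ltW T_gt0)//.
  by case: (hG j) => -> _; rewrite addr0.
- by move=> t; rewrite /b' clK.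
- move=> j; have [_ dG] := hG j.
  have Gc1 x : {for x, continuous (fun t => Re (G j (clamp t)))}.
    apply: (@continuous_comp _ _ _ clamp (fun y => Re (G j y))); first exact: cc.
    by case: (dG _ (clamp_itv x)) => d1 _; exact: is_derive_continuous d1.
  have Gc2 x : {for x, continuous (fun t => Im (G j (clamp t)))}.
    apply: (@continuous_comp _ _ _ clamp (fun y => Im (G j y))); first exact: cc.
    by case: (dG _ (clamp_itv x)) => _ d2; exact: is_derive_continuous d2.
  split.
    rewrite (_ : (fun y => _) = fun t => Re (u0 j) + Re (G j (clamp t))).
      by move=> x; apply: cvgD; [exact: cvg_cst|exact: Gc1].
    by apply/funext => x; rewrite /b' ReD.
  rewrite (_ : (fun y => _) = fun t => Im (u0 j) + Im (G j (clamp t))).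
    by move=> x; apply: cvgD; [exact: cvg_cst|exact: Gc2].
  by apply/funext => x; rewrite /b' ImD.
- move=> j t tT; have [_ dG] := hG j; have [t0 t1] := andP tT.
  have [d1 d2] := dG t ltac:(by rewrite !ltW).
  have nr : \forall x \near t, clamp x = x.
    near=> x; apply: clamp_id; apply/andP; split; apply: ltW; near: x.
      exact: lt_nbhsr.
    exact: lt_nbhsl.
  have key (h : R -> R) (c l : R) : is_derive t (1 : R) h l ->
      is_derive t (1 : R) (fun x => c + h (clamp x)) l.
    move=> dh; have dc : is_derive t (1 : R) (fun x => c + h x) l.
      by rewrite -[l]add0r; apply: is_deriveD.
    by apply: near_eq_is_derive dc; apply: filterS nr => x ->.
  split.
    have := key (fun x => Re (G j x)) (Re (u0 j)) _ d1.
    by congr is_derive; apply/funext => x; rewrite /b' ReD.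
  have := key (fun x => Im (G j x)) (Im (u0 j)) _ d2.
  by congr is_derive; apply/funext => x; rewrite /b' ImD.
Unshelve. all: by end_near. Qed.

(** The bounds are on squared norms, so the factor $1/4$ means that distances are halved; it is
    $T^2$ times the squared Lipschitz constant. *)
Lemma step_contract b1 b1' b2 b2' (D : R) : good b1 -> good b2 -> step b1 b1' -> step b2 b2' ->
  (forall t, sobB 0 (fun j => b1 t j - b2 t j) D) ->
  forall t, sobB 0 (fun j => b1' t j - b2' t j) (4^-1 * D).
Proof.
move=> g1 g2 [i1 cl1 bc1 bd1] [i2 cl2 bc2 bd2] hD t; rewrite cl1 cl2.
move: (clamp t) (clamp_itv t) => {}t /andP[t0 tT].
have D0 : 0 <= D := sumB_ge0 (hD 0).
have h : sobB 0 (fun j => b1' t j - b2' t j - (b1' 0 j - b2' 0 j)) ((t - 0) ^+ 2 * (Lam * D)).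
  move=> K uK.
  apply: (@vector_mean_value _ _ _ (fweight 0) (fun j x => b1' x j - b2' x j)
     (fun j x => rhs b1 x j - rhs b2 x j)) => //.
  - by move=> j; exact: fweight_ge0.
  - move=> j; apply: ccontinuousW; have [c1 c1'] := bc1 j; have [c2 c2'] := bc2 j; split.
      rewrite (_ : (fun y => _) = fun x => Re (b1' x j) - Re (b2' x j)).
        by move=> x; apply: cvgB; [exact: c1|exact: c2].
      by apply/funext => x; rewrite ReB.
    rewrite (_ : (fun y => _) = fun x => Im (b1' x j) - Im (b2' x j)).
      by move=> x; apply: cvgB; [exact: c1'|exact: c2'].
    by apply/funext => x; rewrite ImB.
  - move=> j x /andP[x0 xt].
    have xT : 0 < x < T by rewrite x0 (lt_le_trans xt).
    have [d1 e1] := bd1 j x xT; have [d2 e2] := bd2 j x xT.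
    split.
      rewrite (_ : (fun y => _) = fun x => Re (b1' x j) - Re (b2' x j)).
        by rewrite ReB; exact: is_deriveB.
      by apply/funext => y; rewrite ReB.
    rewrite (_ : (fun y => _) = fun x => Im (b1' x j) - Im (b2' x j)).
      by rewrite ImB; exact: is_deriveB.
    by apply/funext => y; rewrite ImB.
  - move=> x _.
    have rD : sobB 0 (fun j => rot x (b1 x) j - rot x (b2 x) j) D.
      by apply: sobB_sqc (hD x) _ => j; rewrite /rot -mulrBr sqcM sqc_cis mul1r.
    have := nlhat_lip p (good_rot x g1) (good_rot x g2) (good_l1 x g1) (good_l1 x g2) rD.
    move=> /sobB_sqc; apply=> // j.
    by rewrite /rhs -mulrBr !sqcM sg1 sqc_cis !mul1r.
have := h; rewrite subr0 => {}h.
apply: (@sobB_le _ _ _ _ (t ^+ 2 * (Lam * D))).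
  apply: sobB_sqc h _ => j; rewrite i1 i2 subrr subr0//.
have tT2 := @sqr_le_T t ltac:(by rewrite t0 tT).
by rewrite mulrA ler_wpM2r// (le_trans _ KL)// ler_wpM2r// sqr_ge0.
Qed.

Lemma good_const : good (fun=> u0).
Proof.
have h0 : sobB 0 u0 (4 * q0) by apply: sobB_le u0q0 _; have := q0_ge0; lra.
have h1 : sobB s1 u0 (4 * q1) by apply: sobB_le u0q1 _; have := q1_ge0; lra.
split => //.
move=> t t'; have L0 : 0 <= (t - t') ^+ 2 * Lb.
    have q00 := q0_ge0; have A0 : 0 <= A := sumB_ge0 (l1A h0 h1).
    by apply: mulr_ge0; rewrite ?sqr_ge0// mulr_ge0 ?mulr_ge0// exprn_ge0// mulr_ge0 ?powR_ge0.
  apply: sobB_le L0; apply/sobB0 => K _.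
  by rewrite big1// => j _; rewrite subrr sqc0.
Qed.

Lemma iterates_exist : exists b_ : nat -> R -> coefs,
  [/\ b_ 0%N = fun=> u0, forall n, good (b_ n) & forall n, step (b_ n) (b_ n.+1)].
Proof.
have /choice[F hF] : forall b, exists b', good b -> step b b'.
  (* For a curve that is not [good] nothing is required, and the curve itself is taken as a default
     value. *)
  move=> b; have [gb|ngb] := pselect (good b); last by exists b.
  by have [b' sb] := step_exists gb; exists b'.
exists (fun n => iter n F (fun=> u0)).
have gn n : good (iter n F (fun=> u0)).
  elim: n => [|n ih]; first exact: good_const.
  by apply: (step_good ih); exact: hF ih.
by split => // n; exact: hF (gn n).
Qed.

Lemma iterates_increment (b_ : nat -> R -> coefs) : (forall n, good (b_ n)) -> (forall n, step (b_ n) (b_ n.+1)) ->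
  forall n t, sobB 0 (fun j => b_ n.+1 t j - b_ n t j) (16 * q0 * (4^-1) ^+ n).
Proof.
move=> gb sb; elim=> [|n ih] t.
  have [h1 _ _] := gb 1%N; have [h0 _ _] := gb 0%N.
  (* The constant 16 is $2(4+4)$, from two curves in the ball of squared radius [4 * q0]. *)
  by apply: sobB_le (sobBB (h1 t) (h0 t)) _; rewrite expr0; lra.
apply: sobB_le (step_contract (gb _) (gb _) (sb _) (sb _) ih t) _.
by rewrite exprS mulrCA.
Qed.

Lemma iterates_cvg (b_ : nat -> R -> coefs) : (forall n, good (b_ n)) -> (forall n, step (b_ n) (b_ n.+1)) ->
  exists b : R -> coefs, forall t j, Re (b_ n t j) @[n --> \oo] --> Re (b t j) /\
    Im (b_ n t j) @[n --> \oo] --> Im (b t j).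
Proof.
move=> gb sb; have inc := iterates_increment gb sb.
have q00 := q0_ge0.
pose v n := Num.sqrt (16 * q0) * (2^-1) ^+ n : R.
have hv n t j : normc (b_ n.+1 t j - b_ n t j) <= v n.
  have v0 : 0 <= v n by rewrite mulr_ge0 ?sqrtr_ge0 ?exprn_ge0// invr_ge0.
  rewrite -(ler_pXn2r (ltn0Sn 1)) ?nnegrE ?normc_ge0// sqr_normcE.
  apply: le_trans (sobB_single j (inc n t)) _.
  rewrite /v exprMn sqr_sqrtr ?mulr_ge0// exprAC ler_wpM2l ?mulr_ge0//.
  by rewrite (_ : 2^-1 ^+ 2 = 4^-1 :> R)//; lra.
have sv n : \sum_(k < n) v k <= Num.sqrt (16 * q0) * 2.
  rewrite -mulr_sumr ler_wpM2l ?sqrtr_ge0//.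
  suff -> : \sum_(k < n) (2^-1 : R) ^+ k = 2 - 2 * 2^-1 ^+ n.
    by rewrite gerBl mulr_ge0// exprn_ge0// invr_ge0.
  by elim: n => [|n ih]; rewrite ?big_ord0 ?big_ord_recr ?ih/= ?exprS; lra.
have cRe t j : cvgn (fun n => Re (b_ n t j)).
  apply: (@cvg_summable_increments _ _ v) sv => n.
  by rewrite -ReB (le_trans (Re_le_normc _)).
have cIm t j : cvgn (fun n => Im (b_ n t j)).
  apply: (@cvg_summable_increments _ _ v) sv => n.
  by rewrite -ImB (le_trans (Im_le_normc _)).
exists (fun t j => (limn (fun n => Re (b_ n t j)) +i* limn (fun n => Im (b_ n t j)))%C).
by move=> t j; split; [exact: cRe|exact: cIm].
Qed.

Lemma good_lim (b_ : nat -> R -> coefs) b : (forall n, good (b_ n)) ->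
  (forall t j, Re (b_ n t j) @[n --> \oo] --> Re (b t j) /\
    Im (b_ n t j) @[n --> \oo] --> Im (b t j)) -> good b.
Proof.
move=> gb hb; split.
- by move=> t; apply: sobB_lim (hb t) => n; case: (gb n).
- by move=> t; apply: sobB_lim (hb t) => n; case: (gb n).
- move=> t t'; apply: (@sobB_lim _ _ _ (fun n j => b_ n t j - b_ n t' j)).
    by move=> n; case: (gb n).
  move=> j; have [h1 h2] := hb t j; have [h3 h4] := hb t' j.
  split.
    under eq_fun do rewrite ReB.
    by rewrite ReB; exact: cvgB.
  under eq_fun do rewrite ImB.
  by rewrite ImB; exact: cvgB.
Qed.

(** No limit is taken under the derivative: the step [b'] of the limit curve is constructed, and the
    contraction shows that it is also the limit of the iterates, hence equal to [b]. *)
Lemma step_lim (b_ : nat -> R -> coefs) b : (forall n, good (b_ n)) -> (forall n, step (b_ n) (b_ n.+1)) ->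
  (forall t j, Re (b_ n t j) @[n --> \oo] --> Re (b t j) /\
    Im (b_ n t j) @[n --> \oo] --> Im (b t j)) -> step b b.
Proof.
move=> gb sb hb; have gg := good_lim gb hb.
have q00 := q0_ge0.
(* The constant 64 is stable under the induction, since $2(64/4+16)=64$. *)
have tail n t : sobB 0 (fun j => b t j - b_ n t j) (64 * q0 * (4^-1) ^+ n).
  apply: (@sobB_lim _ _ _ (fun k j => b_ (k + n)%N t j - b_ n t j)); last first.
    move=> j; have [h1 h2] := hb t j; split.
      under eq_fun do rewrite ReB.
      rewrite ReB; apply: cvgB; last exact: cvg_cst.
      by rewrite (cvg_shiftn n (fun k => Re (b_ k t j))).
    under eq_fun do rewrite ImB.
    rewrite ImB; apply: cvgB; last exact: cvg_cst.
    by rewrite (cvg_shiftn n (fun k => Im (b_ k t j))).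
  move=> k; elim: k n => [|k ih] n.
    apply/sobB0 => K _; rewrite big1 ?mulr_ge0 ?exprn_ge0 ?invr_ge0// => j _.
    by rewrite add0n subrr sqc0.
  apply: sobB_le (_ : 2 * (64 * q0 * 4^-1 ^+ n.+1 + 16 * q0 * 4^-1 ^+ n) <= _); last first.
    by rewrite exprS; have := exprn_ge0 n (ltac:(lra) : 0 <= 4^-1 :> R); nra.
  apply: sobB_sqc (sobBD (ih n.+1) (iterates_increment gb sb n t)) _ => j.
  by rewrite addSnnS addrA subrK.
have [b' sb'] := step_exists gg; suff e : b = b' by rewrite -e in sb'.
apply/funext => t; apply/funext => j; apply/subr0_eq.
suff /sobB_eq0/(congr1 (fun f => f j)) : sobB 0 (fun j => b t j - b' t j) (0 : R) by [].
move=> K uK; apply: (@le_geometric_bound _ _ (64 * q0)) => n; rewrite add0r.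
have h1 := step_contract gg (gb n) sb' (sb n) (tail n) t.
have := sobBB (tail n.+1 t) h1 uK; rewrite exprS.
set X := \sum_(_ <- _) _; set Y := \sum_(_ <- _) _ => hX.
suff -> : Y = X by move: hX; lra.
by apply: eq_bigr => k _; congr (_ * sqc _); ring.
Qed.

(* The free parameter [rho] of the interpolation of [H^(s-1)] between [H^s1] and
   [H^s] is taken proportional to [t]: the [H^s] part of the nonlinear term is
   then absorbed, and no Gronwall argument is needed. *)
Lemma iterates_sob (b_ : nat -> R -> coefs) (A1 s Q t : R) :
  (forall a : coefs, sobB 0 a (4 * q0) -> sobB s1 a (4 * q1) -> l1gradB a A1) ->
  0 < A -> 0 < A1 -> T ^+ 2 * (A ^+ (4 * p) * 32 ^+ (2 * p)) <= 8^-1 ->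
  s1 + 1 <= s -> sobB s u0 Q -> 0 < t <= T ->
  b_ 0%N = (fun=> u0) -> (forall n, good (b_ n)) -> (forall n, step (b_ n) (b_ n.+1)) ->
  forall n x, 0 <= x <= t -> sobB s (b_ n x)
    (4 * Q + 2 * ((4 * t * A ^+ (2 * p) * (64 * 16 `^ s) ^+ p * (A1 / A)) `^ (s - s1)) ^+ 2 * q1).
Proof.
move=> gA A0 A10 KT ss1 uQ /andP[t0 tT] b0 gb sb.
(* The factor 4 makes $\rho^2=16\,t^2A^{4p}(64\cdot 16^s)^{2p}(A_1/A)^2$, so that the term
   $2\rho^{-2}Y$ of the interpolation contributes exactly $Y/8$ after multiplication by $t^2$ and
   the coefficient of the lower-order term. *)
set rho := 4 * t * _ * _ * _; set Y := 4 * Q + _.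
have Z0 : 0 < (64 * 16 `^ s) ^+ p :> R by rewrite exprn_gt0// mulr_gt0// powR_gt0.
have AA : 0 < A1 / A by rewrite divr_gt0.
have rho0 : 0 < rho by rewrite /rho (mulr_gt0 _ AA)// (mulr_gt0 _ Z0)// mulr_gt0 ?exprn_gt0// mulr_gt0.
have Q0 := sumB_ge0 uQ; have q10 := q1_ge0.
have QY : Q <= Y.
  have : 0 <= 2 * (rho `^ (s - s1)) ^+ 2 * q1 by rewrite mulr_ge0// mulr_ge0// sqr_ge0.
  by rewrite /Y; lra.
have Y0 : 0 <= Y := le_trans Q0 QY.
elim=> [|n ih] x xt; first by rewrite b0; apply: sobB_le uQ QY.
have [x0 xt'] := andP xt.
have xT : 0 <= x <= T by rewrite x0 (le_trans xt').
have s1s : 1 <= s by have := s1_ge2; lra.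
apply: sobB_le (step_sob (sb n) xT uQ (B := A ^+ (4 * p) * (32 ^+ (2 * p) * Y +
   (64 * 16 `^ s) ^+ (2 * p) * (A1 / A) ^+ 2 * (2 * (rho `^ (s - 1 - s1)) ^+ 2 * (4 * q1) +
     2 * (rho `^ (s - 1 - s)) ^+ 2 * Y))) _) _.
  move=> y /andP[y0 yx]; apply: rhs_sob.
  have [h0 h1 _] := gb n.
  have hs : sobB s (b_ n y) Y by apply: ih; rewrite (ltW y0) (le_trans (ltW yx)).
  apply: nlhat_tame => //; [exact: good_rot|exact: good_l1| | |].
  - by apply: gA; apply: rot_sob.
  - exact: rot_sob.
  - apply: rot_sob; apply: sobB_interp => //; move: s1_ge2; lra.
have e1 : rho `^ (s - s1) = rho `^ (s - 1 - s1) * rho.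
  by rewrite -{3}(powRr1 (ltW rho0)) -powRD ?(gt_eqF rho0) ?implybT//; congr (_ `^ _); ring.
have e2 : rho `^ (s - 1 - s) = rho^-1.
  by rewrite (_ : s - 1 - s = - 1) ?powR_inv1 ?ltW//; ring.
have eX : (64 * 16 `^ s) ^+ (2 * p) = ((64 * 16 `^ s) ^+ p) ^+ 2 :> R by rewrite mulnC exprM.
have eA : A ^+ (4 * p) = (A ^+ (2 * p)) ^+ 2 by rewrite -exprM; congr (_ ^+ _); ring.
have eR : rho ^+ 2 = 16 * t ^+ 2 * (A ^+ (4 * p) * ((64 * 16 `^ s) ^+ (2 * p) * (A1 / A) ^+ 2)).
  by rewrite eA eX /rho; ring.
have xt2 : x ^+ 2 <= t ^+ 2 by rewrite ler_sqr ?nnegrE// ltW.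
have tT2 : t ^+ 2 <= T ^+ 2 by apply: sqr_le_T; rewrite ltW.
move: (A ^+ (4 * p)) (exprn_ge0 (4 * p) (ltW A0)) KT eR => A4 A40 KT eR.
rewrite e2; have eY : Y = 4 * Q + 2 * rho `^ (s - s1) ^+ 2 * q1 by [].
clearbody Y; move: eY e1; move: (rho `^ (s - s1)) (rho `^ (s - 1 - s1)) => r1 r2 eY e1.
set V := _ * (A1 / A) ^+ 2 in eR *.
have V0 : 0 <= V by rewrite /V mulr_ge0 ?sqr_ge0// eX sqr_ge0.
have L0 : 0 <= 32 ^+ (2 * p) :> R by rewrite exprn_ge0.
move: (32 ^+ (2 * p)) L0 KT => L L0 KT.
set W := A4 * (_ + _).
have W0 : 0 <= W.
  apply: mulr_ge0 => //; apply: addr_ge0; first exact: mulr_ge0.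
  apply: mulr_ge0 => //; apply: addr_ge0; apply: mulr_ge0 => //.
  - by rewrite mulr_ge0// sqr_ge0.
  - by rewrite mulr_ge0.
  - by rewrite mulr_ge0// sqr_ge0.
apply: (@le_trans _ _ (2 * (Q + t ^+ 2 * W))).
  by rewrite ler_pM2l// lerD2l ler_wpM2r.
have h1 : t ^+ 2 * (A4 * L) <= 8^-1.
  by apply: le_trans KT; rewrite ler_wpM2r// mulr_ge0.
have -> : t ^+ 2 * W = t ^+ 2 * (A4 * L) * Y +
    (16 * t ^+ 2 * (A4 * V)) / 16 * (8 * r2 ^+ 2 * q1 + 2 * rho^-1 ^+ 2 * Y).
  by rewrite /W; field; rewrite gt_eqF.
rewrite -eR.
have -> : rho ^+ 2 / 16 * (8 * r2 ^+ 2 * q1 + 2 * rho^-1 ^+ 2 * Y) =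
   2^-1 * (r2 * rho) ^+ 2 * q1 + 8^-1 * Y.
  by field; rewrite gt_eqF.
rewrite -e1.
(* With both multiples of $Y$ at most $Y/8$, the total is at most $2Q+Y/2+$ [r1 ^+ 2 * q1], which
   equals $Y$ by its definition. *)
have := ler_wpM2r Y0 h1; move: eY; lra.
Qed.

(** The final time [t], and with it the interpolation parameter, stays fixed through the induction
    on the iterates; the bound is then evaluated at [t] itself and passed to the limit. *)
Lemma limit_sob (b_ : nat -> R -> coefs) b (A1 s Q t : R) :
  (forall a : coefs, sobB 0 a (4 * q0) -> sobB s1 a (4 * q1) -> l1gradB a A1) ->
  0 < A -> 0 < A1 -> T ^+ 2 * (A ^+ (4 * p) * 32 ^+ (2 * p)) <= 8^-1 ->
  s1 + 1 <= s -> sobB s u0 Q -> 0 <= t <= T ->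
  b_ 0%N = (fun=> u0) -> (forall n, good (b_ n)) -> (forall n, step (b_ n) (b_ n.+1)) ->
  (forall t j, Re (b_ n t j) @[n --> \oo] --> Re (b t j) /\
    Im (b_ n t j) @[n --> \oo] --> Im (b t j)) ->
  sobB s (b t)
    (4 * Q + 2 * ((4 * t * A ^+ (2 * p) * (64 * 16 `^ s) ^+ p * (A1 / A)) `^ (s - s1)) ^+ 2 * q1).
Proof.
move=> gA A0 A10 KT ss1 uQ /andP[t0 tT] b0 gb sb hb.
(* At $t=0$ the interpolation parameter would vanish; there the curve equals the datum. *)
have [t_eq0|t_neq0] := eqVneq t 0.
  rewrite {1}t_eq0; have [-> _ _ _] := step_lim gb sb hb.
  have Q0 := sumB_ge0 uQ; have q10 := q1_ge0; apply: (sobB_le uQ).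
  set r := _ `^ _; have : 0 <= 2 * r ^+ 2 * q1 by rewrite mulr_ge0// mulr_ge0// sqr_ge0.
  lra.
have t1 : 0 < t <= T by rewrite lt_neqAle eq_sym t_neq0 t0.
apply: sobB_lim (hb t) => n.
by apply: (iterates_sob gA A0 A10 KT ss1 uQ t1 b0 gb sb); rewrite t0 lexx.
Qed.

End Picard.

(** * Sobolev norms of functions and of coefficients *)

Section SobolevNorm.
Context {R : realType} {d : nat}.
Local Notation fn := (@freq_norm R d).
Local Notation P := ((2 * pi : R) ^+ d).
Local Notation fhat := (@fourier_coef R d).
Implicit Types (f g : torus_fun R d) (a : d.-tuple int -> R[i]) (j : d.-tuple int).

Lemma sqrt_laplacian_sqc s f g j : is_sqrt_laplacian s f g ->
  sqc (fhat g j) = fweight s j * sqc (fhat f j).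
Proof. by move=> [_ ->]; rewrite sqcM sqcR. Qed.

Lemma sqrt_laplacian_sobB s f g : is_sqrt_laplacian s f g -> sobB s (fhat f) (P^-1 * n2 g).
Proof.
move=> h; have [Ig _] := h; apply: sumB_le (bessel Ig) _ (lexx _) => j.
by rewrite (sqrt_laplacian_sqc _ h).
Qed.

Lemma sqrt_laplacian_n2_le s f g B : is_sqrt_laplacian s f g -> sobB s (fhat f) B ->
  n2 g <= P * B.
Proof.
move=> h fB; have [Ig _] := h; apply: parseval_le => //.
by apply: sumB_le fB _ (lexx _) => j; rewrite (sqrt_laplacian_sqc _ h).
Qed.

Lemma sqrt_laplacian_exists s f B : sobB s (fhat f) B -> exists g, is_sqrt_laplacian s f g.
Proof.
move=> fB; pose a j := (fn j `^ s)%:C%C * fhat f j.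
have /synthP[Ig eg] : sobB 0 a B.
  by apply/sobB0; apply: sumB_le fB _ (lexx _) => j; rewrite /a sqcM sqcR.
by exists (synth a); split => // j; rewrite eg.
Qed.

Lemma HnormE s f g : inL2 f -> is_sqrt_laplacian s f g ->
  Hnorm s f = (Num.sqrt (n2 f) + Num.sqrt (n2 g))%:E.
Proof.
move=> If fg; have [Ig eg] := fg.
rewrite /Hnorm L2normE// EFinD; congr (_ + _)%E.
apply/eqP; rewrite eq_le; apply/andP; split.
  by apply: ereal_inf_lbound; exists g => //; rewrite L2normE.
apply/ereal_infP => _ [g' [Ig' eg'] <-]; rewrite L2normE//.
rewrite (@eq_n2_ae _ _ g g')//.
by apply: fourier_coef_inj; rewrite ?eg; [exact: Cint_L2|exact: Cint_L2|move=> j; rewrite eg eg'].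
Qed.

Lemma inH_sqrt_laplacian s f : inH s f -> exists g, is_sqrt_laplacian s f g.
Proof.
move=> [If]; rewrite /Hnorm L2normE// => h.
apply: contrapT => nex.
suff e : [set L2norm g | g in is_sqrt_laplacian s f] = set0.
  by move: h; rewrite e ereal_inf0.
by rewrite -subset0 => y [g fg yE]; apply: nex; exists g.
Qed.

Lemma inH_sobB s f : inH s f -> exists B, sobB s (fhat f) B.
Proof.
by move=> /inH_sqrt_laplacian[g fg]; exists (P^-1 * n2 g); exact: sqrt_laplacian_sobB.
Qed.

Lemma inH_sob0 s f : inH s f -> sobB 0 (fhat f) (P^-1 * n2 f).
Proof. by move=> [If _]; apply/sobB0; exact: bessel. Qed.

Lemma sobB_inH s f B : inL2 f -> sobB s (fhat f) B -> inH s f.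
Proof.
move=> If fB; split => //; have [g fg] := sqrt_laplacian_exists fB.
by rewrite (HnormE If fg) ltry.
Qed.

Lemma Hnorm_le s f B0 B : inL2 f -> sobB 0 (fhat f) B0 -> sobB s (fhat f) B ->
  (Hnorm s f <= (Num.sqrt (P * B0) + Num.sqrt (P * B))%:E)%E.
Proof.
move=> If fB0 fB; have [g fg] := sqrt_laplacian_exists fB.
rewrite (HnormE If fg) lee_fin lerD// ler_wsqrtr//.
  by apply: parseval_le => //; apply/sobB0.
exact: sqrt_laplacian_n2_le fg fB.
Qed.

Lemma Hnorm_ge0 s f : (0 <= Hnorm s f)%E.
Proof.
apply: adde_ge0; first exact: Lnorm_ge0.
by apply/ereal_infP => _ [g _ <-]; exact: Lnorm_ge0.
Qed.

Lemma sobB_of_Hnorm s f (e : R) : inL2 f -> (Hnorm s f <= e%:E)%E ->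
  sobB 0 (fhat f) (P^-1 * e ^+ 2) /\ sobB s (fhat f) (P^-1 * e ^+ 2).
Proof.
move=> If he.
have iH : inH s f by split => //; apply: le_lt_trans he _; rewrite ltry.
have [g fg] := inH_sqrt_laplacian iH.
move: he; rewrite (HnormE If fg) lee_fin => he.
have Pi0 : 0 <= P^-1 by rewrite invr_ge0 ltW// P_gt0.
have h x y : 0 <= x -> Num.sqrt x + Num.sqrt y <= e -> P^-1 * x <= P^-1 * e ^+ 2.
  move=> x0 xe; have sx := sqrtr_ge0 x; have sy := sqrtr_ge0 y.
  by apply: ler_wpM2l => //; rewrite -[x]sqr_sqrtr// ler_sqr ?nnegrE; lra.
split; first by apply: sobB_le (inH_sob0 iH) _; apply: h he; exact: n2_ge0.
apply: sobB_le (sqrt_laplacian_sobB fg) _.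
by apply: (h _ (n2 f)); [exact: n2_ge0|rewrite addrC].
Qed.

Lemma Hnorm_cvg0 s (F : set_system R) (FF : Filter F) (v : R -> torus_fun R d) :
  (forall e, 0 < e -> \forall t \near F,
     [/\ inL2 (v t), sobB 0 (fhat (v t)) e & sobB s (fhat (v t)) e]) ->
  Hnorm s (v t) @[t --> F] --> 0%E.
Proof.
move=> h; have P0 := P_gt0 (R := R) (d := d).
have key (e : R) : 0 < e -> \forall t \near F, (Hnorm s (v t) <= e%:E)%E.
  move=> e0; have e'0 : 0 < P^-1 * (e / 2) ^+ 2.
    by rewrite mulr_gt0 ?invr_gt0// exprn_gt0// divr_gt0.
  apply: filterS (h _ e'0) => t [If f0 fs].
  apply: le_trans (Hnorm_le If f0 fs) _.
  rewrite mulrA divff ?gt_eqF// mul1r sqrtr_sqr ger0_norm ?divr_ge0 ?(ltW e0)//.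
  by rewrite lee_fin; lra.
apply/fine_cvgP; split.
  apply: filterS (key 1 ltr01) => t ht.
  by rewrite ge0_fin_numE ?Hnorm_ge0// (le_lt_trans ht)// ltry.
apply/cvgrPdist_le => /= e e0.
apply: filterS (key e e0) => t ht /=.
rewrite sub0r normrN ger0_norm ?fine_ge0 ?Hnorm_ge0//.
by rewrite -lee_fin fineK// ge0_fin_numE ?Hnorm_ge0// (le_lt_trans ht)// ltry.
Qed.

Lemma Hnorm_cvg0_sob s (F : set_system R) (FF : Filter F) (v : R -> torus_fun R d) (e : R) :
  (\forall t \near F, inL2 (v t)) ->
  Hnorm s (v t) @[t --> F] --> 0%E -> 0 < e ->
  \forall t \near F, sobB 0 (fhat (v t)) e /\ sobB s (fhat (v t)) e.
Proof.
move=> Iv h e0; have P0 := P_gt0 (R := R) (d := d).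
have r0 : 0 < Num.sqrt (P * e) by rewrite sqrtr_gt0 mulr_gt0.
have /h hF := @nbhs_open_ereal_lt R 0 (fun=> Num.sqrt (P * e)) r0.
 near=> t.
have Ivt : inL2 (v t) by near: t.
have : (Hnorm s (v t) <= (Num.sqrt (P * e))%:E)%E by apply: ltW; near: t; exact: hF.
move=> /(sobB_of_Hnorm Ivt).
by rewrite sqr_sqrtr ?mulr_ge0 ?(ltW P0) ?(ltW e0)// mulrA mulVf ?gt_eqF// mul1r.
Unshelve. all: by end_near. Qed.

End SobolevNorm.

(** * Componentwise calculus of complex curves *)

Section ComplexCurves.
Context {R : realType}.
Implicit Types (f g : R -> R[i]).

Lemma cderiveD f g l k x : cderive f l x -> cderive g k x ->
  cderive (fun y => f y + g y) (l + k) x.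
Proof.
move=> [f1 f2] [g1 g2]; split.
  rewrite ReD (_ : (fun y => _) = (fun y => Re (f y)) \+ (fun y => Re (g y))).
    exact: is_deriveD.
  by apply/funext => y; rewrite ReD.
rewrite ImD (_ : (fun y => _) = (fun y => Im (f y)) \+ (fun y => Im (g y))).
  exact: is_deriveD.
by apply/funext => y; rewrite ImD.
Qed.

Lemma cderiveN f l x : cderive f l x -> cderive (fun y => - f y) (- l) x.
Proof.
move=> [f1 f2]; split.
  rewrite ReN (_ : (fun y => _) = fun y => - Re (f y)); first exact: is_deriveN.
  by apply/funext => y; rewrite ReN.
rewrite ImN (_ : (fun y => _) = fun y => - Im (f y)); first exact: is_deriveN.
by apply/funext => y; rewrite ImN.
Qed.

Lemma cderive_scale (z : R[i]) x : cderive (fun y => y%:C%C * z) z x.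
Proof.
split.
  rewrite (_ : (fun y => _) = fun y => Re z * y).
    by apply: is_derive_eq; rewrite [LHS]mulr1.
  by apply/funext => y; rewrite Re_mul/= mul0r subr0 mulrC.
rewrite (_ : (fun y => _) = fun y => Im z * y).
  by apply: is_derive_eq; rewrite [LHS]mulr1.
by apply/funext => y; rewrite Im_mul/= mul0r addr0 mulrC.
Qed.

Lemma cderive_ccontinuous f g : (forall x, cderive f (g x) x) -> ccontinuous f.
Proof.
by move=> h; split => x; have [h1 h2] := h x; [exact: is_derive_continuous h1|exact: is_derive_continuous h2].
Qed.

Lemma ccontinuous_withinD f g a b : ccontinuous_within a b f -> ccontinuous_within a b g ->
  ccontinuous_within a b (fun y => f y + g y).
Proof.
move=> [f1 f2] [g1 g2]; split.
  rewrite (_ : (fun y => _) = fun y => Re (f y) + Re (g y)).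
    by move=> x; apply: cvgD; [exact: f1|exact: g1].
  by apply/funext => y; rewrite ReD.
rewrite (_ : (fun y => _) = fun y => Im (f y) + Im (g y)).
  by move=> x; apply: cvgD; [exact: f2|exact: g2].
by apply/funext => y; rewrite ImD.
Qed.

Lemma ccontinuous_withinN f a b : ccontinuous_within a b f ->
  ccontinuous_within a b (fun y => - f y).
Proof.
move=> [f1 f2]; split.
  rewrite (_ : (fun y => _) = fun y => - Re (f y)).
    by move=> x; apply: cvgN; exact: f1.
  by apply/funext => y; rewrite ReN.
rewrite (_ : (fun y => _) = fun y => - Im (f y)).
  by move=> x; apply: cvgN; exact: f2.
by apply/funext => y; rewrite ImN.
Qed.

Lemma ccontinuous_withinM f g a b : ccontinuous_within a b f -> ccontinuous_within a b g ->
  ccontinuous_within a b (fun y => f y * g y).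
Proof.
move=> [f1 f2] [g1 g2]; split.
  rewrite (_ : (fun y => _) = fun y => Re (f y) * Re (g y) - Im (f y) * Im (g y)).
    by move=> x; apply: cvgB; apply: cvgM; [exact: f1|exact: g1|exact: f2|exact: g2].
  by apply/funext => y; rewrite Re_mul.
rewrite (_ : (fun y => _) = fun y => Re (f y) * Im (g y) + Im (f y) * Re (g y)).
  by move=> x; apply: cvgD; apply: cvgM; [exact: f1|exact: g2|exact: f2|exact: g1].
by apply/funext => y; rewrite Im_mul.
Qed.

End ComplexCurves.

(** * From curves of coefficients to curves in Sobolev spaces *)

Section SobolevContinuity.
Context {R : realType} {d : nat}.
Local Notation fn := (@freq_norm R d).
Local Notation coefs := (d.-tuple int -> R[i]).
Local Notation fhat := (@fourier_coef R d).
Variable T : R.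
Implicit Types (s t : R) (a b c v : R -> coefs) (j : d.-tuple int).

(** Continuity at [t] relative to $[0,T]$, phrased with squared norms and radii so that it combines
    with the calculus of [sobB] bounds; one-sidedness at the endpoints is built in. *)
Definition sobcont s a t : Prop := forall e : R, 0 < e -> exists2 r : R, 0 < r &
  forall t', 0 <= t' <= T -> `|t' - t| < r -> sobB s (fun j => a t' j - a t j) e.

Lemma near_itv_within t (Q : R -> Prop) (r : R) : 0 < r ->
  (forall t', 0 <= t' <= T -> `|t' - t| < r -> Q t') ->
  \forall t' \near within `[0, T] (nbhs t), Q t'.
Proof.
move=> r0 h; rewrite near_withinE; apply/nbhs_normP; exists r => // t' /= tt' t'T.
by apply: h; [move: t'T; rewrite in_itv|rewrite distrC].
Qed.

Lemma near_itv_within_dnbhs t (Q : R -> Prop) (r : R) : 0 < r ->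
  (forall t', 0 <= t' <= T -> t' != t -> `|t' - t| < r -> Q t') ->
  \forall t' \near within `[0, T] (t^'), Q t'.
Proof.
move=> r0 h; rewrite near_withinE /dnbhs near_withinE; apply/nbhs_normP; exists r => // t' /= tt' nt' t'T.
by apply: h; [move: t'T; rewrite in_itv| |rewrite distrC].
Qed.

Lemma within_near_itv t (Q : R -> Prop) :
  (\forall t' \near within `[0, T] (nbhs t), Q t') ->
  exists2 r : R, 0 < r & forall t', 0 <= t' <= T -> `|t' - t| < r -> Q t'.
Proof.
rewrite near_withinE => /nbhs_normP[r /= r0 h]; exists r => // t' t'T tt'.
by apply: h; rewrite /= ?in_itv//= distrC.
Qed.

Lemma within_dnbhs_near_itv t (Q : R -> Prop) :
  (\forall t' \near within `[0, T] (t^'), Q t') ->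
  exists2 r : R, 0 < r & forall t', 0 <= t' <= T -> t' != t -> `|t' - t| < r -> Q t'.
Proof.
rewrite near_withinE /dnbhs near_withinE => /nbhs_normP[r /= r0 h]; exists r => // t' t'T nt' tt'.
by apply: h; rewrite /= ?in_itv//= distrC.
Qed.

Lemma sqr_le_lt_sqrt (x y : R) : `|x| < Num.sqrt y -> x ^+ 2 <= y.
Proof.
move=> h; have y0 : 0 < y by rewrite -sqrtr_gt0; exact: le_lt_trans h.
rewrite -real_normK ?num_real// -[leRHS]sqr_sqrtr ?(ltW y0)//.
by rewrite ler_sqr ?nnegrE ?sqrtr_ge0// ltW.
Qed.

Lemma sobcont_lip s a t (L : R) :
  (forall t', 0 <= t' <= T -> sobB s (fun j => a t' j - a t j) (L * (t' - t) ^+ 2)) ->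
  sobcont s a t.
Proof.
move=> hL e e0; have L1 : 0 < `|L| + 1 by rewrite ltr_wpDl.
exists (Num.sqrt (e / (`|L| + 1))); first by rewrite sqrtr_gt0 divr_gt0.
move=> t' t'T tt'; apply: sobB_le (hL t' t'T) _.
have := sqr_le_lt_sqrt tt'.
rewrite ler_pdivlMr// => h; have := ler_norm L; have := sqr_ge0 (t' - t); nra.
Qed.

Lemma sobcontD s a b t : sobcont s a t -> sobcont s b t ->
  sobcont s (fun t j => a t j + b t j) t.
Proof.
move=> ha hb e e0; have e4 : 0 < e / 4 by rewrite divr_gt0.
have [r1 r10 h1] := ha _ e4; have [r2 r20 h2] := hb _ e4.
exists (Num.min r1 r2); first by rewrite lt_min r10.
move=> t' t'T; rewrite lt_min => /andP[t1 t2].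
apply: sobB_le (sobB_sqc (sobBD (h1 _ t'T t1) (h2 _ t'T t2)) _) (_ : 2 * (e / 4 + e / 4) <= e).
  by move=> j; rewrite (_ : _ - _ = (a t' j - a t j) + (b t' j - b t j)) //; ring.
 by rewrite -mulrDl; lra.
Qed.

Lemma sobcontZ s a t z : sqc z = 1 -> sobcont s a t -> sobcont s (fun t j => z * a t j) t.
Proof.
move=> z1 ha e e0; have [r r0 h] := ha _ e0; exists r => // t' t'T tt'.
by apply: sobB_sqc (h _ t'T tt') _ => j; rewrite -mulrBr sqcM z1 mul1r.
Qed.

Lemma sobB_between s q (a : coefs) (A B : R) : 0 < q -> q <= s -> sobB 0 a A -> sobB s a B ->
  sobB q a (2 * A + 2 * B).
Proof.
move=> q0 qs hA hB; have := sobB_interp ltr01 (ltW q0) qs q0 hA hB.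
by rewrite !powR1 expr1n !mulr1.
Qed.

Lemma sobcont_between s q a t : 0 < q -> q <= s -> sobcont 0 a t -> sobcont s a t ->
  sobcont q a t.
Proof.
move=> q0 qs h0 hs e e0; have e4 : 0 < e / 4 by rewrite divr_gt0.
have [r1 r10 h1] := h0 _ e4; have [r2 r20 h2] := hs _ e4.
exists (Num.min r1 r2); first by rewrite lt_min r10.
move=> t' t'T; rewrite lt_min => /andP[t1 t2].
apply: sobB_le (sobB_between q0 qs (h1 _ t'T t1) (h2 _ t'T t2)) _; lra.
Qed.

Lemma sobcont_interp s a t (B : R) : 2 < s -> sobcont 0 a t -> sobB s (a t) B ->
  (forall t', 0 <= t' <= T -> sobB s (a t') B) -> sobcont (s - 2) a t.
Proof.
move=> s2 h0 hB hB' e e0; have B0 := sumB_ge0 hB.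
(* The high-frequency part is at most $8B\rho^{-4}\le 8B\rho^{-1}\le e/2$; the $L^2$ distance is
   then taken small relative to this [rho]. *)
pose rho := 1 + 16 * B / e.
have rho1 : 1 <= rho by rewrite lerDl divr_ge0 ?mulr_ge0// ltW.
have rho0 : 0 < rho by exact: lt_le_trans rho1.
pose X := 2 * (rho `^ (s - 2 - 0)) ^+ 2.
have X0 : 0 < X by rewrite mulr_gt0// exprn_gt0// powR_gt0.
have [r r0 h] := h0 (e / (2 * X)) ltac:(by rewrite divr_gt0// mulr_gt0).
exists r => // t' t'T tt'.
apply: sobB_le (sobB_interp rho0 _ _ _ (h t' t'T tt') (sobBB (hB' _ t'T) hB)) _; [lra|lra|lra|].
rewrite -/X (_ : X * (e / (2 * X)) = e / 2); last by field; rewrite gt_eqF.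
rewrite (_ : s - 2 - s = - 2); last by ring.
rewrite powRN powR_mulrn ?(ltW rho0)//.
have hr : (rho ^+ 2)^-1 ^+ 2 <= rho^-1.
  rewrite -exprVn -exprM -[leRHS]expr1; apply: ler_wiXn2l => //.
    by rewrite invr_ge0 ltW.
  by rewrite invf_le1.
have hB2 : rho^-1 * (16 * B) <= e.
  rewrite mulrC ler_pdivrMr// /rho mulrDr mulr1 mulrCA divff ?gt_eqF// mulr1.
  by rewrite lerDr ltW.
have : 16 * B * (rho ^+ 2)^-1 ^+ 2 <= 16 * B * rho^-1 by rewrite ler_wpM2l// mulr_ge0.
move: hB2; rewrite [rho^-1 * _]mulrC; lra.
Qed.

Lemma sobB_shift s (a : coefs) (B : R) : 2 <= s -> sobB s a B ->
  sobB (s - 2) (fun j => (fn j ^+ 2)%:C%C * a j) B.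
Proof.
move=> s2 h; apply: sumB_le h _ (lexx _) => j; rewrite sqcM sqcR mulrA ler_wpM2r ?sqc_ge0//.
have [->|fn0] := eqVneq (fn j) 0.
  by rewrite expr0n/= expr0n/= mulr0 fweight_ge0.
have f0 : 0 < fn j by rewrite lt_neqAle eq_sym fn0 freq_norm_ge0.
rewrite /fweight -exprMn -(powR_mulrn 2 (ltW f0)) -powRD ?(gt_eqF f0) ?implybT//.
by rewrite (_ : s - 2 + _ = s)//; ring.
Qed.

Lemma sobcont_shift s a t : 2 <= s -> sobcont s a t ->
  sobcont (s - 2) (fun t j => (fn j ^+ 2)%:C%C * a t j) t.
Proof.
move=> s2 ha e e0; have [r r0 h] := ha _ e0; exists r => // t' t'T tt'.
by apply: sobB_sqc (sobB_shift s2 (h _ t'T tt')) _ => j; rewrite mulrBr.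
Qed.

Lemma sqc_cisB x y : sqc (cis x - cis y : R[i]) <= (x - y) ^+ 2.
Proof.
have -> : cis x - cis y = cis y * (cis (x - y) - 1).
  by rewrite mulrBr mulr1 -cisD; congr (cis _ - _); ring.
by rewrite sqcM sqc_cis mul1r sqc_cis_sub.
Qed.

(** The free flow is only strongly continuous on $H^s$. A finite set of frequencies carries almost
    all of the norm of [b t]; there the phases are Lipschitz in time, and the rest is small
    uniformly in time. *)
Lemma sobcont_rot s b t (B : R) : sobB s (b t) B -> sobcont s b t ->
  sobcont s (fun t => rot t (b t)) t.
Proof.
move=> bB hb e e0.
have [r1 r10 h1] := hb (e / 4) ltac:(by rewrite divr_gt0).
(* The difference of two rotations costs a factor 4 on the tail, giving $e/8$; the finite part gives
   another $e/8$, and the variation of [b] gives $e/4$ before the final doubling. *)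
have [J uJ hJ] := sumB_tail bB (ltac:(by rewrite divr_gt0) : 0 < e / 32).
pose S := \sum_(j <- J) fn j ^+ 4 * (fweight s j * sqc (b t j)).
have S0 : 0 <= S.
  by apply: sumr_ge0 => j _; rewrite mulr_ge0 ?exprn_even_ge0// mulr_ge0 ?fweight_ge0// sqc_ge0.
have S1 : 0 < 8 * S + 1 by rewrite ltr_wpDl ?mulr_ge0.
pose r2 := Num.sqrt (e / (8 * S + 1)).
have r20 : 0 < r2 by rewrite sqrtr_gt0 divr_gt0.
exists (Num.min r1 r2); first by rewrite lt_min r10.
move=> t' t'T; rewrite lt_min => /andP[t1 t2].
have dt : (t' - t) ^+ 2 * S <= e / 8.
  have := sqr_le_lt_sqrt t2.
  rewrite ler_pdivlMr// => h; have := sqr_ge0 (t' - t); nra.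
have hd : sobB s (fun j => rot t' (b t) j - rot t (b t) j) (e / 4).
  move=> K uK; rewrite (bigID (fun j => j \in J))/=.
  have h1' : \sum_(j <- K | j \in J) fweight s j * sqc (rot t' (b t) j - rot t (b t) j) <= e / 8.
    apply: le_trans dt; rewrite /S mulr_sumr -big_filter.
    apply: (@le_trans _ _ (\sum_(j <- [seq j <- K | j \in J])
        (t' - t) ^+ 2 * (fn j ^+ 4 * (fweight s j * sqc (b t j))))).
      apply: ler_sum => j _; rewrite /rot -mulrBl sqcM.
      have -> : (t' - t) ^+ 2 * (fn j ^+ 4 * (fweight s j * sqc (b t j))) =
        fweight s j * ((fn j ^+ 2 * t' - fn j ^+ 2 * t) ^+ 2 * sqc (b t j)) by ring.
      by rewrite ler_wpM2l ?fweight_ge0// ler_wpM2r ?sqc_ge0// sqc_cisB.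
    apply: ler_sum_sub; [exact: filter_uniq|exact: uJ| |].
      by move=> j; rewrite mem_filter => /andP[].
    move=> j; rewrite mulr_ge0 ?sqr_ge0// mulr_ge0 ?exprn_even_ge0//.
    by rewrite mulr_ge0 ?fweight_ge0// sqc_ge0.
  have h2' : \sum_(j <- K | j \notin J) fweight s j * sqc (rot t' (b t) j - rot t (b t) j) <= e / 8.
    rewrite -big_filter.
    apply: (@le_trans _ _ (4 * \sum_(j <- [seq j <- K | j \notin J]) fweight s j * sqc (b t j))).
      rewrite mulr_sumr; apply: ler_sum => j _; rewrite mulrCA ler_wpM2l ?fweight_ge0//.
      apply: le_trans (sqcB_le _ _) _; rewrite /rot !sqcM !sqc_cis; lra.
    have := hJ _ (filter_uniq (fun j => j \notin J) uK).
    move=> /(_ (fun j => ltac:(by rewrite mem_filter => /andP[]))).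
    by move: (\sum_(_ <- _) _) => Z; lra.
  lra.
have hr : sobB s (fun j => rot t' (b t') j - rot t' (b t) j) (e / 4).
  by apply: sobB_sqc (h1 _ t'T t1) _ => j; rewrite /rot -mulrBr sqcM sqc_cis mul1r.
apply: sobB_le (sobB_sqc (sobBD hr hd) _) (_ : 2 * (e / 4 + e / 4) <= e).
  by move=> j; rewrite addrA subrK.
lra.
Qed.

Lemma synthB_coef (a a' : coefs) (B B' : R) : sobB 0 a B -> sobB 0 a' B' ->
  inL2 (fun x => synth a x - synth a' x) /\
  fhat (fun x => synth a x - synth a' x) = fun j => a j - a' j.
Proof.
move=> /synthP[Ia ea] /synthP[Ia' ea']; split; first exact: inL2B.
by apply/funext => j; rewrite fourier_coefB ?ea ?ea'//; exact: Cint_L2.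
Qed.

Lemma synth_C0H s c (B0 B : R) :
  (forall t, 0 <= t <= T -> sobB 0 (c t) B0) -> (forall t, 0 <= t <= T -> sobB s (c t) B) ->
  (forall t, 0 <= t <= T -> sobcont 0 c t) -> (forall t, 0 <= t <= T -> sobcont s c t) ->
  C0H T s (fun t => synth (c t)).
Proof.
move=> c0 cs k0 ks t; rewrite in_itv/= => tT; split.
  have [Ic ec] := synthP (c0 t tT).
  by apply: (@sobB_inH _ _ _ _ B) => //; rewrite ec; exact: cs.
apply: Hnorm_cvg0 => e e0.
have [r1 r10 h1] := k0 t tT e e0; have [r2 r20 h2] := ks t tT e e0.
apply: (@near_itv_within _ _ (Num.min r1 r2)); first by rewrite lt_min r10.
move=> t' t'T; rewrite lt_min => /andP[t1 t2].
have [Id ed] := synthB_coef (c0 t' t'T) (c0 t tT).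
by split => //; rewrite ed; [exact: h1|exact: h2].
Qed.

(** The mean value inequality is applied to $z\mapsto c(z)-z\,v(t)$, whose derivative $v(z)-v(t)$ is
    small near $t$. Only derivatives at interior times occur, so the endpoints are covered by
    one-sided quotients. *)
Lemma sobcont_deriv s c v t : 0 <= t <= T ->
  (forall j, ccontinuous_within 0 T (fun t => c t j)) ->
  (forall j t, 0 < t < T -> cderive (fun t => c t j) (v t j) t) ->
  sobcont s v t ->
  forall e, 0 < e -> exists2 r : R, 0 < r & forall t', 0 <= t' <= T -> t' != t -> `|t' - t| < r ->
    sobB s (fun j => ((t' - t)^-1)%:C%C * (c t' j - c t j) - v t j) e.
Proof.
move=> tT cc cd kv e e0; have [r r0 h] := kv e e0; exists r => // t' t'T nt tt'.
have [t0 t1] := andP tT; have [t'0 t'1] := andP t'T.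
have key x y : 0 <= x <= T -> 0 <= y <= T -> x <= y -> `|x - t| < r -> `|y - t| < r ->
    sobB s (fun j => (c y j - y%:C%C * v t j) - (c x j - x%:C%C * v t j)) ((y - x) ^+ 2 * e).
  move=> /andP[x0 xT] /andP[y0 yT] xy xt yt K uK.
  apply: (@vector_mean_value _ _ _ (fweight s) (fun j z => c z j - z%:C%C * v t j)
     (fun j z => v z j - v t j)) => //.
  - by move=> j; exact: fweight_ge0.
  - move=> j; apply: ccontinuous_withinD; first exact: ccontinuous_withinS x0 yT (cc j).
    apply/ccontinuous_withinN/ccontinuousW/cderive_ccontinuous => z; exact: cderive_scale.
  - move=> j z /andP[xz zy]; apply: cderiveD; last exact/cderiveN/cderive_scale.
    by apply: cd; rewrite (le_lt_trans x0)//= (lt_le_trans zy).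
  - move=> z /andP[xz zy]; apply: (h z) => //.
      by rewrite (le_trans x0 (ltW xz)) (le_trans (ltW zy) yT).
    move: xt yt; rewrite !ltr_norml => /andP[a1 a2] /andP[b1 b2]; apply/andP; split; lra.
have sq : sobB s (fun j => (c t' j - c t j) - (t' - t)%:C%C * v t j) ((t' - t) ^+ 2 * e).
  have [le|/ltW le] := leP t t'.
    have := key t t' tT t'T le; rewrite subrr normr0 => /(_ r0 tt').
    by move/sobB_sqc; apply=> j; rewrite rmorphB/= le_eqVlt; apply/orP; left; apply/eqP; congr sqc; ring.
  have := key t' t t'T tT le tt'; rewrite subrr normr0 => /(_ r0).
  rewrite -sqrrN opprB; move/sobB_sqc; apply=> j.
  by rewrite sqcB rmorphB/= le_eqVlt; apply/orP; left; apply/eqP; congr sqc; ring.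
have dt0 : t' - t != 0 by rewrite subr_eq0.
have := sumBZ (sqr_ge0 (t' - t)^-1) sq.
move=> /sumB_le; apply.
  move=> j; rewrite mulrCA ler_wpM2l ?fweight_ge0// -sqcR -sqcM [X in _ <= sqc X]mulrBr [_%:C%C * (_%:C%C * _)]mulrA -rmorphM/=.
  by rewrite mulVf// mul1r.
by rewrite mulrA -exprMn mulVf// expr1n mul1r.
Qed.

Lemma synth_derivH s c v (B0 B0' : R) :
  (forall t, 0 <= t <= T -> sobB 0 (c t) B0) ->
  (forall t, 0 <= t <= T -> sobB 0 (v t) B0') ->
  (forall j, ccontinuous_within 0 T (fun t => c t j)) ->
  (forall j t, 0 < t < T -> cderive (fun t => c t j) (v t j) t) ->
  (forall t, 0 <= t <= T -> sobcont 0 v t) -> (forall t, 0 <= t <= T -> sobcont s v t) ->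
  derivH T s (fun t => synth (c t)) (fun t => synth (v t)).
Proof.
move=> c0 v0 cc cd k0 ks t; rewrite in_itv/= => tT.
apply: Hnorm_cvg0 => e e0.
have [r1 r10 h1] := sobcont_deriv tT cc cd (k0 t tT) e0.
have [r2 r20 h2] := sobcont_deriv tT cc cd (ks t tT) e0.
apply: (@near_itv_within_dnbhs _ _ (Num.min r1 r2)); first by rewrite lt_min r10.
move=> t' t'T nt; rewrite lt_min => /andP[t1 t2].
have [Id ed] := synthB_coef (c0 t' t'T) (c0 t tT).
have [Iv ev] := synthP (v0 t tT).
have IZ := inL2Z ((t' - t)^-1)%:C%C Id.
split; first exact: inL2B.
  rewrite (_ : fhat _ = fun j => ((t' - t)^-1)%:C%C * (c t' j - c t j) - v t j); first exact: h1.
  apply/funext => j; rewrite fourier_coefB; [|exact: Cint_L2|exact: Cint_L2].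
  by rewrite fourier_coefZ ?ed ?ev//; exact: Cint_L2.
rewrite (_ : fhat _ = fun j => ((t' - t)^-1)%:C%C * (c t' j - c t j) - v t j); first exact: h2.
apply/funext => j; rewrite fourier_coefB; [|exact: Cint_L2|exact: Cint_L2].
by rewrite fourier_coefZ ?ed ?ev//; exact: Cint_L2.
Qed.

End SobolevContinuity.

Lemma sqc_i (R : realType) : sqc ('i%C : R[i]) = 1.
Proof. by rewrite /sqc/= expr0n expr1n add0r. Qed.

Lemma sqc_sign (R : realType) (b : bool) : sqc ((-1) ^+ b : R[i]) = 1.
Proof. by case: b; rewrite ?expr0 ?expr1 ?sqcN /sqc/= ?expr1n ?expr0n addr0. Qed.

(** * The limit curve gives a solution of the equation *)

Section Solution.
Context {R : realType} {d : nat}.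
Local Notation fn := (@freq_norm R d).
Local Notation coefs := (d.-tuple int -> R[i]).
Local Notation fhat := (@fourier_coef R d).
Variables (sgn : bool) (p : nat) (s s1 q0 q1 A T Bs : R) (f0 : torus_fun R d) (b : R -> coefs).
Hypotheses (s1_ge2 : 2 <= s1) (s1s : s1 + 1 <= s) (T_gt0 : 0 < T).
Hypothesis l1A : forall a : coefs, sobB 0 a (4 * q0) -> sobB s1 a (4 * q1) -> l1B a A.
Hypothesis If0 : inL2 f0.
Hypothesis gb : good p s1 q0 q1 A b.
Local Notation sg := ('i%C * (-1) ^+ sgn : R[i]).
Hypothesis sb : step sg p T (fhat f0) b b.
Hypothesis bBs : forall t, 0 <= t <= T -> sobB s (b t) Bs.

Implicit Types (t : R) (j : d.-tuple int).

Definition sol t : torus_fun R d := synth (rot t (b t)).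

Definition sol_dt_coef t : coefs := fun j =>
  'i%C * ((fn j ^+ 2)%:C%C * rot t (b t) j) + sg * nlhat p (rot t (b t)) j.

Lemma sqc_sg : sqc sg = 1.
Proof. by rewrite sqcM sqc_i mul1r sqc_sign. Qed.

Lemma s_ge3 : 3 <= s.
Proof. by move: s1_ge2 s1s; lra. Qed.

Lemma sol_coef t : fhat (sol t) = rot t (b t) /\ inL2 (sol t).
Proof. by have [] := synthP (good_rot t gb). Qed.

(** The crude product estimate suffices here, since only the finiteness of the Lipschitz constant
    matters for continuity. *)
Lemma b_lip_sob : exists L, forall t t', 0 <= t <= T -> 0 <= t' <= T ->
  sobB s (fun j => b t' j - b t j) (L * (t' - t) ^+ 2).
Proof.
have s0 : 0 <= s by have := s_ge3; lra.
eexists => t t' /andP[t0 tT] /andP[t0' tT'].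
have h x : 0 <= x <= T -> sobB s (rhs sg p b x) ((8 * 4 `^ s) ^+ (2 * p) * A ^+ (4 * p) * Bs).
  move=> xT; apply: (rhs_sob sqc_sg).
  apply: nlhat_sob => //; [exact: good_rot gb|exact: good_l1 gb|].
  by apply: rot_sob; exact: bBs.
have hx x y z : 0 <= x -> y <= T -> x < z < y -> 0 <= z <= T.
  by move=> x0 yT /andP[xz zy]; rewrite (le_trans x0 (ltW xz)) (le_trans (ltW zy)).
rewrite mulrC; have [le|/ltW le] := leP t t'.
  by apply: (step_mv sb t0 le tT') => x xt; apply/h/(hx t t').
rewrite -sqrrN opprB.
apply: sobB_sqc (step_mv sb t0' le tT (B := _) _) _; last by move=> j; rewrite sqcB.
by move=> x xt; apply/h/(hx t' t).
Qed.

Lemma sol_sobcont t : 0 <= t <= T -> sobcont T s (fun t => rot t (b t)) t.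
Proof.
move=> tT; have [L hL] := b_lip_sob; apply: sobcont_rot (bBs tT) _.
by apply: sobcont_lip => t' t'T; exact: hL.
Qed.

Lemma sol_sobcont0 t : 0 <= t <= T -> sobcont T 0 (fun t => rot t (b t)) t.
Proof.
move=> tT; have [h0 _ h2] := gb; apply: sobcont_rot (h0 t) _.
apply: sobcont_lip => t' t'T; rewrite mulrC; exact: h2.
Qed.

Lemma nl_sobcont0 t : sobcont T 0 (fun t => nlhat p (rot t (b t))) t.
Proof.
have [C C0 hC] := good_nlhat_lip s1_ge2 l1A gb.
by apply: (@sobcont_lip _ _ _ _ _ _ C) => t' _; exact: hC.
Qed.

Lemma nl_sobB t : 0 <= t <= T -> sobB s (nlhat p (rot t (b t)))
  ((8 * 4 `^ s) ^+ (2 * p) * A ^+ (4 * p) * Bs).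
Proof.
move=> tT; have s0 : 0 <= s by have := s_ge3; lra.
apply: nlhat_sob => //; [exact: good_rot gb|exact: good_l1 gb|].
by apply: rot_sob; exact: bBs.
Qed.

Lemma nl_sobB0 t : sobB 0 (nlhat p (rot t (b t)))
  ((8 * 4 `^ 0) ^+ (2 * p) * A ^+ (4 * p) * (4 * q0)).
Proof. by apply: nlhat_sob (good_rot t gb) => //; [exact: good_rot gb|exact: good_l1 gb]. Qed.

(** Interpolation between Lipschitz continuity in $L^2$ and boundedness in $H^s$; no difference
    estimate for the nonlinearity in a higher norm is required. *)
Lemma nl_sobcont t : 0 <= t <= T -> sobcont T (s - 2) (fun t => nlhat p (rot t (b t))) t.
Proof.
move=> tT; apply: sobcont_interp (nl_sobcont0 t) (nl_sobB tT) _; first by have := s_ge3; lra.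
by move=> t'; exact: nl_sobB.
Qed.

Lemma sol_dt_sobcont t : 0 <= t <= T -> sobcont T (s - 2) sol_dt_coef t.
Proof.
move=> tT; apply: sobcontD; apply: sobcontZ; rewrite ?sqc_i ?sqc_sg//; last exact: nl_sobcont.
by apply: sobcont_shift (sol_sobcont tT); have := s_ge3; lra.
Qed.

Lemma sol_dt_sobcont0 t : 0 <= t <= T -> sobcont T 0 sol_dt_coef t.
Proof.
move=> tT; apply: sobcontD; apply: sobcontZ; rewrite ?sqc_i ?sqc_sg//; last exact: nl_sobcont0.
have := sobcont_shift (lexx 2) (sobcont_between (ltr0n _ 2) _ (sol_sobcont0 tT) (sol_sobcont tT)).
by rewrite subrr; apply; have := s_ge3; lra.
Qed.

Lemma sol_sob2 : exists B, forall t, 0 <= t <= T -> sobB 2 (rot t (b t)) B.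
Proof.
eexists => t tT; apply: sobB_between (rot_sob t (bBs tT)); last exact: good_rot gb.
  by [].
by have := s_ge3; lra.
Qed.

Lemma sol_dt_sob0 : exists B, forall t, 0 <= t <= T -> sobB 0 (sol_dt_coef t) B.
Proof.
have [B2 hB2] := sol_sob2; eexists => t tT.
apply: sobBD; last by apply: sobB_sqc (nl_sobB0 t) _ => j; rewrite sqcM sqc_sg mul1r.
have := sobB_shift (lexx 2) (hB2 t tT); rewrite subrr => /sobB_sqc; apply => j.
by rewrite sqcM sqc_i mul1r.
Qed.

Lemma sol_dt_sob : exists B, forall t, 0 <= t <= T -> sobB (s - 2) (sol_dt_coef t) B.
Proof.
have s3 := s_ge3; eexists => t tT; apply: sobBD.
  apply: sobB_sqc (sobB_shift _ (rot_sob t (bBs tT))) _; first lra.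
  by move=> j; rewrite sqcM sqc_i mul1r.
have s2 : 0 < s - 2 by lra.
have s2s : s - 2 <= s by lra.
by apply: sobB_sqc (sobB_between s2 s2s (nl_sobB0 t) (nl_sobB tT)) _ => j; rewrite sqcM sqc_sg mul1r.
Qed.

Lemma sol_cderive j t : 0 < t < T -> cderive (fun t => rot t (b t) j) (sol_dt_coef t j) t.
Proof.
move=> tT; have [_ _ _ bd] := sb.
have := cderiveM (cderive_cis (fn j ^+ 2) t) (bd j t tT).
rewrite /sol_dt_coef /rhs; congr (cderive _ _ _).
rewrite -[RHS]addr0.
have e : cis (fn j ^+ 2 * t) * cis (- fn j ^+ 2 * t) = 1 by rewrite mulNr cisNK.
rewrite addr0; congr (_ + _); last first.
  by rewrite -[nlhat _ _ _ in RHS]mul1r -e; ring.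
rewrite /rot !mulrA; congr (_ * _ * _).
by apply: complexP; rewrite ?Re_mul ?Im_mul/=; ring.
Qed.

Lemma sol_ccontinuous j : ccontinuous_within 0 T (fun t => rot t (b t) j).
Proof.
have [_ _ bc _] := sb.
by apply/ccontinuousW/ccontinuousM; [exact: ccontinuous_cis|exact: bc].
Qed.

Lemma sol_NLS : NLS_solution sgn p T s f0 sol.
Proof.
have s3 := s_ge3; have s20 : 0 < s - 2 by lra.
have s2s : s - 2 <= s by lra.
have [h0 _ _] := gb.
have hs t : 0 <= t <= T -> sobB s (rot t (b t)) Bs by move=> tT; exact: rot_sob (bBs tT).
have h0' t : 0 <= t <= T -> sobB 0 (rot t (b t)) (4 * q0) by move=> _; exact: rot_sob.
have [B0' hB0'] := sol_dt_sob0; have [B' hB'] := sol_dt_sob.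
split.
- exact: synth_C0H h0' hs sol_sobcont0 sol_sobcont.
- have [e0 I0] := sol_coef 0.
  apply: fourier_coef_inj; rewrite ?e0; [exact: Cint_L2|exact: Cint_L2|move=> j].
  by rewrite /rot mulr0 cis0 mul1r; have [-> _ _ _] := sb.
- exists (fun t => synth (sol_dt_coef t)).
    split.
    + apply: (@synth_C0H _ _ _ _ _ (4 * q0) _ h0' _ sol_sobcont0) => t tT.
        by apply: sobB_between s20 s2s (h0' t tT) (hs t tT).
      exact: sobcont_between s20 s2s (sol_sobcont0 tT) (sol_sobcont tT).
    + exact: synth_C0H hB0' hB' sol_dt_sobcont0 sol_dt_sobcont.
    + apply: synth_derivH h0' hB0' sol_ccontinuous sol_cderive sol_dt_sobcont0 sol_dt_sobcont.
  move=> t; rewrite in_itv/= => tT; have [et It] := sol_coef t.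
  have [B2 hB2] := sol_sob2.
  pose l := fun j => - ((fn j ^+ 2)%:C%C * rot t (b t) j).
  have l0 : sobB 0 l B2.
    have := sobB_shift (lexx 2) (hB2 t tT); rewrite subrr => /sobB_sqc; apply => j.
    by rewrite sqcN.
  have [Il el] := synthP l0; have [Iv ev] := synthP (hB0' t tT).
  exists (synth l).
    by split => // j; rewrite el et /l rmorphN/= mulNr.
  have IN : inL2 (nl p (sol t)) := inL2_nl p (good_rot t gb) (good_l1 l1A t gb).
  have I1 := inL2Z 'i%C Iv; have I2 := inL2B I1 Il.
  have I3 := inL2Z ((-1) ^+ sgn) IN; have I4 := inL2D I2 I3.
  (* The zero function appears as a multiple of the nonlinear term, so that its coefficients are
     computed by linearity as well. *)
  have Iz := inL2Z 0 IN.
  apply: filterS (fourier_coef_inj (Cint_L2 I4) (Cint_L2 Iz) _) => [x hx|j].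
    by have := hx I; rewrite mul0r.
  rewrite fourier_coefD ?fourier_coefB ?fourier_coefZ ?ev ?el; do ?exact: Cint_L2.
  rewrite mul0r -/(nlhat p (rot t (b t)) j) /sol_dt_coef /l.
  have ii : 'i%C * 'i%C = -1 :> R[i] by apply: complexP; rewrite ?Re_mul ?Im_mul/=; ring.
  have alg (i z w e : R[i]) : i * i = -1 -> i * (i * z + i * e * w) - - z + e * w = 0.
    by move=> h; rewrite mulrDr !mulrA h; ring.
  exact: alg ii.
Qed.

End Solution.

(** * Uniqueness *)

Section CurveCriteria.
Context {R : realType}.

Lemma le_sqr_le (x e : R) : 0 <= e -> x ^+ 2 <= e ^+ 2 -> `|x| <= e.
Proof. by move=> e0; rewrite -real_normK ?num_real// ler_sqr ?nnegrE. Qed.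

Lemma is_derive_eps (h : R -> R) (l t : R) :
  (forall e, 0 < e -> exists2 r : R, 0 < r & forall t', t' != t -> `|t' - t| < r ->
     ((t' - t)^-1 * (h t' - h t) - l) ^+ 2 <= e) ->
  is_derive t (1 : R) h l.
Proof.
move=> H.
have cv : (fun k : R => k^-1 *: (h (k *: (1 : R) + t) - h t)) @ 0^' --> l.
  apply/cvgrPdist_le => e e0; have [r r0 hr] := H (e ^+ 2) (exprn_gt0 2 e0).
  rewrite /dnbhs near_withinE; apply/nbhs_normP; exists r => // k /=.
  rewrite sub0r normrN => kr k0; rewrite distrC; apply: le_sqr_le; first exact: ltW.
  have := hr (k *: (1 : R) + t); rewrite addrK [k *: _]mulr1; apply => //.
  by rewrite -subr_eq0 addrK.
exact: DeriveDef (cvgP _ cv) (cvg_lim _ cv).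
Qed.

Lemma cderive_eps (f : R -> R[i]) (l : R[i]) (t : R) :
  (forall e, 0 < e -> exists2 r : R, 0 < r & forall t', t' != t -> `|t' - t| < r ->
     sqc (((t' - t)^-1)%:C%C * (f t' - f t) - l) <= e) ->
  cderive f l t.
Proof.
move=> H; split; apply: is_derive_eps => e e0; have [r r0 hr] := H e e0; exists r => // t' nt tt'.
  apply: le_trans (hr t' nt tt'); rewrite /sqc ReB Re_mul/= mul0r subr0 ReB.
  by rewrite lerDl sqr_ge0.
apply: le_trans (hr t' nt tt'); rewrite /sqc ImB Im_mul/= mul0r addr0 ImB.
by rewrite lerDr sqr_ge0.
Qed.

Lemma ccontinuous_within_eps (f : R -> R[i]) (T : R) :
  (forall t, 0 <= t <= T -> forall e, 0 < e -> exists2 r : R, 0 < r &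
     forall t', 0 <= t' <= T -> `|t' - t| < r -> sqc (f t' - f t) <= e) ->
  ccontinuous_within 0 T f.
Proof.
move=> H; have key (g : R -> R) :
    (forall t t', (g t' - g t) ^+ 2 <= sqc (f t' - f t)) -> {within `[0, T], continuous g}.
  move=> gf; apply/subspace_continuousP => t /=; rewrite in_itv/= => tT.
  apply/cvgrPdist_le => e e0; have [r r0 hr] := H t tT (e ^+ 2) (exprn_gt0 2 e0).
  apply: (near_itv_within r0) => t' t'T tt'.
  by rewrite distrC; apply: le_sqr_le; [exact: ltW|exact: le_trans (hr t' t'T tt')].
split; apply: key => t t'; rewrite /sqc.
  by rewrite -ReB lerDl sqr_ge0.
by rewrite -ImB lerDr sqr_ge0.
Qed.

End CurveCriteria.

Section Uniqueness.
Context {R : realType} {d : nat}.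
Local Notation fn := (@freq_norm R d).
Local Notation coefs := (d.-tuple int -> R[i]).
Local Notation fhat := (@fourier_coef R d).
Implicit Types (j : d.-tuple int).

(** On a piece of length $h$ with $h^2\Lambda\le 1/4$ and zero initial value, the mean value
    inequality divides any bound by 4; iterating it gives zero. Finitely many pieces cover
    $[0,T]$. *)
Lemma ode_unique (T Lam D0 : R) (g gd : R -> coefs) :
  0 < T -> 0 <= Lam ->
  (forall j, ccontinuous_within 0 T (fun t => g t j)) ->
  (forall j t, 0 < t < T -> cderive (fun t => g t j) (gd t j) t) ->
  (forall t D, 0 < t < T -> sobB 0 (g t) D -> sobB 0 (gd t) (Lam * D)) ->
  (forall t, 0 <= t <= T -> sobB 0 (g t) D0) ->
  sobB 0 (g 0) 0 ->
  forall t, 0 <= t <= T -> sobB 0 (g t) 0.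
Proof.
move=> T0 L0 gc gder gL gD g0.
have D00 : 0 <= D0 by apply: sumB_ge0 (gD 0 _); rewrite lexx ltW.
(* With $n>4\Lambda T^2$ and $n\le n^2$, pieces of length $T/n$ satisfy the smallness condition. *)
pose n := (Num.truncn (4 * Lam * T ^+ 2)).+1.
have n0 : 0 < n%:R :> R by rewrite ltr0n.
pose h := T / n%:R.
have h0 : 0 <= h by rewrite divr_ge0 ?ltW.
have hL : h ^+ 2 * Lam <= 4^-1.
  have n1 : (n%:R : R) <= n%:R ^+ 2 by rewrite -natrX ler_nat expnS expn1 leq_pmulr.
  have le1 : 4 * Lam * T ^+ 2 <= n%:R by apply/ltW/truncnS_gt.
  rewrite /h expr_div_n mulrAC ler_pdivrMr ?exprn_gt0//; lra.
have step (a : R) : 0 <= a -> a + h <= T -> sobB 0 (g a) 0 ->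
    forall t, a <= t <= a + h -> sobB 0 (g t) 0.
  move=> a0 ahT ga.
  have incr (D : R) : 0 <= D -> (forall t, a <= t <= a + h -> sobB 0 (g t) D) ->
      forall t, a <= t <= a + h -> sobB 0 (g t) (4^-1 * D).
    move=> Dge hD t /andP[ta tah].
    have hm : sobB 0 (fun j => g t j - g a j) ((t - a) ^+ 2 * (Lam * D)).
      move=> K uK; apply: (@vector_mean_value _ _ _ (fweight 0) (fun j x => g x j) (fun j x => gd x j)) => //.
      - by move=> j; exact: fweight_ge0.
      - by move=> j; apply: ccontinuous_withinS (gc j); [|exact: le_trans tah ahT].
      - move=> j x /andP[ax xt]; apply: gder.
        by rewrite (le_lt_trans a0 ax)/= (lt_le_trans xt)// (le_trans tah).
      - move=> x /andP[ax xt]; apply: gL => //.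
          by rewrite (le_lt_trans a0 ax)/= (lt_le_trans xt)// (le_trans tah).
        by apply: hD; rewrite (ltW ax) (le_trans (ltW xt)).
    have ga0 := sobB_eq0 ga.
    apply: sobB_le (sobB_sqc hm _) _ => [j|]; first by rewrite ga0 subr0.
    rewrite mulrA ler_wpM2r// (le_trans _ hL)// ler_wpM2r// ler_sqr ?nnegrE ?subr_ge0//; lra.
  have geo m : forall t, a <= t <= a + h -> sobB 0 (g t) (D0 * (4^-1) ^+ m).
    elim: m => [|m ih] t tah.
      by rewrite expr0 mulr1; apply: gD; case/andP: tah => h1 h2; rewrite (le_trans a0 h1) (le_trans h2).
    rewrite exprS mulrCA; apply: incr tah => //.
    by rewrite mulr_ge0// exprn_ge0// invr_ge0.
  move=> t tah K uK; apply: (@le_geometric_bound _ _ D0) => m; rewrite add0r; exact: geo.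
have iter k : (k <= n)%N -> forall t, 0 <= t <= k%:R * h -> sobB 0 (g t) 0.
  elim: k => [_ t|k ih kn t /andP[t0 tk]].
    by rewrite mul0r => te; rewrite (_ : t = 0)//; apply/eqP; rewrite eq_le andbC.
  have [le|/ltW lt] := leP t (k%:R * h); first by apply: ih; rewrite ?t0// ltnW.
  apply: (step (k%:R * h)); first by rewrite mulr_ge0.
  - rewrite -[X in _ + X]mul1r -mulrDl natr1 /h mulrCA ger_pMr// ler_pdivrMr// mul1r.
    by rewrite ler_nat.
  - by apply: ih; [exact: ltnW|rewrite lexx andbT mulr_ge0].
  - by rewrite lt/=; move: tk; rewrite -natr1 mulrDl mul1r.
move=> t /andP[t0 tT]; apply: (iter n (leqnn n)).
by rewrite t0/= /h mulrCA divff ?gt_eqF// mulr1.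
Qed.

Variable T : R.

(** Compactness of $[0,T]$: near each time, continuity gives the bound $2(B+1)$, and finitely many
    neighbourhoods suffice. *)
Lemma sobB_unif s (a : R -> coefs) :
  (forall t, 0 <= t <= T -> exists B, sobB s (a t) B) ->
  (forall t, 0 <= t <= T -> sobcont T s a t) ->
  exists B, forall t, 0 <= t <= T -> sobB s (a t) B.
Proof.
move=> aB ac; have := @segment_compact R 0 T => /compact_near_coveringP/near_covering_withinP.
move=> /(_ R (pinfty_nbhs R) (fun B t => sobB s (a t) B) _) H.
have : \forall B \near +oo, `[0, T] `<=` (fun t => sobB s (a t) B).
  apply: H => t; rewrite /= in_itv/= => tT.
  have [B hB] := aB t tT; have [r r0 hr] := ac t tT 1 ltr01.
  exists ([set x | `|t - x| < r], [set C | 2 * (B + 1) < C]) => /=.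
    split; first by apply/nbhs_normP; exists r.
    apply: nbhs_pinfty_gt; exact: num_real.
  move=> [t' C]/= [tt' BC]; rewrite in_itv/= => t'T.
  rewrite distrC in tt'.
  apply: sobB_le (sobB_sqc (sobBD hB (hr t' t'T tt')) _) (ltW BC).
  by move=> j; rewrite addrC subrK.
move=> /filter_ex[B hB]; exists B => t tT.
by apply: hB; rewrite /= in_itv.
Qed.

Section Coefficients.
Variables (sgn : bool) (p : nat) (s s0 C0 : R) (u0 : torus_fun R d) (u : R -> torus_fun R d).
Hypotheses (s0s : s0 <= s) (s0_gt0 : 0 < s0).
Hypothesis hC0 : sumB (fun j => (1 + fn j ^+ 2) `^ (- s0)) C0.
Hypothesis hu : NLS_solution sgn p T s u0 u.

Lemma NLS_inH t : 0 <= t <= T -> inH s (u t).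
Proof. by move=> tT; case: hu => h _ _; case: (h t); rewrite ?in_itv. Qed.

Lemma C0H_sobcont q (v : R -> torus_fun R d) t : C0H T q v -> 0 <= t <= T ->
  sobcont T 0 (fun t => fhat (v t)) t /\ sobcont T q (fun t => fhat (v t)) t.
Proof.
move=> hv tT.
have Iv t' : 0 <= t' <= T -> inL2 (v t') by move=> t'T; case: (hv t'); rewrite ?in_itv// => -[].
suff H e : 0 < e -> exists2 r : R, 0 < r & forall t', 0 <= t' <= T -> `|t' - t| < r ->
    sobB 0 (fun j => fhat (v t') j - fhat (v t) j) e /\
    sobB q (fun j => fhat (v t') j - fhat (v t) j) e.
  by split => e e0; have [r r0 h] := H e e0; exists r => // t' t'T tt'; case: (h t' t'T tt').
move=> e0; have [_ cv] := hv t ltac:(by rewrite in_itv).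
have IvB : \forall t' \near within `[0, T] (nbhs t), inL2 (fun x => v t' x - v t x).
  by apply: (near_itv_within ltr01) => t' t'T _; apply: inL2B; exact: Iv.
have [r r0 hr] := within_near_itv (Hnorm_cvg0_sob _ IvB cv e0).
exists r => // t' t'T tt'; have := hr t' t'T tt'.
suff -> : fhat (fun x => v t' x - v t x) = (fun j => fhat (v t') j - fhat (v t) j) by [].
by apply/funext => j; rewrite fourier_coefB//; apply: Cint_L2; exact: Iv.
Qed.

Lemma NLS_unif : exists B0 A, forall t, 0 <= t <= T ->
  sobB 0 (fhat (u t)) B0 /\ l1B (fhat (u t)) A.
Proof.
have [cu _ _] := hu.
have [B0 hB0] : exists B, forall t, 0 <= t <= T -> sobB 0 (fhat (u t)) B.
  apply: sobB_unif => t tT; first by eexists; exact: inH_sob0 (NLS_inH tT).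
  by have [] := C0H_sobcont cu tT.
have [B hB] : exists B, forall t, 0 <= t <= T -> sobB s (fhat (u t)) B.
  apply: sobB_unif => t tT; first exact: inH_sobB (NLS_inH tT).
  by have [] := C0H_sobcont cu tT.
exists B0; eexists => t tT; split; first exact: hB0.
by apply: l1B_sob (ltW s0_gt0) hC0 (hB0 t tT) (sobB_between s0_gt0 s0s (hB0 t tT) (hB t tT)).
Qed.

Lemma NLS_coef_continuous j : ccontinuous_within 0 T (fun t => fhat (u t) j).
Proof.
have [cu _ _] := hu.
apply: ccontinuous_within_eps => t tT e e0; have [h _] := C0H_sobcont cu tT.
have [r r0 hr] := h e e0; exists r => // t' t'T tt'.
exact: sobB_single (hr t' t'T tt').
Qed.

(** Convergence of the difference quotients in $H^{s-2}$ includes $L^2$ convergence, hence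
    convergence of each coefficient; the a.e. equation then identifies the coefficient of the time
    derivative. *)
Lemma NLS_coef_derive j t : 0 < t < T -> cderive (fun t => fhat (u t) j)
  ('i%C * ((fn j ^+ 2)%:C%C * fhat (u t) j) + 'i%C * (-1) ^+ sgn * fhat (nl p (u t)) j) t.
Proof.
move=> /andP[t0 t1]; have tT : 0 <= t <= T by rewrite !ltW.
have [_ _ [ut [_ cut dut] heq]] := hu.
have tI : t \in `[0, T] by rewrite in_itv.
have Iu t' : 0 <= t' <= T -> inL2 (u t') by move=> /NLS_inH[].
have Iut : inL2 (ut t) by case: (cut t tI) => -[].
have [B0 [A hBA]] := NLS_unif.
have IN : inL2 (nl p (u t)).
  by rewrite nlE; have [_ l1] := hBA t tT; case: (fpow_l1 (2 * p) (Iu t tT) l1).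
have [Lu [ILu eLu] ae] := heq t tI.
have I1 := inL2Z 'i%C Iut; have I2 := inL2B I1 ILu.
have I3 := inL2Z ((-1) ^+ sgn) IN; have I4 := inL2D I2 I3.
have := @fourier_coef_ae _ _ _ _ j (Cint_L2 I4) (Cint0 (d := d)).
rewrite fourier_coef0 fourier_coefD ?fourier_coefB ?fourier_coefZ ?eLu; do ?exact: Cint_L2.
move=> eqj; have {}eqj := eqj ltac:(by apply: filterS ae => x h _; exact: h).
rewrite (_ : _ + _ = fhat (ut t) j); last first.
  move: eqj; rewrite !rmorphN/= mulNr.
  have ii : 'i%C * 'i%C = -1 :> R[i] by apply: complexP; rewrite ?Re_mul ?Im_mul/=; ring.
  have alg (i z w e v : R[i]) : i * i = -1 -> i * v - - z + e * w = 0 -> i * z + i * e * w = v.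
    move=> h E; have -> : i * z + i * e * w = i * (i * v - - z + e * w) - i * i * v by ring.
    by rewrite E h; ring.
  exact: alg ii.
apply: cderive_eps => e e0.
have IvB : \forall t' \near within `[0, T] (t^'),
    inL2 (fun x => ((t' - t)^-1)%:C%C * (u t' x - u t x) - ut t x).
  apply: (near_itv_within_dnbhs ltr01) => t' t'T _ _.
  by apply: inL2B => //; apply: inL2Z; apply: inL2B; exact: Iu.
have [r r0 hr] := within_dnbhs_near_itv (Hnorm_cvg0_sob _ IvB (dut t tI) e0).
(* The radius keeps $t'$ inside $[0,T]$, so that the one-sided notion of [derivH] yields a two-sided
   derivative. *)
exists (Num.min r (Num.min t (T - t))); first by rewrite !lt_min r0 t0 subr_gt0.
move=> t' nt; rewrite !lt_min => /and3P[tr]; rewrite !ltr_norml => /andP[a1 _] /andP[_ a2].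
have t'T : 0 <= t' <= T by apply/andP; split; lra.
have [h _] := hr t' t'T nt tr.
have := sobB_single j h.
rewrite fourier_coefB ?fourier_coefZ ?fourier_coefB//; do ?[exact: Cint_L2|apply: Cint_L2].
- exact: Iu.
- exact: Iu.
- by apply: inL2B; exact: Iu.
- by apply: inL2Z; apply: inL2B; exact: Iu.
Qed.

End Coefficients.

(** Rotating the difference of the coefficients back by the free flow removes the linear term; the
    remaining derivative is Lipschitz in $\ell^2$, both solutions having a uniform $\ell^1$ bound,
    and [ode_unique] applies. *)
Lemma NLS_unique sgn p s s0 C0 (u0 : torus_fun R d) (u v : R -> torus_fun R d) :
  0 < T -> s0 <= s -> 0 < s0 ->
  sumB (fun j => (1 + fn j ^+ 2) `^ (- s0)) C0 ->
  NLS_solution sgn p T s u0 u -> NLS_solution sgn p T s u0 v ->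
  forall t, t \in `[0, T] -> v t = u t %[ae torus_measure d].
Proof.
move=> T0 s0s s00 hC0 hu hv t; rewrite in_itv/= => tT.
have Iu x : 0 <= x <= T -> inL2 (u x) by move=> /(NLS_inH hu)[].
have Iv x : 0 <= x <= T -> inL2 (v x) by move=> /(NLS_inH hv)[].
have [Bu [Au hAu]] := NLS_unif s0s s00 hC0 hu.
have [Bv [Av hAv]] := NLS_unif s0s s00 hC0 hv.
have z0 : 0 <= (0 : R) <= T by rewrite lexx ltW.
have Au0 : 0 <= Au by have [_ h] := hAu 0 z0; exact: sumB_ge0 h.
have Av0 : 0 <= Av by have [_ h] := hAv 0 z0; exact: sumB_ge0 h.
pose g x : coefs := fun j => cis (- fn j ^+ 2 * x) * (fhat (u x) j - fhat (v x) j).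
pose gd x : coefs := fun j => cis (- fn j ^+ 2 * x) *
  ('i%C * (-1) ^+ sgn * (fhat (nl p (u x)) j - fhat (nl p (v x)) j)).
have gE x D : sobB 0 (g x) D -> sobB 0 (fun j => fhat (u x) j - fhat (v x) j) D.
  by move=> /sobB_sqc; apply => j; rewrite sqcM sqc_cis mul1r.
have gz : sobB 0 (g t) 0.
  apply: (@ode_unique T (((2 * p).+1%:R * (Au + Av) ^+ (2 * p)) ^+ 2) (2 * (Bu + Bv)) g gd) => //.
  - exact: sqr_ge0.
  - move=> j; apply: ccontinuous_withinM; first exact/ccontinuousW/ccontinuous_cis.
    apply: ccontinuous_withinD; first exact: NLS_coef_continuous hu j.
    exact/ccontinuous_withinN/(NLS_coef_continuous hv).
  - move=> j x xT.
    have du := NLS_coef_derive s0s s00 hC0 hu j xT; have dv := NLS_coef_derive s0s s00 hC0 hv j xT.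
    have := cderiveM (cderive_cis (- fn j ^+ 2) x) (cderiveD du (cderiveN dv)).
    congr (cderive _ _ _); rewrite /gd.
    have -> : (0 +i* - fn j ^+ 2)%C = - ('i%C * (fn j ^+ 2)%:C%C) :> R[i].
      by apply: complexP; rewrite ?ReN ?ImN ?Re_mul ?Im_mul/=; ring.
    ring.
  - move=> x D /andP[x0 xT] /gE hD; have xI : 0 <= x <= T by rewrite !ltW.
    have [_ lu] := hAu x xI; have [_ lv] := hAv x xI.
    have lu' : l1B (fhat (u x)) (Au + Av) by apply: sumB_le lu _ _ => //; rewrite lerDl.
    have lv' : l1B (fhat (v x)) (Au + Av) by apply: sumB_le lv _ _ => //; rewrite lerDr.
    apply: sobB_sqc (nl_lip p (Iu x xI) (Iv x xI) lu' lv' hD) _ => j.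
    by rewrite /gd !sqcM sqc_cis mul1r sqc_i sqc_sign !mul1r.
  - move=> x xI; have [bu _] := hAu x xI; have [bv _] := hAv x xI.
    by apply: sobB_sqc (sobBB bu bv) _ => j; rewrite sqcM sqc_cis mul1r.
  - apply/sobB0 => K _; rewrite big1// => j _.
    have [_ u00 _] := hu; have [_ v00 _] := hv.
    have uv0 : v 0 = u 0 %[ae torus_measure d].
      by apply: filterS2 u00 v00 => x E1 E2 _; rewrite E1// E2.
    rewrite /g (fourier_coef_ae _ _ _ uv0) ?subrr ?mulr0 ?sqc0//; apply: Cint_L2; [exact: Iv|exact: Iu].
apply: fourier_coef_inj => [||j]; [exact: Cint_L2 (Iv t tT)|exact: Cint_L2 (Iu t tT)|].
apply/esym/subr0_eq.
by have := congr1 (fun f => f j) (sobB_eq0 (gE t 0 gz)).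
Qed.

End Uniqueness.

(** * Choice of the constants *)

Section Constants.
Context {R : realType}.
Variables (K2 M s0 s1 eps : R) (p : nat).
Hypotheses (K2_gt0 : 0 < K2) (K2M : K2 <= M) (M32 : 32 <= M) (s0_gt0 : 0 < s0)
  (s0s1 : s0 + 2 <= s1) (eps_gt0 : 0 < eps) (p_gt0 : (0 < p)%N).

Local Notation A := (Num.sqrt K2 * eps * (2 * M) `^ (s0 - s1)).
Local Notation T := (T_good s0 M p s1 eps).

Lemma M_gt0 : 0 < M. Proof. by apply: lt_le_trans M32. Qed.

Lemma powR_ge_exprn (x : R) (y : R) (n : nat) : 1 <= x -> n%:R <= y -> x ^+ n <= x `^ y.
Proof.
move=> x1 ny; rewrite -powR_mulrn ?(le_trans ler01)//.
by apply: ler_powR.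
Qed.

Lemma A_gt0 : 0 < A.
Proof. by have M0 := M_gt0; rewrite mulr_gt0 ?powR_gt0 ?mulr_gt0 ?sqrtr_gt0. Qed.

Lemma T_good_gt0 : 0 < T.
Proof.
have M0 := M_gt0; rewrite /T_good mulr_gt0 ?divr_gt0 ?powR_gt0//.
by rewrite invr_gt0 exprn_gt0.
Qed.

Lemma A_expr : A ^+ (2 * p) = K2 ^+ p * eps ^+ (2 * p) *
  ((2 `^ (2 * p%:R * (s1 - s0)))^-1 * M `^ (2 * p%:R * s0) * M `^ (- (2 * p%:R * s1))).
Proof.
have M0 := M_gt0.
rewrite !exprMn exprM sqr_sqrtr ?(ltW K2_gt0)//; congr (_ * _).
rewrite -powR_mulrn ?powR_ge0// -powRrM powRM ?(ltW M0)//.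
rewrite -mulrA -powRD ?(gt_eqF M0) ?implybT// -powRN natrM.
by congr (_ `^ _ * _ `^ _); ring.
Qed.

Lemma TA_expr : T * A ^+ (2 * p) = K2 ^+ p * M `^ (- (2 * p%:R * s1)) / 2 ^+ (4 * (2 * p + 2)).
Proof.
rewrite A_expr /T_good; have M0 := M_gt0.
have := powR_gt0 (2 * p%:R * (s1 - s0)) (ltr0n R 2).
have := powR_gt0 (2 * p%:R * s0) M0.
have := exprn_gt0 (2 * p) eps_gt0.
have : 0 < 2 ^+ (4 * (2 * p + 2)) :> R by rewrite exprn_gt0.
move: (_ `^ (2 * p%:R * (s1 - s0))) (_ `^ (2 * p%:R * s0)) (eps ^+ _) (2 ^+ _) => a b c e e0 c0 b0 a0.
by field; rewrite !gt_eqF.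
Qed.

(** One factor $M^{-ps_1}$ pays for $K_2^p$, since $K_2\le M$ and $s_1\ge 1$. *)
Lemma K2_powR : K2 ^+ p * M `^ (- (p%:R * s1)) <= 1.
Proof.
have M0 := M_gt0; rewrite powRN ler_pdivrMr ?powR_gt0// mul1r.
apply: (@le_trans _ _ (M ^+ p)); first by apply: lerXn2r; rewrite // nnegrE ltW.
apply: powR_ge_exprn; first by move: M32; lra.
by rewrite ler_peMr//; move: s0_gt0 s0s1; lra.
Qed.

(** The squared power of $M$ consists of four factors $m=M^{-ps_1}$: two pay for $K_2^{2p}$, one for
    $4^{2ps_1}=16^{ps_1}$, and the last is at most one. Of the two factors $2^{-(8p+8)}$, one pays
    for $8^{2p}$ and the other gives $1/8$. *)
Lemma small_product : T ^+ 2 * ((8 * 4 `^ s1) ^+ (2 * p) * A ^+ (4 * p)) <= 8^-1.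
Proof.
have M0 := M_gt0.
have -> : A ^+ (4 * p) = (A ^+ (2 * p)) ^+ 2 by rewrite -exprM; congr (_ ^+ _); ring.
rewrite mulrCA -exprMn TA_expr.
have -> : M `^ (- (2 * p%:R * s1)) = M `^ (- (p%:R * s1)) * M `^ (- (p%:R * s1)).
  by rewrite -powRD ?(gt_eqF M0) ?implybT//; congr (_ `^ _); ring.
have m1 : M `^ (- (p%:R * s1)) <= 1.
  rewrite powRN invf_le1 ?powR_gt0// -[leLHS](powRr0 M) ler_powR//; first by move: M32; lra.
  by rewrite mulr_ge0//; move: s0_gt0 s0s1; lra.
have h1 := K2_powR.
have h2 : (4 `^ s1) ^+ (2 * p) * M `^ (- (p%:R * s1)) <= 1.
  have -> : (4 `^ s1) ^+ (2 * p) = 16 `^ (p%:R * s1).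
    rewrite -powR_mulrn ?powR_ge0// -powRrM (_ : 16 = 4 `^ 2%:R).
      by rewrite -powRrM natrM; congr (_ `^ _); ring.
    by rewrite powR_mulrn//; ring.
  rewrite powRN ler_pdivrMr ?powR_gt0// mul1r.
  have ps0 : 0 <= p%:R * s1 by rewrite mulr_ge0//; move: s0_gt0 s0s1; lra.
  by apply: ge0_ler_powR => //; rewrite ?nnegrE//; move: M32; lra.
have h3 : 8 ^+ (2 * p) <= 2 ^+ (4 * (2 * p + 2)) :> R.
  rewrite (_ : 8 = 2 ^+ 3); last by ring.
  by rewrite -exprM ler_eXn2l ?ltr1n//; lia.
have h4 : 8 <= 2 ^+ (4 * (2 * p + 2)) :> R.
  rewrite (_ : 8 = 2 ^+ 3); last by ring.
  by rewrite ler_eXn2l ?ltr1n//; lia.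
have k0 : 0 <= K2 ^+ p by rewrite exprn_ge0// ltW.
rewrite exprMn; move: (8 ^+ _) (exprn_ge0 (2 * p) (ler0n R 8)) h3 => Z Z0 h3.
move: (_ ^+ (2 * p)) (exprn_ge0 (2 * p) (powR_ge0 4 s1)) h2 => W W0 h2.
move: (2 ^+ _) h3 h4 => N ZN N8; have N0 : 0 < N by lra.
move: (M `^ _) (powR_ge0 M (- (p%:R * s1))) h1 h2 m1 => m m0 h1 h2 m1.
move: (K2 ^+ p) k0 h1 => k k0 h1.
have -> : Z * W * (k * (m * m) / N) ^+ 2 = (k * m) ^+ 2 * (W * m) * m * (Z / N) * N^-1.
  by field; rewrite gt_eqF.
have km : (k * m) ^+ 2 <= 1 by rewrite expr_le1 ?mulr_ge0.
have ZN1 : Z / N <= 1 by rewrite ler_pdivrMr// mul1r.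
have N8' : N^-1 <= 8^-1 by rewrite lef_pV2// ?posrE; lra.
apply: le_trans N8'; rewrite ger_pMl ?invr_gt0//.
have W1 : 0 <= W * m by rewrite mulr_ge0.
have V1 : 0 <= (k * m) ^+ 2 * (W * m) by rewrite mulr_ge0 ?sqr_ge0.
apply: mulr_ile1 => //; [by rewrite mulr_ge0|by rewrite divr_ge0// ltW|].
by apply: mulr_ile1 => //; apply: mulr_ile1 => //; exact: sqr_ge0.
Qed.

Lemma small_product0 : T ^+ 2 * ((8 * 4 `^ 0) ^+ (2 * p) * A ^+ (4 * p)) <= 4^-1.
Proof.
apply: le_trans (_ : 8^-1 <= 4^-1); last by lra.
apply: le_trans small_product; rewrite ler_wpM2l ?sqr_ge0// ler_wpM2r ?exprn_ge0 ?(ltW A_gt0)//.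
apply: lerXn2r; rewrite ?nnegrE ?mulr_ge0 ?powR_ge0// ler_wpM2l// ler_powR//; first by lra.
by move: s0_gt0 s0s1; lra.
Qed.

Lemma four_powR_s1 : 16 <= 4 `^ s1.
Proof.
rewrite (_ : 16 = 4 ^+ 2); last by ring.
by apply: powR_ge_exprn; [lra|move: s0_gt0 s0s1; lra].
Qed.

Lemma small_productL : T ^+ 2 * ((2 * p).+1%:R * A ^+ (2 * p)) ^+ 2 <= 4^-1.
Proof.
apply: le_trans (_ : 8^-1 <= 4^-1); last by lra.
apply: le_trans small_product; rewrite ler_wpM2l ?sqr_ge0// exprMn.
have -> : A ^+ (4 * p) = (A ^+ (2 * p)) ^+ 2 by rewrite -exprM; congr (_ ^+ _); ring.
rewrite ler_wpM2r ?sqr_ge0//.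
apply: (@le_trans _ _ ((2 ^+ (2 * p)) ^+ 2)).
  by rewrite ler_sqr ?nnegrE ?exprn_ge0// -natrX ler_nat ltn_expl.
rewrite exprAC lerXn2r ?nnegrE ?sqr_ge0 ?mulr_ge0 ?powR_ge0//.
by have := four_powR_s1; lra.
Qed.

Lemma small_productT : T ^+ 2 * (A ^+ (4 * p) * 32 ^+ (2 * p)) <= 8^-1.
Proof.
apply: le_trans small_product; rewrite ler_wpM2l ?sqr_ge0// mulrC.
rewrite ler_wpM2r ?exprn_ge0 ?(ltW A_gt0)//.
by apply: lerXn2r; rewrite ?nnegrE ?mulr_ge0 ?powR_ge0//; have := four_powR_s1; lra.
Qed.

Local Notation rate s t := (M `^ (2 * p%:R * (s - s1)) *
  (2 ^+ (4 * p) * M `^ (2 * p%:R * s0) / 2 `^ (2 * p%:R * (s1 - s0))) * eps ^+ (2 * p) * t).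

(** This is the interpolation parameter of the $H^s$ estimate, with $A_1/A=2M$. Of the two factors
    $M^{ps}$ in the rate, one absorbs $16^{ps}$. The other is at least $M^{3p}$ since $s\ge 3$, and
    pays for $K_2^p$, for $M$ and, together with $2^{4p}$, for $8\cdot 64^p$. *)
Lemma growth_le_rate s t : s1 + 1 <= s -> 0 <= t ->
  4 * t * A ^+ (2 * p) * (64 * 16 `^ s) ^+ p * (2 * M) <= rate s t.
Proof.
move=> s1s t0; have M0 := M_gt0; have M1 : 1 <= M by move: M32; lra.
have s0' := s0_gt0; have s3 : 3 <= s by move: s0s1; lra.
rewrite A_expr.
have -> : M `^ (2 * p%:R * (s - s1)) =
    M `^ (p%:R * s) * M `^ (p%:R * s) * M `^ (- (2 * p%:R * s1)).
  by rewrite -!powRD ?(gt_eqF M0) ?implybT//; congr (_ `^ _); ring.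
have h1 : (16 `^ s) ^+ p <= M `^ (p%:R * s).
  rewrite -powR_mulrn ?powR_ge0// -powRrM mulrC.
  have ps0 : 0 <= p%:R * s by rewrite mulr_ge0//; lra.
  by apply: ge0_ler_powR => //; rewrite ?nnegrE//; move: M32; lra.
have h2 : (M ^+ p) ^+ 3 <= M `^ (p%:R * s).
  by rewrite -exprM; apply: powR_ge_exprn => //; rewrite natrM ler_wpM2l.
have h3 : K2 ^+ p <= M ^+ p by apply: lerXn2r; rewrite // nnegrE ltW.
have h4 : M <= M ^+ p by rewrite -[leLHS]expr1 ler_weXn2l.
(* For $p=1$ this reads $8\cdot 64\le 16M$, which is an equality at $M=32$. *)
have h5 : 8 * 64 ^+ p <= M ^+ p * 2 ^+ (4 * p).
  rewrite exprM -exprMn; apply: (@le_trans _ _ ((8 * 64) ^+ p)).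
    by rewrite exprMn ler_wpM2r ?exprn_ge0// -[leLHS]expr1 ler_weXn2l//; lra.
  by apply: lerXn2r; rewrite ?nnegrE//; move: M32; rewrite ?exprS ?expr0; lra.
rewrite exprMn.
have := powR_gt0 (2 * p%:R * (s1 - s0)) (ltr0n R 2).
have := powR_gt0 (2 * p%:R * s0) M0.
have := powR_gt0 (- (2 * p%:R * s1)) M0.
have e0 := exprn_gt0 (2 * p) eps_gt0.
have k0 : 0 < K2 ^+ p by rewrite exprn_gt0.
have Mp0 : 0 < M ^+ p by rewrite exprn_gt0.
have w0 : 0 <= (16 `^ s) ^+ p by rewrite exprn_ge0 ?powR_ge0.
have z0 : 0 < 64 ^+ p :> R by rewrite exprn_gt0.
have y0 : 0 < 2 ^+ (4 * p) :> R by rewrite exprn_gt0.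
move: (_ `^ (2 * p%:R * (s1 - s0))) (_ `^ (2 * p%:R * s0)) (M `^ - _) => a b c c0 b0 a0.
move: (eps ^+ _) e0 => e e0.
move: (K2 ^+ p) k0 h3 => k k0 h3; move: (64 ^+ p) z0 h5 => z z0 h5.
move: ((16 `^ s) ^+ p) w0 h1 => w w0 h1; move: (2 ^+ (4 * p)) y0 h5 => y y0 h5.
move: (M `^ (p%:R * s)) h1 h2 => G h1 h2; move: (M ^+ p) Mp0 h2 h3 h4 h5 => m m0 h2 h3 h4 h5.
have -> : 4 * t * (k * e * (a^-1 * b * c)) * (z * w) * (2 * M) =
   (e * a^-1 * b * c * t) * (8 * z * k * w * M) by ring.
have -> : G * G * c * (y * b / a) * e * t = (e * a^-1 * b * c * t) * (G * G * y) by ring.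
have G0 : 0 <= G := le_trans w0 h1.
apply: ler_wpM2l; first by rewrite !mulr_ge0 ?invr_ge0 ?(ltW e0) ?(ltW a0) ?(ltW b0) ?(ltW c0).
apply: (@le_trans _ _ (m * y * m * G * m)).
  have z0' := ltW z0; have k0' := ltW k0; have M0' := ltW M0.
  have n1 : 0 <= 8 * z by rewrite mulr_ge0.
  have n2 : 0 <= 8 * z * k by rewrite mulr_ge0.
  have n3 : 0 <= 8 * z * k * w by rewrite mulr_ge0.
  by apply: ler_pM => //; apply: ler_pM => //; apply: ler_pM.
rewrite (_ : m * y * m * G * m = (m ^+ 3 * G) * y); last by ring.
by apply: ler_wpM2r; [exact: ltW|exact: ler_wpM2r].
Qed.

(** At $t=T_{good}$ the factor after the power of $M$ reduces to $2^{4p}/2^{8p+8}\le 1$. *)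
Lemma rate_le s t : s1 + 1 <= s -> 0 <= t -> t <= T -> rate s t <= M `^ (2 * p%:R * (s - s1)).
Proof.
move=> s1s t0 tT; have M0 := M_gt0.
rewrite -(mulrA (M `^ _)) -(mulrA (M `^ _)) ger_pMr ?powR_gt0//.
apply: (@le_trans _ _ (2 ^+ (4 * p) * M `^ (2 * p%:R * s0) / 2 `^ (2 * p%:R * (s1 - s0)) *
   eps ^+ (2 * p) * T)).
  by rewrite ler_wpM2l// !mulr_ge0 ?invr_ge0 ?powR_ge0 ?exprn_ge0// ltW.
rewrite /T_good.
have h : 2 ^+ (4 * p) <= 2 ^+ (4 * (2 * p + 2)) :> R by rewrite ler_eXn2l ?ltr1n//; lia.
have := powR_gt0 (2 * p%:R * (s1 - s0)) (ltr0n R 2).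
have := powR_gt0 (2 * p%:R * s0) M0.
have e0 := exprn_gt0 (2 * p) eps_gt0.
have : 0 < 2 ^+ (4 * (2 * p + 2)) :> R by rewrite exprn_gt0.
move: h; move: (_ `^ (2 * p%:R * (s1 - s0))) (_ `^ (2 * p%:R * s0)) (2 ^+ (4 * p)) (2 ^+ (4 * (2 * p + 2))) (eps ^+ _) e0 => a b y N e e0 yN N0 b0 a0.
have -> : y * b / a * e * (e^-1 * N^-1 * (a / b)) = y / N.
  by field; rewrite !gt_eqF.
by rewrite ler_pdivrMr// mul1r.
Qed.

Section Families.
Context {d : nat}.
Variable Cl : R.
Hypothesis hCl : sumB (fun j : d.-tuple int => (1 + freq_norm j ^+ 2) `^ (- s0)) Cl.
Hypothesis K2E : K2 = 32 * 2 `^ s0 * Cl.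
Variables (q0 q1 : R) (a : d.-tuple int -> R[i]).
Hypotheses (q0le : q0 <= eps ^+ 2 * ((2 * M) `^ (- s1)) ^+ 2) (q1le : q1 <= eps ^+ 2).
Hypotheses (a0 : sobB 0 a (4 * q0)) (a1 : sobB s1 a (4 * q1)).

Lemma rho_gt0 : 0 < 2 * M. Proof. by rewrite mulr_gt0// M_gt0. Qed.

Lemma rho_ge1 : 1 <= 2 * M. Proof. by move: M32; lra. Qed.

(** At $\rho=2M$ the two smallness assumptions balance: each of the two interpolation terms is at
    most $8\varepsilon^2(2M)^{2(q-s_1)}$. *)
Lemma weighted_interp q : 0 < q -> q <= s1 ->
  sobB q a (16 * eps ^+ 2 * ((2 * M) `^ (q - s1)) ^+ 2).
Proof.
move=> q0' qs1; have r0 := rho_gt0.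
apply: sobB_le (sobB_interp r0 (ltW q0') qs1 q0' a0 a1) _.
rewrite subr0.
have e : (2 * M) `^ (q - s1) = (2 * M) `^ q * (2 * M) `^ (- s1).
  by rewrite -powRD ?(gt_eqF r0) ?implybT.
have h1 := ler_wpM2l (sqr_ge0 ((2 * M) `^ q)) q0le.
have h2 := ler_wpM2l (sqr_ge0 ((2 * M) `^ (q - s1))) q1le.
have : ((2 * M) `^ q) ^+ 2 * q0 <= eps ^+ 2 * ((2 * M) `^ (q - s1)) ^+ 2.
  by apply: le_trans h1 _; rewrite e exprMn mulrCA.
lra.
Qed.

Lemma family_l1 : l1B a A.
Proof.
have r1 := rho_ge1; have r0 := rho_gt0; have s0' := s0_gt0.
have s01 : s0 <= s1 by move: s0s1; lra.
set X := eps ^+ 2 * ((2 * M) `^ (s0 - s1)) ^+ 2.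
have a0' : sobB 0 a (4 * X).
  apply: sobB_le a0 _; rewrite ler_wpM2l//; apply: le_trans q0le _.
  rewrite ler_wpM2l ?sqr_ge0// ler_sqr ?nnegrE ?powR_ge0// ler_powR//; lra.
have as0 := weighted_interp s0' s01; rewrite -mulrA -/X in as0.
apply: sumB_le (l1B_sob (ltW s0') hCl a0' as0) _ _ => //.
have X0 : 0 <= X by rewrite mulr_ge0 ?sqr_ge0.
have C0 : 0 <= Cl by exact: sumB_ge0 hCl.
have -> : A = Num.sqrt (K2 * X).
  rewrite sqrtrM ?(ltW K2_gt0)// /X -exprMn sqrtr_sqr ger0_norm ?mulrA//.
  by rewrite mulr_ge0 ?powR_ge0// ltW.
rewrite ler_wsqrtr// K2E.
have := mulr_ge0 (mulr_ge0 C0 (powR_ge0 2 s0)) X0; lra.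
Qed.

(** One derivative costs $2M$, the interpolation frequency. The two weighted bounds with constant 16
    add up to the 32 in [K2]. *)
Lemma family_l1grad : l1gradB a (A * (2 * M)).
Proof.
have r1 := rho_ge1; have r0 := rho_gt0; have s0' := s0_gt0.
set X := eps ^+ 2 * ((2 * M) `^ (s0 - s1)) ^+ 2.
have X0 : 0 <= X by rewrite mulr_ge0 ?sqr_ge0.
have h1 : sobB 1 a (16 * (X * (2 * M) ^+ 2)).
  apply: sobB_le (weighted_interp ltr01 _) _; first by move: s0s1; lra.
  rewrite -mulrA ler_wpM2l// /X -mulrA ler_wpM2l ?sqr_ge0// -exprMn.
  rewrite ler_sqr ?nnegrE ?mulr_ge0 ?powR_ge0 ?(ltW M_gt0)//.
  rewrite -[X in _ <= _ * X](powRr1 (ltW r0)) -powRD ?(gt_eqF r0) ?implybT// ler_powR//; lra.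
have h2 : sobB (s0 + 1) a (16 * (X * (2 * M) ^+ 2)).
  apply: sobB_le (weighted_interp _ _) _; [lra|by move: s0s1; lra|].
  rewrite -mulrA ler_wpM2l// /X -mulrA ler_wpM2l ?sqr_ge0// -exprMn.
  rewrite ler_sqr ?nnegrE ?mulr_ge0 ?powR_ge0 ?(ltW M_gt0)//.
  by rewrite -[X in _ <= _ * X](powRr1 (ltW r0)) -powRD ?(gt_eqF r0) ?implybT// ler_powR//; lra.
have := l1gradB_sob s0' hCl h1 h2 (lexx _).
move=> /sumB_le; apply => //.
have C0 : 0 <= Cl by exact: sumB_ge0 hCl.
have -> : A * (2 * M) = Num.sqrt (K2 * (X * (2 * M) ^+ 2)).
  rewrite sqrtrM ?(ltW K2_gt0)// /X -!exprMn sqrtr_sqr ger0_norm ?mulrA//.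
  by rewrite !mulr_ge0 ?powR_ge0// ltW// M_gt0.
rewrite ler_wsqrtr// K2E; set Y := X * _; lra.
Qed.

End Families.

End Constants.

(** Conversion of squared bounds into norms. The assumption on [q] lets the second root be dominated
    by $2\sqrt y+2r(\sqrt x+\sqrt y)$, as squaring shows. *)
Lemma sqrt_bound (R : realType) (x y q r : R) : 0 <= x -> 0 <= y -> 0 <= q -> 0 <= r ->
  q <= 2 * x + 2 * y ->
  Num.sqrt (4 * x) + Num.sqrt (4 * y + 2 * r ^+ 2 * q) <=
  2 * (Num.sqrt x + Num.sqrt y) * (1 + r).
Proof.
move=> x0 y0 q0 r0 qxy.
have sx := sqrtr_ge0 x; have sy := sqrtr_ge0 y.
have ex : x = Num.sqrt x ^+ 2 by rewrite sqr_sqrtr.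
have ey : y = Num.sqrt y ^+ 2 by rewrite sqr_sqrtr.
move: (Num.sqrt x) (Num.sqrt y) ex ey sx sy => a b ex ey a0 b0.
have -> : Num.sqrt (4 * x) = 2 * a.
  by rewrite ex (_ : 4 * a ^+ 2 = (2 * a) ^+ 2) ?sqrtr_sqr ?ger0_norm ?mulr_ge0//; ring.
have h : Num.sqrt (4 * y + 2 * r ^+ 2 * q) <= 2 * b + 2 * r * (a + b).
  rewrite -[leRHS]ger0_norm ?addr_ge0 ?mulr_ge0 ?addr_ge0// -sqrtr_sqr ler_wsqrtr//.
  have := ler_wpM2l (sqr_ge0 r) qxy; rewrite ex ey => h.
  have := mulr_ge0 a0 b0; have := mulr_ge0 r0 (mulr_ge0 b0 (addr_ge0 a0 b0)).
  have := mulr_ge0 (sqr_ge0 r) (mulr_ge0 a0 b0); nra.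
have := mulr_ge0 r0 (addr_ge0 a0 b0); lra.
Qed.

(** * From the data to the final estimate *)

Section Data.
Context {R : realType} {d : nat}.
Local Notation P := ((2 * pi : R) ^+ d).

Lemma P_ge1 : 1 <= P.
Proof. by rewrite exprn_ege1//; have := @pi_ge2 R; lra. Qed.

(** The volume $P$ of the torus is at least one, so dividing by it preserves the bounds on the
    squared norms. *)
Lemma data_bounds (s1 eps rho : R) (u0 g1 : torus_fun R d) : 0 < rho -> 0 <= eps ->
  inL2 u0 -> is_sqrt_laplacian s1 u0 g1 ->
  (Hnorm s1 u0 <= eps%:E)%E -> ((rho `^ s1)%:E * L2norm u0 <= eps%:E)%E ->
  P^-1 * n2 u0 <= eps ^+ 2 * (rho `^ (- s1)) ^+ 2 /\ P^-1 * n2 g1 <= eps ^+ 2.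
Proof.
move=> rho0 eps0 I0 I1; rewrite (HnormE I0 I1) L2normE// -EFinM !lee_fin => h1 h2.
have P1 := P_ge1; have P0 : 0 < P by exact: lt_le_trans P1.
have sx := sqrtr_ge0 (n2 u0); have sy := sqrtr_ge0 (n2 g1).
have hP x : 0 <= x -> P^-1 * x <= x by move=> x0; rewrite ler_piMl ?invf_le1.
split.
  apply: le_trans (hP _ (n2_ge0 _)) _; rewrite -exprMn -[leLHS]sqr_sqrtr ?n2_ge0//.
  by rewrite ler_sqr ?nnegrE ?mulr_ge0 ?powR_ge0// powRN ler_pdivlMr ?powR_gt0// mulrC.
apply: le_trans (hP _ (n2_ge0 _)) _; rewrite -[leLHS]sqr_sqrtr ?n2_ge0//.
by rewrite ler_sqr ?nnegrE//; lra.
Qed.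

End Data.

Theorem theorem1p1 (R : realType) (d : nat) (s0 : R)
    (hd : (1 <= d)%N) (hs0 : d%:R / 2 < s0) :
  exists eps0 C M : R,
    [/\ 0 < eps0, eps0 < 1, 0 < M & M <= C] /\
    forall (sgn : bool) (p : nat) (s1 eps : R) (u0 : torus_fun R d),
      (1 <= p)%N -> s0 + 2 <= s1 -> 0 < eps -> eps <= eps0 ->
      inH s1 u0 ->
      (Hnorm s1 u0 <= eps%:E)%E ->
      (((2 * M) `^ s1)%:E * L2norm u0 <= eps%:E)%E ->
      exists T : R, [/\ 0 < T, T_good s0 M p s1 eps <= T &
        forall s : R, s1 + 1 <= s -> inH s u0 ->
          exists u : R -> torus_fun R d,
          [/\ NLS_solution sgn p T s u0 u,
              (forall v : R -> torus_fun R d,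
                 NLS_solution sgn p T s u0 v ->
                 forall t, t \in `[0, T] -> v t = u t %[ae torus_measure d]),
              (forall t, t \in `[0, T] ->
                 (Hnorm s (u t) <=
                    (3 * C `^ (p%:R * s * (s - s1)))%:E *
                    (Hnorm s u0 + ((2 * M) `^ s)%:E * L2norm u0) *
                    (1 + (M `^ (2 * p%:R * (s - s1)) *
                          (2 ^+ (4 * p) * M `^ (2 * p%:R * s0) /
                             2 `^ (2 * p%:R * (s1 - s0))) *
                          eps ^+ (2 * p) * t) `^ (s - s1))%:E)%E) &
              (forall That : R, That <= T_good s0 M p s1 eps ->
                 (ereal_sup [set Hnorm s (u t) | t in `[0%R, That]] <=
                    (3 * C `^ (p%:R * s * (s - s1)))%:E *
                    (Hnorm s u0 + ((2 * M) `^ s)%:E * L2norm u0) *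
                    (1 + M `^ (2 * p%:R * (s - s1) ^+ 2))%:E)%E)]].
Proof.
have [Cl Cl0 hCl] := lattice_sum hd hs0.
have s0_gt0 : 0 < s0 by apply: le_lt_trans hs0; rewrite divr_ge0.
pose K2 := 32 * 2 `^ s0 * Cl; have K20 : 0 < K2 by rewrite !mulr_gt0 ?powR_gt0.
(* The summand 32 pays for the numerical factors of the product estimates and [K2] for the embedding
   constant; the sum is fixed before [p], [s1], [eps] and [s]. *)
pose M := 32 + K2.
have K2M : K2 <= M by rewrite /M; lra.
have M32 : 32 <= M by rewrite /M; lra.
(* With [C] equal to [M] the prefactor is a power at least one, so that the constant 2 of
   [sqrt_bound] passes below it. *)
exists 2^-1, M, M; split; first by split; [lra|lra|lra|].
move=> sgn p s1 eps u0 p0 s0s1 eps0 _ iH1 hH1 hL2.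
have [I0 _] := iH1; have [g1 hg1] := inH_sqrt_laplacian iH1.
have s12 : 2 <= s1 by lra.
have rho0 : 0 < 2 * M by lra.
have [q0le q1le] := data_bounds rho0 (ltW eps0) I0 hg1 hH1 hL2.
set q0 := _ * n2 u0 in q0le; set q1 := _ * n2 g1 in q1le.
have u0q0 : sobB 0 (fourier_coef u0) q0 := inH_sob0 iH1.
have u0q1 : sobB s1 (fourier_coef u0) q1 := sqrt_laplacian_sobB hg1.
pose A := Num.sqrt K2 * eps * (2 * M) `^ (s0 - s1).
have A0 : 0 < A := A_gt0 _ _ K20 M32 eps0.
pose T := T_good s0 M p s1 eps.
have T0 : 0 < T := T_good_gt0 _ _ _ M32 eps0.
have l1A (a : d.-tuple int -> R[i]) : sobB 0 a (4 * q0) -> sobB s1 a (4 * q1) -> l1B a A.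
  exact: (family_l1 K20 M32 s0_gt0 s0s1 eps0 hCl erefl q0le q1le).
have l1gA (a : d.-tuple int -> R[i]) :
    sobB 0 a (4 * q0) -> sobB s1 a (4 * q1) -> l1gradB a (A * (2 * M)).
  exact: (family_l1grad K20 M32 s0_gt0 s0s1 eps0 hCl erefl q0le q1le).
have K0 : T ^+ 2 * ((8 * 4 `^ 0) ^+ (2 * p) * A ^+ (4 * p)) <= 4^-1.
  exact: small_product0.
have K1 : T ^+ 2 * ((8 * 4 `^ s1) ^+ (2 * p) * A ^+ (4 * p)) <= 4^-1.
  apply: le_trans (small_product K20 K2M M32 s0_gt0 s0s1 eps0 p0) _; lra.
have KL : T ^+ 2 * ((2 * p).+1%:R * A ^+ (2 * p)) ^+ 2 <= 4^-1 by exact: small_productL.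
have KT : T ^+ 2 * (A ^+ (4 * p) * 32 ^+ (2 * p)) <= 8^-1 by exact: small_productT.
have sg1 := @sqc_sg R sgn.
have [b_ [b_0 gb_ sb_]] := iterates_exist sg1 s12 T0 l1A K0 K1 u0q0 u0q1.
have [b hb] := iterates_cvg sg1 T0 l1A KL u0q0 gb_ sb_.
have gb := good_lim gb_ hb.
have sb := step_lim sg1 s12 T0 l1A KL u0q0 gb_ sb_ hb.
(* The curve [b] is already built when [s] is introduced, so the same time serves every [s]. *)
exists T; split => //.
move=> s s1s iHs; have [gs hgs] := inH_sqrt_laplacian iHs.
set rate := fun t : R => M `^ (2 * p%:R * (s - s1)) *
  (2 ^+ (4 * p) * M `^ (2 * p%:R * s0) / 2 `^ (2 * p%:R * (s1 - s0))) * eps ^+ (2 * p) * t.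
pose Q := ((2 * pi) ^+ d)^-1 * n2 gs.
have uQ : sobB s (fourier_coef u0) Q := sqrt_laplacian_sobB hgs.
have q10 : 0 <= q1 := sumB_ge0 u0q1.
have m0 : 0 <= s - s1 by lra.
have rate0 t : 0 <= t -> 0 <= rate t.
  by move=> t0; rewrite /rate !mulr_ge0 ?invr_ge0 ?powR_ge0 ?exprn_ge0 ?(ltW eps0).
have bs t : 0 <= t <= T -> sobB s (b t) (4 * Q + 2 * (rate t `^ (s - s1)) ^+ 2 * q1).
  move=> tT; have A10 : 0 < A * (2 * M) by rewrite mulr_gt0.
  have [t0 _] := andP tT.
  apply: sobB_le (limit_sob sg1 s12 T0 l1A KL u0q0 u0q1 l1gA A0 A10 KT s1s uQ tT b_0 gb_ sb_ hb) _.
  rewrite lerD2l ler_wpM2r// ler_wpM2l// ler_sqr ?nnegrE ?powR_ge0//.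
  rewrite [A * (2 * M) / A]mulrAC divff ?gt_eqF// mul1r.
  apply: ge0_ler_powR => //; rewrite ?nnegrE ?rate0//; last exact: growth_le_rate.
  apply: mulr_ge0 (ltW rho0); apply: mulr_ge0.
    by apply: mulr_ge0; [rewrite mulr_ge0|rewrite exprn_ge0 ?(ltW A0)].
  by rewrite exprn_ge0// mulr_ge0 ?powR_ge0.
have rateM t : 0 <= t <= T -> rate t <= M `^ (2 * p%:R * (s - s1)).
  by move=> /andP[t0 tT]; exact: (rate_le K20 K2M M32 s0_gt0 s0s1 eps0 p0 s1s t0 tT).
have ratepow t : 0 <= t <= T -> rate t `^ (s - s1) <= M `^ (2 * p%:R * (s - s1) ^+ 2).
  move=> tT; have [t0 _] := andP tT.
  apply: le_trans (ge0_ler_powR m0 _ _ (rateM t tT)) _; rewrite ?nnegrE ?rate0 ?powR_ge0//.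
  by rewrite -powRrM expr2 mulrA.
have bBs t : 0 <= t <= T ->
    sobB s (b t) (4 * Q + 2 * (M `^ (2 * p%:R * (s - s1) ^+ 2)) ^+ 2 * q1).
  move=> tT; apply: sobB_le (bs t tT) _.
  by rewrite lerD2l ler_wpM2r// ler_wpM2l// ler_sqr ?nnegrE ?powR_ge0// ratepow.
have solu := sol_NLS s12 s1s l1A I0 gb sb bBs.
have C1 : 1 <= M `^ (p%:R * s * (s - s1)).
  rewrite -[leLHS](powRr0 M) ler_powR//; first lra.
  by rewrite !mulr_ge0//; lra.
(* Any majorant [E] of the growth factor is allowed, so as to serve both the estimate at each time
   and the uniform one. *)
have est t (E : R) : 0 <= t <= T -> rate t `^ (s - s1) <= E ->
    (Hnorm s (sol b t) <= (3 * M `^ (p%:R * s * (s - s1)))%:E *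
      (Hnorm s u0 + ((2 * M) `^ s)%:E * L2norm u0) * (1 + E)%:E)%E.
  move=> tT rE; have [et It] := sol_coef gb t; have [t0 _] := andP tT.
  have := @Hnorm_le _ _ s _ (4 * q0) _ It; rewrite et => /(_ _ (good_rot t gb) (rot_sob t (bs t tT))).
  move=> /le_trans; apply; rewrite (HnormE I0 hgs) L2normE//.
  change (((Num.sqrt ((2 * pi) ^+ d * (4 * q0)) +
      Num.sqrt ((2 * pi) ^+ d * (4 * Q + 2 * (rate t `^ (s - s1)) ^+ 2 * q1)))%:E <=
    (3 * M `^ (p%:R * s * (s - s1)) * (Num.sqrt (n2 u0) + Num.sqrt (n2 gs) +
      (2 * M) `^ s * Num.sqrt (n2 u0)) * (1 + E))%:E)%E).
  rewrite lee_fin.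
  have Pg : 0 < (2 * pi) ^+ d :> R by exact: P_gt0.
  have -> : (2 * pi) ^+ d * (4 * q0) = 4 * n2 u0 by rewrite /q0 mulrCA mulVKf ?gt_eqF.
  rewrite mulrDr [X in Num.sqrt (X + _)]mulrCA mulVKf ?gt_eqF//.
  rewrite [X in Num.sqrt (_ + X)]mulrCA mulVKf ?gt_eqF//.
  have r0 : 0 <= rate t `^ (s - s1) by exact: powR_ge0.
  (* Interpolation at parameter one bounds the $H^{s_1}$ part of the datum by its $L^2$ and $H^s$
     parts, which removes it from the final estimate. *)
  have q1Q : n2 g1 <= 2 * n2 u0 + 2 * n2 gs.
    have := sqrt_laplacian_n2_le hg1 (sobB_between _ _ u0q0 uQ).
    have s10 : 0 < s1 by lra.
    have s1s' : s1 <= s by lra.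
    move=> /(_ s10 s1s'); rewrite mulrDr !(mulrCA _ 2) !mulVKf ?gt_eqF//.
  apply: le_trans (sqrt_bound (n2_ge0 _) (n2_ge0 _) (n2_ge0 _) r0 q1Q) _.
  have x0 := sqrtr_ge0 (n2 u0); have y0 := sqrtr_ge0 (n2 gs).
  have z0 : 0 <= (2 * M) `^ s * Num.sqrt (n2 u0) by rewrite mulr_ge0 ?powR_ge0.
  apply: ler_pM; rewrite ?mulr_ge0 ?addr_ge0//; last by rewrite lerD2l.
  apply: ler_pM; rewrite ?addr_ge0//; last by rewrite lerDl.
  lra.
exists (sol b); split.
- exact: solu.
- move=> v hv t tT; have ss0 : s0 <= s by lra.
  exact: NLS_unique T0 ss0 s0_gt0 hCl solu hv t tT.
- by move=> t; rewrite in_itv/= => tT; exact: est (lexx _).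
- move=> That hThat; apply/ereal_supP => _ [t tI <-].
  move: tI; rewrite /= in_itv/= => /andP[t0 tT].
  have tT' : 0 <= t <= T by rewrite t0 (le_trans tT).
  exact: est (ratepow t tT').
Qed.
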